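(* All-Target CoinChange can be solved deterministically in $O((u+t)\,\mathrm{polylog}(u))$ time.
   Context: All-Target CoinChange: the input consists of positive integers $n,u,t$ and integers $w_1,\dots,w_n\in[1,u]$. A solution to a sum $c$ is a vector $(m_1,\dots,m_n)\in\mathbb{N}^n$ with $c=\sum_{i=1}^n w_im_i$. For each integer $c\in[1,t]$ the output is the maximum of $-\sum_{i=1}^n m_i$ over all solutions $(m_1,\dots,m_n)$ to sum $c$ (i.e. minus the minimum number of coins needed), or $-\infty$ if no solution to $c$ exists.
   Formalization: Since repeated weights are allowed, n may far exceed u+t and merely reading the input breaks the stated bound; the proved time is O((u+t) polylog(u) + max(n-u,0)), which is the stated bound when n ≤ u, in particular for distinct weights. *)

(* Defs.v *)
From mathcomp Require Import all_boot all_order all_algebra.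
Set Implicit Arguments.
Unset Strict Implicit.
Unset Printing Implicit Defensive.

(** * Word RAM

    Deterministic word RAM with [W]-bit words, unit cost per operation, random
    access memory, and structured control flow instead of jumps (a structured
    program is a special case of a jump program of the same cost, up to a
    constant factor).  Programs are closed syntactic objects that do not depend
    on [W] or on the input, so a fixed program is a uniform algorithm.  Each
    program mentions finitely many registers; all data of unbounded size has to
    live in memory. *)

Inductive binop :=
  | OAdd | OSub | OMul | ODiv | OMod | OLt | OEq
  | OAnd | OOr | OXor | OShl | OShr.

Inductive expr :=
  | Const of nat
  | Reg of nat
  | Read of expr
  | Bin of binop & expr & expr.

Inductive cmd :=
  | Skip
  | Assign of nat & expr
  | Store of expr & expr
  | Seq of cmd & cmd
  | If of expr & cmd & cmd
  | While of expr & cmd.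

Record state := State { regs : nat -> nat; mem : nat -> nat }.

Definition upd (f : nat -> nat) (a v : nat) : nat -> nat :=
  fun b => if b == a then v else f b.

(** Unsigned arithmetic modulo [2 ^ W]; [ODiv] and [OMod] by zero return [0] and
    the dividend, respectively. *)
Definition eval_binop (W : nat) (o : binop) (x y : nat) : nat :=
  match o with
  | OAdd => (x + y) %% 2 ^ W
  | OSub => (x + (2 ^ W - y %% 2 ^ W)) %% 2 ^ W
  | OMul => (x * y) %% 2 ^ W
  | ODiv => x %/ y
  | OMod => x %% y
  | OLt => x < y
  | OEq => x == y
  | OAnd => Nat.land x y
  | OOr => Nat.lor x y
  | OXor => Nat.lxor x y
  | OShl => (x * 2 ^ y) %% 2 ^ W
  | OShr => x %/ 2 ^ y
  end.

Fixpoint eval (W : nat) (s : state) (e : expr) : nat :=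
  match e with
  | Const k => k %% 2 ^ W
  | Reg r => regs s r
  | Read e1 => mem s (eval W s e1)
  | Bin o e1 e2 => eval_binop W o (eval W s e1) (eval W s e2)
  end.

Fixpoint ecost (e : expr) : nat :=
  match e with
  | Const _ | Reg _ => 1
  | Read e1 => (ecost e1).+1
  | Bin _ e1 e2 => (ecost e1 + ecost e2).+1
  end.

(** [exec W p s s' T]: with [W]-bit words, [p] started in [s] halts in [s']
    after exactly [T] time units. *)
Inductive exec (W : nat) : cmd -> state -> state -> nat -> Prop :=
  | ExecSkip s : exec W Skip s s 1
  | ExecAssign r e s :
      exec W (Assign r e) s (State (upd (regs s) r (eval W s e)) (mem s))
           (ecost e).+1
  | ExecStore e1 e2 s :
      exec W (Store e1 e2) s
           (State (regs s) (upd (mem s) (eval W s e1) (eval W s e2)))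
           (ecost e1 + ecost e2).+1
  | ExecSeq p q s1 s2 s3 T1 T2 :
      exec W p s1 s2 T1 -> exec W q s2 s3 T2 ->
      exec W (Seq p q) s1 s3 (T1 + T2)
  | ExecIfTrue e p q s s' T :
      eval W s e != 0 -> exec W p s s' T ->
      exec W (If e p q) s s' (ecost e + T).+1
  | ExecIfFalse e p q s s' T :
      eval W s e = 0 -> exec W q s s' T ->
      exec W (If e p q) s s' (ecost e + T).+1
  | ExecWhileTrue e p s1 s2 s3 T1 T2 :
      eval W s1 e != 0 -> exec W p s1 s2 T1 -> exec W (While e p) s2 s3 T2 ->
      exec W (While e p) s1 s3 (ecost e + T1 + T2).+1
  | ExecWhileFalse e p s :
      eval W s e = 0 -> exec W (While e p) s s (ecost e).+1.

Lemma exec_deterministic (W : nat) (p : cmd) (s s1 : state) (T1 : nat) :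
  exec W p s s1 T1 ->
  forall (s2 : state) (T2 : nat), exec W p s s2 T2 -> s1 = s2 /\ T1 = T2.
Proof.
elim=> {p s s1 T1}; intros;
  match goal with H : exec _ _ _ _ _ |- ?a = ?b /\ _ =>
    match type of H with exec _ _ _ b _ => inversion H; subst end end;
  repeat match goal with
  | IH : forall (s2 : state) (T2 : nat), exec W ?q ?s s2 T2 -> _,
    H : exec W ?q ?s _ _ |- _ => case: (IH _ _ H) => ? ?; clear IH; subst
  | H : is_true (?x != 0), H' : ?x = 0 |- _ => by rewrite H' in H
  end; by [].
Qed.

(** Bit length of [x] for [x > 0]. *)
Definition bitlen (x : nat) : nat := (trunc_log 2 x).+1.

(** * All-Target CoinChange *)

Definition valid_instance (n u t : nat) (w : n.-tuple nat) : Prop :=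
  [/\ 0 < n, 0 < u, 0 < t & forall i : 'I_n, 1 <= tnth w i <= u].

Definition solution (n : nat) (w : n.-tuple nat) (c : nat) (m : n.-tuple nat) :
  Prop := c = \sum_(i < n) tnth w i * tnth m i.

Definition objective (n : nat) (m : n.-tuple nat) : int :=
  (- (\sum_(i < n) tnth m i)%:Z)%R.

(** [None] stands for minus infinity. *)
Definition is_optimum (n : nat) (w : n.-tuple nat) (c : nat) (v : option int) :
  Prop :=
  match v with
  | Some z =>
      (exists2 m, solution w c m & z = objective m) /\
      (forall m, solution w c m -> (objective m <= z)%R)
  | None => forall m, ~ solution w c m
  end.

(** [n], [u], [t] are passed in registers [0], [1], [2] and [w_i] in memory
    cell [i], for [1 <= i <= n]; everything else is zero. *)
Definition input_state (n u t : nat) (w : n.-tuple nat) : state :=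
  State (nth 0 [:: n; u; t]) (nth 0 (0 :: w)).

(** Two's complement; the most negative word stands for minus infinity. *)
Definition word_of (W : nat) (v : option int) : nat :=
  match v with
  | Some z => absz (modz z (2 ^ W)%:Z)
  | None => 2 ^ W.-1
  end.

(** The answer for target [c] is in memory cell [c], for [1 <= c <= t]. *)
Definition correct_output (W n t : nat) (w : n.-tuple nat) (s : state) : Prop :=
  forall c : nat, 1 <= c <= t ->
    exists2 v : option int, is_optimum w c v & mem s c = word_of W v.

(* Main.v *)
Require Import Defs.
From mathcomp Require Import all_boot all_order all_algebra all_field.
From mathcomp Require Import zify ring.
Set Implicit Arguments.
Unset Strict Implicit.
Unset Printing Implicit Defensive.
Import Order.TTheory GRing.Theory Num.Theory.

(** Let b be the bit length of u, f(c) the least number of coins summing to c,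
    and W(c) the set of coins occurring in an optimal solution of c, that is,
    the coins w with f(c - w) = f(c) - 1.  Rank the coins injectively; the
    canonical solution of c uses the top-ranked coin w of W(c) and continues with
    the canonical solution of c - w.  Exchanging two sets of distinct coins with
    equal cardinality and sum shows that a canonical solution contains fewer than
    h = 8b distinct coins.  Hence, if f(c) >= h, some coin w occurs twice in it,
    so that w also occurs in the canonical solution of c - w: a forward dynamic
    program that pushes from each target b' only along the distinct coins of its
    canonical solution takes O(h) time per target, once f and the top coins are
    known for the targets with f(c) <= h, which are at most hu.

    These small targets are arranged in cells c + f(c) M with M = hu + 1.  The
    convolution of this indicator with a function x on the coins returns the sum
    of x over W(c), at cell c + (f(c) - 1) M; with x the indicator of the coins
    it yields the targets with f(c) = k + 1 from those with f(c) = k.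

    Randomly ranking the coins would make the top coins computable by isolation;
    deterministically, the ranks come from nested sets A_0 > A_1 > ... of coins,
    each at most half of the preceding one.  The rank of a coin is dominated by
    the last i with w in A_i.  If W(c) meets A_i in at most Q coins, some prime
    p <= P isolates the largest of them modulo p, and the queries for x = A_i
    restricted to each residue class find it.  If it meets A_i in more than Q
    coins, A_{i+1} has to meet W(c): A_{i+1} is a union of residue classes of A_i
    chosen greedily, K passes over all classes each halving the number of targets
    that are not yet hit, and an averaging argument over the primes up to P
    (Chebyshev) bounds its size.

    Convolutions modulo 2^W are computed by Nussbaumer's algorithm, whose result
    is the convolution times a power of two. *)

(** * A loop language on arrays *)

Inductive aop := Ad | Su | Mu | Di | Mo | Lt | Eq | MA | MS | MM | Sr | Sl.

Inductive aexp :=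
  | Nu of nat
  | Va of nat
  | Ar of nat & aexp
  | Op of aop & aexp & aexp.

(* Cell [i] of array [j < 32] is the memory cell [j + 32 * i] above the offset held
   in register 0; [GetR] and [PutR] access the memory below the offset.  In
   [Fo r rb c] the register [r] runs from 0 to the value of [rb]. *)
Inductive acmd :=
  | Nop
  | Set_ of nat & aexp
  | Put of nat & aexp & aexp
  | GetR of nat & aexp
  | PutR of aexp & aexp
  | Sq of acmd & acmd
  | Cn of aexp & acmd & acmd
  | Fo of nat & nat & acmd.

Record astate := AState
  { rg : nat -> nat; av : nat -> nat -> nat; rw : nat -> nat }.

Definition setr (a : astate) (r v : nat) :=
  AState (upd (rg a) r v) (av a) (rw a).
Definition seta (a : astate) (j i v : nat) :=
  AState (rg a) (fun j' => if j' == j then upd (av a j) i v else av a j') (rw a).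
Definition setw (a : astate) (i v : nat) :=
  AState (rg a) (av a) (upd (rw a) i v).

Definition ev_op (W : nat) (o : aop) (x y : nat) : nat :=
  match o with
  | Ad => x + y
  | Su => x - y
  | Mu => x * y
  | Di => x %/ y
  | Mo => x %% y
  | Lt => x < y
  | Eq => x == y
  | MA => (x + y) %% 2 ^ W
  | MS => (x + (2 ^ W - y %% 2 ^ W)) %% 2 ^ W
  | MM => (x * y) %% 2 ^ W
  | Sr => x %/ 2 ^ y
  | Sl => (x * 2 ^ y) %% 2 ^ W
  end.

Fixpoint ev (W : nat) (a : astate) (e : aexp) : nat :=
  match e with
  | Nu k => k
  | Va r => rg a r
  | Ar j e1 => av a j (ev W a e1)
  | Op o e1 e2 => ev_op W o (ev W a e1) (ev W a e2)
  end.

(* If [deg e = d <= 12] then [e] evaluates below [lim ^ d]; the degree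
   99 stands for a full machine word.  Arrays 24 to 31 hold machine words, the
   others hold numbers below [lim]. *)
Fixpoint deg (e : aexp) : nat :=
  match e with
  | Nu k => 1
  | Va r => 1
  | Ar j _ => if j < 24 then 1 else 99
  | Op o e1 e2 =>
    match o with
    | Ad => (maxn (deg e1) (deg e2)).+1
    | Mu => deg e1 + deg e2
    | Su | Di | Mo | Sr => deg e1
    | Lt | Eq => 1
    | MA | MS | MM | Sl => 99
    end
  end.

Fixpoint chk (e : aexp) : bool :=
  match e with
  | Nu k => k <= 124
  | Va r => true
  | Ar j e1 => [&& j < 32, chk e1 & deg e1 <= 8]
  | Op o e1 e2 =>
    [&& chk e1, chk e2 & match o with Ad | Mu => deg e <= 12 | _ => true end]
  end.

Fixpoint cexp (e : aexp) : expr :=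
  match e with
  | Nu k => Const k
  | Va r => Reg r
  | Ar j e1 => Read (Bin OAdd (Bin OAdd (Reg 0) (Const j))
                              (Bin OMul (Const 32) (cexp e1)))
  | Op o e1 e2 =>
    let x := cexp e1 in let y := cexp e2 in
    match o with
    | Ad | MA => Bin OAdd x y
    | MS => Bin OSub x y
    | Mu | MM => Bin OMul x y
    | Su => Bin OMul (Bin OSub x y) (Bin OLt y x)
    | Di => Bin ODiv x y
    | Mo => Bin OMod x y
    | Lt => Bin OLt x y
    | Eq => Bin OEq x y
    | Sr => Bin OShr x y
    | Sl => Bin OShl x y
    end
  end.

Fixpoint modr (c : acmd) : seq nat :=
  match c with
  | Nop | Put _ _ _ | PutR _ _ => [::]
  | Set_ r _ | GetR r _ => [:: r]
  | Sq c1 c2 | Cn _ c1 c2 => modr c1 ++ modr c2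
  | Fo r _ c1 => r :: modr c1
  end.

Fixpoint moda (c : acmd) : seq nat :=
  match c with
  | Nop | Set_ _ _ | GetR _ _ | PutR _ _ => [::]
  | Put j _ _ => [:: j]
  | Sq c1 c2 | Cn _ c1 c2 => moda c1 ++ moda c2
  | Fo _ _ c1 => moda c1
  end.

Fixpoint modw (c : acmd) : bool :=
  match c with
  | Nop | Set_ _ _ | GetR _ _ | Put _ _ _ => false
  | PutR _ _ => true
  | Sq c1 c2 | Cn _ c1 c2 => modw c1 || modw c2
  | Fo _ _ c1 => modw c1
  end.

Fixpoint wf (c : acmd) : bool :=
  match c with
  | Nop => true
  | Set_ r e => (r != 0) && chk e
  | Put j e1 e2 => [&& j < 32, chk e1, deg e1 <= 8 & chk e2]
  | GetR r e => [&& r != 0, chk e & deg e <= 8]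
  | PutR e1 e2 => [&& chk e1, deg e1 <= 8 & chk e2]
  | Sq c1 c2 => wf c1 && wf c2
  | Cn e c1 c2 => [&& chk e, wf c1 & wf c2]
  | Fo r rb c1 =>
    [&& r != 0, r != rb, r \notin modr c1, rb \notin modr c1 & wf c1]
  end.

Fixpoint run (W : nat) (c : acmd) (a : astate) : astate :=
  match c with
  | Nop => a
  | Set_ r e => setr a r (ev W a e)
  | Put j e1 e2 => seta a j (ev W a e1) (ev W a e2)
  | GetR r e => setr a r (rw a (ev W a e))
  | PutR e1 e2 => setw a (ev W a e1) (ev W a e2)
  | Sq c1 c2 => run W c2 (run W c1 a)
  | Cn e c1 c2 => if ev W a e != 0 then run W c1 a else run W c2 a
  | Fo r rb c1 =>
    setr (iteri (rg a rb) (fun i s => run W c1 (setr s r i)) a) r (rg a rb)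
  end.

(* The side conditions: stored numbers stay below [lim], raw accesses stay
   below the offset held in register 0, and the bound in register [rb] of a
   loop never exceeds [ub rb]. *)
Fixpoint ok (W lim : nat) (ub : nat -> nat) (c : acmd) (a : astate) : Prop :=
  match c with
  | Nop => True
  | Set_ r e => ev W a e < lim
  | Put j e1 e2 => (j < 24) ==> (ev W a e2 < lim)
  | GetR r e => (ev W a e < rg a 0) && (rw a (ev W a e) < lim)
  | PutR e1 e2 => ev W a e1 < rg a 0
  | Sq c1 c2 => ok W lim ub c1 a /\ ok W lim ub c2 (run W c1 a)
  | Cn e c1 c2 => if ev W a e != 0 then ok W lim ub c1 a else ok W lim ub c2 a
  | Fo r rb c1 =>
    rg a rb <= ub rb /\
    forall i, i < rg a rb ->
      ok W lim ub c1 (setr (iteri i (fun i s => run W c1 (setr s r i)) a) r i)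
  end.

Fixpoint comp (c : acmd) : cmd :=
  match c with
  | Nop => Skip
  | Set_ r e => Assign r (cexp e)
  | Put j e1 e2 =>
    Store (Bin OAdd (Bin OAdd (Reg 0) (Const j)) (Bin OMul (Const 32) (cexp e1)))
          (cexp e2)
  | GetR r e => Assign r (Read (cexp e))
  | PutR e1 e2 => Store (cexp e1) (cexp e2)
  | Sq c1 c2 => Seq (comp c1) (comp c2)
  | Cn e c1 c2 => If (cexp e) (comp c1) (comp c2)
  | Fo r rb c1 =>
    Seq (Assign r (Const 0))
        (While (Bin OLt (Reg r) (Reg rb))
               (Seq (comp c1) (Assign r (Bin OAdd (Reg r) (Const 1)))))
  end.

Fixpoint tb (ub : nat -> nat) (c : acmd) : nat :=
  match c with
  | Nop => 1
  | Set_ r e => (ecost (cexp e)).+1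
  | Put j e1 e2 => ecost (cexp e1) + ecost (cexp e2) + 7
  | GetR r e => (ecost (cexp e)).+2
  | PutR e1 e2 => (ecost (cexp e1) + ecost (cexp e2)).+1
  | Sq c1 c2 => tb ub c1 + tb ub c2
  | Cn e c1 c2 => (ecost (cexp e) + (tb ub c1 + tb ub c2)).+1
  | Fo r rb c1 => 6 + ub rb * (tb ub c1 + 8)
  end.

Record rep (W lim : nat) (s : state) (a : astate) : Prop := Rep
  { rep_r : forall r, regs s r = rg a r;
    rep_lr : forall r, rg a r < lim;
    rep_a : forall j i, j < 32 -> i < lim ^ 8 ->
              Defs.mem s (rg a 0 + j + 32 * i) = av a j i;
    rep_la : forall j i, j < 24 -> av a j i < lim;
    rep_lb : forall j i, av a j i < 2 ^ W;
    rep_w : forall i, i < rg a 0 -> Defs.mem s i = rw a i }.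

Section Soundness.
Variables (W lim : nat).
Hypotheses (lim_gt : 128 <= lim) (lim_W : lim ^ 12 <= 2 ^ W).

Lemma lim_exp d : d <= 12 -> lim ^ d <= 2 ^ W.
Proof. by move=> d6; apply: leq_trans lim_W; rewrite leq_pexp2l //; lia. Qed.

Lemma lim_exp_le d d' : d <= d' -> lim ^ d <= lim ^ d'.
Proof. by move=> dd; rewrite leq_pexp2l //; lia. Qed.

Lemma ev_small s a e : rep W lim s a -> chk e -> deg e <= 12 ->
  ev W a e < lim ^ deg e.
Proof.
move=> R; elim: e => [k|r|j e1 IH|o e1 IH1 e2 IH2] /=.
- by move=> k64 _; rewrite ?expn1; lia.
- by move=> _ _; exact: rep_lr R _.
- by case: ifP => // j24 _ _; apply: (rep_la R).
have lim2 d : 1 < lim ^ d.+1 by rewrite -(exp1n d.+1) ltn_exp2r //; lia.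
have nb (x : bool) : x < lim ^ 1 by rewrite ?expn1; case: x; lia.
case: o => //=.
- case/and3P=> c1 c2 d6 _.
  have := IH1 c1 ltac:(lia); have := IH2 c2 ltac:(lia).
  have := @lim_exp_le (deg e1) (maxn (deg e1) (deg e2)) ltac:(lia).
  have := @lim_exp_le (deg e2) (maxn (deg e1) (deg e2)) ltac:(lia).
  rewrite expnS; set A := _ ^ maxn _ _; nia.
- by case/andP=> c1 /andP[_ _] d6; have := IH1 c1 d6; lia.
- case/and3P=> c1 c2 d6 _; rewrite expnD.
  by have := IH1 c1 ltac:(lia); have := IH2 c2 ltac:(lia); nia.
- case/andP=> c1 _ d6; apply: leq_ltn_trans (IH1 c1 d6); exact: leq_div.
- case/andP=> c1 _ d6; apply: leq_ltn_trans (IH1 c1 d6); exact: leq_mod.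
- case/andP=> c1 _ d6; apply: leq_ltn_trans (IH1 c1 d6); exact: leq_div.
Qed.

Lemma addr_lt off j i : off < lim -> j < 32 -> i < lim ^ 8 ->
  off + j + 32 * i < 2 ^ W.
Proof.
move=> o j32 i8; apply: leq_trans lim_W.
rewrite -[12]/(2 + (2 + 8)) expnD expnD; set x := lim ^ 8 in i8 *.
have l2 : 128 * 128 <= lim ^ 2 * lim ^ 2 by apply: leq_mul; rewrite -mulnn; nia.
have l3 : lim <= x by rewrite /x -[leqLHS]expn1 leq_pexp2l //; lia.
rewrite mulnA; apply: leq_trans (leq_mul l2 (leqnn x)); lia.
Qed.

Lemma cexp_ok s a e : rep W lim s a -> chk e ->
  eval W s (cexp e) = ev W a e /\ ev W a e < 2 ^ W.
Proof.
move=> R; have lW : lim <= 2 ^ W by rewrite -[lim]expn1 lim_exp.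
elim: e => [k|r|j e1 IH|o e1 IH1 e2 IH2] /=.
- by move=> k64; rewrite modn_small //; lia.
- by move=> _; rewrite (rep_r R); have := rep_lr R r; lia.
- case/and3P=> j32 c1 d4; have [-> e1W] := IH c1; rewrite !(rep_r R).
  have e14 : ev W a e1 < lim ^ 8.
    by apply: leq_trans (ev_small R c1 _) (lim_exp_le _) => //; lia.
  have := addr_lt (rep_lr R 0) j32 e14 => aW.
  have h32 : 32 < 2 ^ W by apply: leq_trans lW; lia.
  have hj : j < 2 ^ W by apply: leq_trans lW; lia.
  have h1 : rg a 0 + j < 2 ^ W by apply: leq_ltn_trans aW; exact: leq_addr.
  have h2 : 32 * ev W a e1 < 2 ^ W by apply: leq_ltn_trans aW; exact: leq_addl.
  rewrite (modn_small h32) (modn_small hj) (modn_small h1) (modn_small h2).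
  by rewrite (modn_small aW) (rep_a R) //; split => //; exact: (rep_lb R).
case/and3P=> c1 c2 co; have [E1 b1] := IH1 c1; have [E2 b2] := IH2 c2.
have W0 : 0 < 2 ^ W by rewrite expn_gt0.
have W1 : 1 < 2 ^ W by lia.
have nb (x : bool) : x < 2 ^ W by case: x; lia.
have md x : x %% 2 ^ W < 2 ^ W by rewrite ltn_mod.
case: o co => /= co; rewrite ?E1 ?E2; do ?by split; [|exact: nb || exact: md].
- have := leq_trans (@ev_small s a (Op Ad e1 e2) R _ co) (lim_exp co).
  rewrite /= c1 c2 co => /(_ isT) h; split=> //; rewrite modn_small //.
- split; last lia; rewrite (modn_small b2).
  case: (ltnP (ev W a e2) (ev W a e1)) => h.
    rewrite muln1 modn_mod.
    have -> : ev W a e1 + (2 ^ W - ev W a e2) = (ev W a e1 - ev W a e2) + 2 ^ W by lia.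
    rewrite modnDr modn_small //; lia.
  rewrite muln0 mod0n; lia.
- have := leq_trans (@ev_small s a (Op Mu e1 e2) R _ co) (lim_exp co).
  rewrite /= c1 c2 co => /(_ isT) h; split=> //; rewrite modn_small //.
- by split=> //; apply: leq_ltn_trans b1; exact: leq_div.
- by split=> //; apply: leq_ltn_trans b1; exact: leq_mod.
- by split=> //; apply: leq_ltn_trans b1; exact: leq_div.
Qed.

Lemma run_r c a r : r \notin modr c -> rg (run W c a) r = rg a r.
Proof.
elim: c a => //= [r' e|r' e|c1 IH1 c2 IH2|e c1 IH1 c2 IH2|r' rb c1 IH] a.
- by rewrite inE /upd => /negbTE ->.
- by rewrite inE /upd => /negbTE ->.
- by rewrite mem_cat negb_or => /andP[h1 h2]; rewrite IH2 ?IH1.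
- by rewrite mem_cat negb_or => /andP[h1 h2]; case: ifP => _; rewrite ?IH2 ?IH1.
rewrite inE negb_or => /andP[/negbTE rr' h1]; rewrite /upd rr'.
by elim: (rg a rb) => //= n; rewrite IH //= /upd rr'.
Qed.

Lemma run_a c a j : j \notin moda c -> av (run W c a) j = av a j.
Proof.
elim: c a => //= [j' e1 e2|c1 IH1 c2 IH2|e c1 IH1 c2 IH2|r' rb c1 IH] a.
- by rewrite inE => /negbTE ->.
- by rewrite mem_cat negb_or => /andP[h1 h2]; rewrite IH2 ?IH1.
- by rewrite mem_cat negb_or => /andP[h1 h2]; case: ifP => _; rewrite ?IH2 ?IH1.
by move=> h1; elim: (rg a rb) => //= n; rewrite IH.
Qed.

Lemma run_w c a : ~~ modw c -> rw (run W c a) = rw a.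
Proof.
elim: c a => //= [c1 IH1 c2 IH2|e c1 IH1 c2 IH2|r' rb c1 IH] a.
- by rewrite negb_or => /andP[h1 h2]; rewrite IH2 ?IH1.
- by rewrite negb_or => /andP[h1 h2]; case: ifP => _; rewrite ?IH2 ?IH1.
by move=> h1; elim: (rg a rb) => //= n; rewrite IH.
Qed.

Lemma rep_setr s a r v : rep W lim s a -> r != 0 -> v < lim ->
  rep W lim (State (upd (regs s) r v) (Defs.mem s)) (setr a r v).
Proof.
case=> R1 R2 R3 R4 R5 R6 r0 vl.
have r0' : (0 == r) = false by rewrite eq_sym (negbTE r0).
split=> //=; rewrite /upd ?r0' //.
- by move=> r'; case: ifP.
- by move=> r'; case: ifP.
Qed.

Lemma rep_seta s a j i v : rep W lim s a -> j < 32 -> i < lim ^ 8 ->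
    v < 2 ^ W -> (j < 24 -> v < lim) ->
  rep W lim (State (regs s) (upd (Defs.mem s) (rg a 0 + j + 32 * i) v)) (seta a j i v).
Proof.
case=> R1 R2 R3 R4 R5 R6 j32 i4 vW vl; split=> //=.
- move=> j' i' j'32 i'4; rewrite /upd.
  case: (j' =P j) => [->|jj].
    have -> : (rg a 0 + j + 32 * i' == rg a 0 + j + 32 * i) = (i' == i) by lia.
    by case: (i' =P i) => // _; rewrite R3.
  have -> : (rg a 0 + j' + 32 * i' == rg a 0 + j + 32 * i) = false by lia.
  by rewrite R3.
- move=> j' i' j'24; case: (j' =P j) => [E|_]; last exact: R4.
  rewrite E in j'24; rewrite /upd; case: eqP => _; [exact: vl|exact: R4].
- move=> j' i'; case: (j' =P j) => [_|_]; last exact: R5.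
  by rewrite /upd; case: eqP.
move=> i' h; rewrite /upd.
have -> : (i' == rg a 0 + j + 32 * i) = false by lia.
exact: R6.
Qed.

Lemma rep_setw s a i v : rep W lim s a -> i < rg a 0 ->
  rep W lim (State (regs s) (upd (Defs.mem s) i v)) (setw a i v).
Proof.
case=> R1 R2 R3 R4 R5 R6 io; split=> //=.
- move=> j' i' j'32 i'4; rewrite /upd.
  have -> : (rg a 0 + j' + 32 * i' == i) = false by lia.
  by rewrite R3.
by move=> i' h; rewrite /upd; case: eqP => // _; rewrite R6.
Qed.

Variable ub : nat -> nat.

Lemma comp_ok c s a : wf c -> ok W lim ub c a -> rep W lim s a ->
  exists s' T, [/\ exec W (comp c) s s' T, rep W lim s' (run W c a)
                 & T <= tb ub c].
Proof.
have lW : lim <= 2 ^ W by rewrite -[lim]expn1 lim_exp.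
have cst k : k <= 124 -> k %% 2 ^ W = k by move=> ?; rewrite modn_small; lia.
elim: c s a => /= [|r e|j e1 e2|r e|e1 e2|c1 IH1 c2 IH2|e c1 IH1 c2 IH2|r rb c1 IH] s a.
- by move=> _ _ R; exists s, 1; split=> //; exact: ExecSkip.
- case/andP=> r0 ce vl R; have [E _] := cexp_ok R ce.
  do 2!eexists; split; [exact: ExecAssign| |by []].
  by rewrite E; exact: rep_setr.
- case/and4P=> j32 c1 d1 c2 /implyP vl R.
  have [E1 _] := cexp_ok R c1; have [E2 b2] := cexp_ok R c2.
  have e14 : ev W a e1 < lim ^ 8.
    by apply: leq_trans (ev_small R c1 _) (lim_exp_le _) => //; lia.
  have aW := addr_lt (rep_lr R 0) j32 e14.
  do 2!eexists; split; [exact: ExecStore| |by rewrite /=; lia].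
  have h1 : rg a 0 + j < 2 ^ W by apply: leq_ltn_trans aW; exact: leq_addr.
  have h2 : 32 * ev W a e1 < 2 ^ W by apply: leq_ltn_trans aW; exact: leq_addl.
  rewrite /= (rep_r R) E1 E2 (cst 32) // (cst j); last lia.
  rewrite (modn_small h1) (modn_small h2) (modn_small aW).
  by apply: rep_seta => // j24; move: vl; rewrite j24 => /(_ isT).
- case/and3P=> r0 ce d4 /andP[eo vl] R; have [E _] := cexp_ok R ce.
  do 2!eexists; split; [exact: ExecAssign| |by []].
  by rewrite /= E (rep_w R eo); exact: rep_setr.
- case/and3P=> c1 d1 c2 vl R.
  have [E1 _] := cexp_ok R c1; have [E2 b2] := cexp_ok R c2.
  do 2!eexists; split; [exact: ExecStore| |by []].
  by rewrite E1 E2; exact: rep_setw.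
- case/andP=> w1 w2 [o1 o2] R.
  have [s1 [T1 [X1 R1 B1]]] := IH1 s a w1 o1 R.
  have [s2 [T2 [X2 R2 B2]]] := IH2 s1 _ w2 o2 R1.
  exists s2, (T1 + T2); split=> //; [exact: ExecSeq X1 X2|lia].
- case/and3P=> ce w1 w2; have [] := boolP (ev W a e != 0) => ee o1 R;
    have [E _] := cexp_ok R ce.
    have [s1 [T1 [X1 R1 B1]]] := IH1 s a w1 o1 R.
    exists s1, (ecost (cexp e) + T1).+1; split=> //; last lia.
    by apply: ExecIfTrue => //; rewrite E.
  have [s1 [T1 [X1 R1 B1]]] := IH2 s a w2 o1 R.
  exists s1, (ecost (cexp e) + T1).+1; split=> //; last lia.
  by apply: ExecIfFalse => //; rewrite E; move: ee; rewrite negbK => /eqP.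
case/and5P=> r0 rrb rm rbm w1 [nub okb] R.
have rbr : (rb == r) = false by rewrite eq_sym (negbTE rrb).
set n := rg a rb in nub okb *.
pose st i := iteri i (fun i s => run W c1 (setr s r i)) a.
rewrite -/(st n).
have strb i : rg (st i) rb = n.
  elim: i => //= i IHi; rewrite run_r //= /upd rbr.
  exact: IHi.
have nl : n < lim by exact: rep_lr R rb.
have main k i s0 : i + k = n -> rep W lim s0 (setr (st i) r i) ->
  exists s' T, [/\ exec W (While (Bin OLt (Reg r) (Reg rb))
      (Seq (comp c1) (Assign r (Bin OAdd (Reg r) (Const 1))))) s0 s' T,
      rep W lim s' (setr (st n) r n) & T <= 4 + k * (tb ub c1 + 8)].
  elim: k i s0 => [|k IHk] i s0 ik R0.
    have -> : n = i by rewrite -ik addn0.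
    exists s0, 4; split=> //.
    apply: ExecWhileFalse; rewrite /= !(rep_r R0) /= /upd eqxx rbr.
    rewrite strb; lia.
  have i_n : i < n by lia.
  have [s1 [T1 [X1 R1 B1]]] := IH s0 _ w1 (okb i i_n) R0.
  have e1 : rg (run W c1 (setr (st i) r i)) r = i by rewrite run_r //= /upd eqxx.
  have [||s2 [T2 [X2 R2 B2]]] := IHk i.+1 (State (upd (regs s1) r i.+1) (Defs.mem s1)).
  - lia.
  - by apply: (rep_setr R1 r0); lia.
  exists s2, (3 + (T1 + 4) + T2).+1; split=> //; last by rewrite mulSn; lia.
  apply: ExecWhileTrue X2.
    rewrite /= !(rep_r R0) /= /upd eqxx rbr strb i_n //.
  apply: ExecSeq X1 _.
  suff <- : eval W s1 (Bin OAdd (Reg r) (Const 1)) = i.+1 by exact: ExecAssign.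
  by rewrite /= (rep_r R1) e1 (cst 1) // modn_small ?addn1 //; lia.
have [||s2 [T2 [X2 R2 B2]]] := main n 0 (State (upd (regs s) r 0) (Defs.mem s)).
- by [].
- by apply: rep_setr => //; lia.
exists s2, (2 + T2); split=> //.
  apply: ExecSeq X2; suff {2}<- : eval W s (Const 0) = 0 by exact: ExecAssign.
  by rewrite /= mod0n.
by have := leq_mul nub (leqnn (tb ub c1 + 8)); lia.
Qed.

End Soundness.

(** * Program logic *)

Section Triples.
Variables (W lim : nat) (ub : nat -> nat).

Definition tri (c : acmd) (a : astate) (Q : astate -> Prop) : Prop :=
  ok W lim ub c a /\ Q (run W c a).

Definition keep (c : acmd) (a a' : astate) : Prop :=
  [/\ forall r, r \notin modr c -> rg a' r = rg a r,
      forall j, j \notin moda c -> av a' j = av a j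
    & ~~ modw c -> rw a' = rw a].

Lemma keep_run c a : keep c a (run W c a).
Proof. by split=> *; rewrite (run_r, run_a, run_w). Qed.

Lemma keep_r c a a' (K : keep c a a') r : r \notin modr c -> rg a' r = rg a r.
Proof. by case: K => h _ _ /h. Qed.

Lemma keep_a c a a' (K : keep c a a') j : j \notin moda c -> av a' j = av a j.
Proof. by case: K => _ h _ /h. Qed.

Lemma keep_w c a a' (K : keep c a a') : ~~ modw c -> rw a' = rw a.
Proof. by case: K => _ _ h /h. Qed.

Lemma tri_conseq c a (Q Q' : astate -> Prop) : tri c a Q ->
  (forall a', keep c a a' -> Q a' -> Q' a') -> tri c a Q'.
Proof. by move=> [h q] H; split=> //; apply: H q; exact: keep_run. Qed.

Lemma tri_seq c1 c2 a Q :
  tri c1 a (fun a' => tri c2 a' Q) -> tri (Sq c1 c2) a Q.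
Proof. by case=> h1 [h2 q]; split. Qed.

Lemma tri_nop a (Q : astate -> Prop) : Q a -> tri Nop a Q.
Proof. by []. Qed.

Lemma tri_set r e v a (Q : astate -> Prop) : ev W a e = v -> v < lim ->
  Q (setr a r v) -> tri (Set_ r e) a Q.
Proof. by move=> E h q; rewrite /tri /= E. Qed.

Lemma tri_put j e1 e2 i v a (Q : astate -> Prop) : ev W a e1 = i ->
  ev W a e2 = v -> (j < 24 -> v < lim) ->
  Q (seta a j i v) -> tri (Put j e1 e2) a Q.
Proof. by move=> E1 E2 h q; rewrite /tri /= E1 E2; split=> //; apply/implyP. Qed.

Lemma tri_getr r e i a (Q : astate -> Prop) : ev W a e = i -> i < rg a 0 ->
  rw a i < lim -> Q (setr a r (rw a i)) -> tri (GetR r e) a Q.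
Proof. by move=> E h1 h2 q; rewrite /tri /= E h1 h2. Qed.

Lemma tri_putr e1 e2 i v a (Q : astate -> Prop) : ev W a e1 = i ->
  ev W a e2 = v -> i < rg a 0 -> Q (setw a i v) -> tri (PutR e1 e2) a Q.
Proof. by move=> E1 E2 h q; rewrite /tri /= E1 E2. Qed.

Lemma tri_cn e c1 c2 a Q :
  (ev W a e != 0 -> tri c1 a Q) -> (ev W a e = 0 -> tri c2 a Q) ->
  tri (Cn e c1 c2) a Q.
Proof.
rewrite /tri /= => h1 h2; case: eqP => /= [/h2 //|/eqP/h1 //].
Qed.

Lemma keep_st r rb c a i :
  keep (Fo r rb c) a (iteri i (fun i s => run W c (setr s r i)) a).
Proof.
elim: i => [|i [k1 k2 k3]]; first by split.
split=> /= [r' nr|j nj|w].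
- have := nr; rewrite inE negb_or => /andP[/negbTE rr nm].
  by rewrite run_r //= /upd rr k1.
- by rewrite run_a //= k2.
by rewrite run_w //= k3.
Qed.

Lemma tri_for r rb c a (I : nat -> astate -> Prop) (Q : astate -> Prop) :
  rg a rb <= ub rb -> I 0 a ->
  (forall i a', i < rg a rb -> keep (Fo r rb c) a a' -> I i a' ->
     tri c (setr a' r i) (I i.+1)) ->
  (forall a', keep (Fo r rb c) a a' -> I (rg a rb) a' ->
     Q (setr a' r (rg a rb))) ->
  tri (Fo r rb c) a Q.
Proof.
move=> nub I0 step post.
pose st i := iteri i (fun i s => run W c (setr s r i)) a.
have Ist i : i <= rg a rb -> I i (st i).
  elim: i => // i IH h; have := step i (st i) h (keep_st _ _ _ _ _) (IH (ltnW h)).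
  by case.
split; last by apply: post; [exact: keep_st|exact: Ist].
split=> // i h; have [] := step i (st i) h (keep_st _ _ _ _ _) (Ist i (ltnW h)).
by [].
Qed.

Definition mapl (T r rb : nat) (e : aexp) := Fo r rb (Put T (Va r) e).

Lemma tri_map T r rb e a (v : nat -> nat) (Q : astate -> Prop) :
  rg a rb <= ub rb ->
  (forall i a', i < rg a rb -> rg a' r = i ->
     (forall r', r' != r -> rg a' r' = rg a r') ->
     (forall j, j != T -> av a' j = av a j) ->
     (forall x, i <= x -> av a' T x = av a T x) ->
     ev W a' e = v i /\ (T < 24 -> v i < lim)) ->
  (forall a', (forall r', r' != r -> rg a' r' = rg a r') ->
     (forall j, j != T -> av a' j = av a j) -> rw a' = rw a ->
     (forall i, av a' T i = if i < rg a rb then v i else av a T i) -> Q a') ->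
  tri (mapl T r rb e) a Q.
Proof.
move=> nub He Hq.
apply: (@tri_for _ _ _ _ (fun i a' => forall x, av a' T x = if x < i then v x else av a T x)) => //.
  move=> i a' h K Ia.
  have kr r' : r' != r -> rg a' r' = rg a r' by move=> rr; apply: (keep_r K); rewrite inE (negbTE rr).
  have ka j : j != T -> av a' j = av a j by move=> jj; apply: (keep_a K); rewrite inE (negbTE jj).
  have [||||e1 e2] := He i (setr a' r i) h.
  - by rewrite /= /upd eqxx.
  - by move=> r' rr; rewrite /= /upd (negbTE rr) kr.
  - by move=> j jj; rewrite ka.
  - by move=> x ix; rewrite Ia ltnNge ix.
  apply: (@tri_put _ _ _ i (v i)) => //; first by rewrite /= /upd eqxx.
  move=> x /=; rewrite eqxx /upd ltnS; case: (ltngtP x i) => [xi|xi|->] //.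
  - by rewrite Ia xi.
  - by rewrite Ia ltnNge (ltnW xi).
move=> a' K Ia; apply: Hq.
- by move=> r' rr; rewrite /= /upd (negbTE rr); apply: (keep_r K); rewrite inE (negbTE rr).
- by move=> j jj /=; apply: (keep_a K); rewrite inE (negbTE jj).
- exact: (keep_w K).
- exact: Ia.
Qed.

Definition suml (rs r rb : nat) (e : aexp) :=
  Sq (Set_ rs (Nu 0)) (Fo r rb (Set_ rs (Op Ad (Va rs) e))).

Lemma tri_sum rs r rb e a (v : nat -> nat) (Q : astate -> Prop) :
  rs != r -> rs != rb ->
  rg a rb <= ub rb ->
  (forall i a', i < rg a rb -> rg a' r = i ->
     (forall r', r' != r -> r' != rs -> rg a' r' = rg a r') ->
     av a' = av a -> ev W a' e = v i) ->
  \sum_(i < rg a rb) v i < lim ->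
  (forall a', (forall r', r' != r -> r' != rs -> rg a' r' = rg a r') ->
     (forall j, av a' j = av a j) -> rw a' = rw a ->
     rg a' rs = \sum_(i < rg a rb) v i -> Q a') ->
  tri (suml rs r rb e) a Q.
Proof.
move=> rsr rsb nub He sl Hq; apply: tri_seq; apply: (@tri_set _ _ 0) => //; first by lia.
have rbs : rg (setr a rs 0) rb = rg a rb by rewrite /= /upd eq_sym (negbTE rsb).
apply: (@tri_for _ _ _ _ (fun i a' => av a' = av a /\ rg a' rs = \sum_(k < i) v k)); rewrite ?rbs //.
- by rewrite big_ord0 /= /upd eqxx.
- move=> i a' h K [Ia Ir].
  have kr r' : r' != r -> r' != rs -> rg a' r' = rg a r'.
    move=> r1 r2; rewrite (keep_r K) /= /upd ?(negbTE r2) //.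
    by rewrite !inE negb_or r1.
  have e1 : ev W (setr a' r i) e = v i.
    apply: He => //; first by rewrite /= /upd eqxx.
    by move=> r' r1 r2; rewrite /= /upd (negbTE r1) kr.
  apply: (@tri_set _ _ (\sum_(k < i.+1) v k)).
  - by rewrite /= e1 big_ord_recr /= -Ir /upd (negbTE rsr).
  - apply: leq_ltn_trans sl; rewrite -!(big_mkord xpredT v).
    by rewrite [leqRHS](big_cat_nat (n := i.+1)) //= leq_addr.
  by split=> //=; rewrite /upd eqxx.
move=> a' K [Ia Ir]; apply: Hq => //=.
- move=> r' r1 r2; rewrite /upd (negbTE r1) (keep_r K) /= /upd ?(negbTE r2) //.
  by rewrite !inE negb_or r1.
- by move=> j; rewrite Ia.
- by rewrite (keep_w K).
- by rewrite /upd (negbTE rsr).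
Qed.

End Triples.

(** * Canonical optimal solutions *)

Lemma subseq_perm_cat (T : eqType) (x s : seq T) : subseq x s ->
  exists z, perm_eq s (x ++ z).
Proof.
elim: s x => [|y s IH] [|x0 x] //=; [by exists [::]|by exists (y :: s)|].
case: eqP => [->|_] /IH[z pz]; first by exists z; rewrite perm_cons.
exists (y :: z); rewrite -cat_cons perm_sym perm_catC /= perm_cons perm_catC perm_sym.
exact: pz.
Qed.

Section Coins.
Variables (u : nat) (A : nat -> bool).
Hypothesis A_range : forall w, A w -> 0 < w <= u.

Definition sol (c : nat) (s : seq nat) := all A s && (sumn s == c).

Fixpoint reach (k c : nat) : bool :=
  if k is k'.+1 then has (fun w => [&& A w, w <= c & reach k' (c - w)]) (iota 1 u)
  else c == 0.

Lemma mem_coin w : A w -> w \in iota 1 u.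
Proof. by move=> /A_range; rewrite mem_iota; lia. Qed.

Lemma reachP k c : reflect (exists2 s, sol c s & size s = k) (reach k c).
Proof.
elim: k c => [|k IH] c /=.
  apply: (iffP eqP) => [->|[[|x s] //]]; first by exists [::].
  by rewrite /sol /= => /eqP.
apply: (iffP hasP) => [[w _ /and3P[Aw wc /IH[s /andP[As /eqP sc] <-]]]|[[|w s] //]].
  exists (w :: s) => //; rewrite /sol /= Aw As /= sc; apply/eqP; lia.
rewrite /sol /= => /andP[/andP[Aw As] /eqP sc] [sk].
exists w; first exact: mem_coin.
rewrite Aw (_ : w <= c) /=; last lia.
apply/IH; exists s => //; rewrite /sol As /=; apply/eqP; lia.
Qed.

Lemma sol_size c s : sol c s -> size s <= c.
Proof.
elim: s c => [|w s IH] c //; rewrite /sol /= => /andP[/andP[Aw As] /eqP sc].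
have := IH (sumn s); rewrite /sol As eqxx => /(_ isT).
by have := A_range Aw; lia.
Qed.

(* The value [c.+1] means that [c] has no solution. *)
Definition mincoins (c : nat) := find (reach^~ c) (iota 0 c.+1).
Definition feasible c := mincoins c <= c.

Lemma mincoins_sol c : feasible c -> exists2 s, sol c s & size s = mincoins c.
Proof.
move=> h; apply/reachP.
have := @nth_find _ 0 (reach^~ c) (iota 0 c.+1); rewrite has_find size_iota ltnS => /(_ h).
by rewrite nth_iota ?ltnS.
Qed.

Lemma mincoins_min c s : sol c s -> mincoins c <= size s.
Proof.
move=> sc; have sz := sol_size sc; rewrite leqNgt; apply/negP => h.
have := before_find 0 h; rewrite nth_iota ?ltnS //.
by move/negP; apply; apply/reachP; exists s.
Qed.

Lemma sol_feasible c s : sol c s -> feasible c.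
Proof. by move=> sc; apply: leq_trans (mincoins_min sc) (sol_size sc). Qed.

Lemma mincoins0 : mincoins 0 = 0.
Proof. by apply/eqP; rewrite -leqn0; apply: (@mincoins_min 0 [::]). Qed.

Lemma mincoins_gt0 c : 0 < c -> 0 < mincoins c.
Proof.
move=> c0; rewrite lt0n; apply/eqP => h.
have [|[|w s] // ] := @mincoins_sol c; first by rewrite /feasible h.
  by rewrite /sol /= => /eqP E; rewrite -E in c0.
by rewrite h.
Qed.

Lemma sol_cons w c s : A w -> sol c s -> sol (w + c) (w :: s).
Proof. by rewrite /sol /= => -> /andP[-> /eqP ->] /=. Qed.

Lemma sol_perm c s s' : perm_eq s s' -> sol c s = sol c s'.
Proof. by move=> p; rewrite /sol (perm_all _ p) (perm_sumn p). Qed.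

Lemma sol_rem c s w : sol c s -> w \in s -> [/\ A w, w <= c & sol (c - w) (rem w s)].
Proof.
move=> sc ws; rewrite (sol_perm _ (perm_to_rem ws)) /sol /= in sc.
case/andP: sc => /andP[Aw As] /eqP sc; split=> //; first lia.
by rewrite /sol As /=; apply/eqP; lia.
Qed.

Lemma mincoins_step c w : A w -> feasible c -> 
  mincoins (w + c) <= (mincoins c).+1.
Proof.
by move=> Aw /mincoins_sol[s ss <-]; apply: (mincoins_min (sol_cons Aw ss)).
Qed.

Definition wit (c w : nat) :=
  [&& A w, w <= c, feasible (c - w) & mincoins c == (mincoins (c - w)).+1].

Lemma wit_feasible c w : wit c w -> feasible c.
Proof.
case/and4P=> Aw wc /mincoins_sol[s ss _] _.
by have := sol_feasible (sol_cons Aw ss); rewrite subnKC.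
Qed.

Lemma wit_of_opt c s w : sol c s -> size s = mincoins c -> w \in s -> wit c w.
Proof.
move=> sc sz ws; have [Aw wc sr] := sol_rem sc ws.
have sz' : size s = (size (rem w s)).+1 by rewrite (perm_size (perm_to_rem ws)).
rewrite /wit Aw wc (sol_feasible sr) /= eqn_leq -sz sz' ltnS.
have h := mincoins_step Aw (sol_feasible sr).
by rewrite subnKC // -sz sz' ltnS in h; rewrite h ltnS (mincoins_min sr).
Qed.

Lemma opt_rem c s w : sol c s -> size s = mincoins c -> w \in s ->
  sol (c - w) (rem w s) /\ size (rem w s) = mincoins (c - w).
Proof.
move=> sc sz ws; have [Aw wc sr] := sol_rem sc ws; split=> //.
have /and4P[_ _ _ /eqP] := wit_of_opt sc sz ws.
by rewrite -sz (perm_size (perm_to_rem ws)) /= => -[].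
Qed.

Lemma opt_of_wit c w : wit c w ->
  exists s, [/\ sol c s, size s = mincoins c & w \in s].
Proof.
case/and4P=> Aw wc /mincoins_sol[s ss sz] /eqP E.
exists (w :: s); rewrite inE eqxx /= sz E; split=> //.
by rewrite -{1}(subnKC wc); exact: sol_cons.
Qed.

Lemma wit_sub c w w' : wit c w -> wit (c - w) w' -> wit c w'.
Proof.
move=> h1 /opt_of_wit[s [ss sz ws]]; case/and4P: h1 => Aw wc _ /eqP E.
apply: (@wit_of_opt c (w :: s)); rewrite ?inE ?ws ?orbT //= ?sz ?E //.
by rewrite -{1}(subnKC wc); exact: sol_cons.
Qed.

Lemma wit_pos c w : wit c w -> 0 < w <= u.
Proof. by case/and4P=> /A_range. Qed.

Lemma wit_exists c : 0 < c -> feasible c -> exists w, wit c w.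
Proof.
move=> c0 /mincoins_sol[[|w s] ss sz].
  by move: ss; rewrite /sol /= => /eqP E; rewrite -E in c0.
by exists w; apply: wit_of_opt ss sz _; rewrite inE eqxx.
Qed.

Variable rho : nat -> nat.
Hypothesis rho_inj : forall w w', A w -> A w' -> rho w = rho w' -> w = w'.

Definition is_top c w := wit c w /\ forall w', wit c w' -> rho w' <= rho w.

Definition top (c : nat) : nat :=
  head 0 [seq w <- iota 1 u | wit c w &&
            all (fun w' => wit c w' ==> (rho w' <= rho w)) (iota 1 u)].

Lemma top_uniq c w w' : is_top c w -> is_top c w' -> w = w'.
Proof.
move=> [h1 h2] [h3 h4]; apply: rho_inj.
- by case/and4P: h1.
- by case/and4P: h3.
by apply/eqP; rewrite eqn_leq h2 ?h4.
Qed.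

Lemma topP c : 0 < c -> feasible c -> is_top c (top c).
Proof.
move=> c0 fc; have [w0 hw0] := wit_exists c0 fc.
pose v (w : 'I_u.+1) := rho w.
have w0u : w0 < u.+1 by have := wit_pos hw0; lia.
case: (@arg_maxnP _ (Ordinal w0u) (fun w : 'I_u.+1 => wit c w) v hw0) => w hw maxw.
have inI x : wit c x -> x \in iota 1 u by move/wit_pos; rewrite mem_iota; lia.
rewrite /top; set l := filter _ _.
have : (val w) \in l.
  rewrite mem_filter hw inI //= andbT; apply/allP => x _; apply/implyP => hx.
  have xu : x < u.+1 by have := wit_pos hx; lia.
  exact: (maxw (Ordinal xu)).
case E : l => [|x l'] // _; have : x \in l by rewrite E inE eqxx.
rewrite mem_filter => /andP[/andP[hx /allP ax] _]; split=> // w' hw'.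
by have /implyP := ax w' (inI _ hw'); apply.
Qed.

Lemma top_eq c w : is_top c w -> top c = w.
Proof.
move=> h; apply: (top_uniq _ h); apply: topP.
  by case: h => /and4P[/A_range h1 h2 _ _] _; lia.
by case: h => /wit_feasible.
Qed.

Fixpoint canon_rec (n c : nat) : seq nat :=
  if n is n'.+1 then top c :: canon_rec n' (c - top c) else [::].
Definition canon c := canon_rec (mincoins c) c.

Lemma canonE c : 0 < c -> feasible c -> canon c = top c :: canon (c - top c).
Proof.
move=> c0 fc; have [/and4P[_ _ _ /eqP E] _] := topP c0 fc.
by rewrite {1}/canon E.
Qed.

Lemma canon0 : canon 0 = [::].
Proof. by rewrite /canon mincoins0. Qed.

(* The canonical solution is characterised as the optimal solution of largest
   potential; the base exceeds every multiplicity, so that the potential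
   compares multisets lexicographically by rank. *)
Variable B : nat.
Definition pot (s : seq nat) := \sum_(w <- s) B ^ rho w.

Definition best c s := [/\ sol c s, size s = mincoins c &
  forall s', sol c s' -> size s' = mincoins c -> pot s' <= pot s].

Lemma pot_perm s s' : perm_eq s s' -> pot s = pot s'.
Proof. by move=> p; apply: perm_big. Qed.

Lemma best_exists c : feasible c -> exists s, best c s.
Proof.
move=> /mincoins_sol[s0 ss0 sz0].
set k := mincoins c in sz0.
pose sq (x : k.-tuple 'I_u.+1) := map val x.
pose P x := sol c (sq x).
have lift s : sol c s -> size s = k -> exists2 x, sq x = s & P x.
  move=> ss sz; have szm : size (map (inord : nat -> 'I_u.+1) s) == k by rewrite size_map sz.
  exists (Tuple szm); rewrite /P /sq /= -map_comp.
    rewrite -[RHS]map_id; apply/eq_in_map => w ws /=; rewrite inordK //.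
    by case/andP: ss => /allP/(_ _ ws)/A_range; lia.
  rewrite (_ : map _ s = s) //; rewrite -[RHS]map_id; apply/eq_in_map => w ws /=.
  by rewrite inordK //; case/andP: ss => /allP/(_ _ ws)/A_range; lia.
have [x0 _ Px0] := lift s0 ss0 sz0.
case: (@arg_maxnP _ x0 P (fun x => pot (sq x)) Px0) => x Px maxx.
exists (sq x); split=> //; first by rewrite size_map size_tuple.
by move=> s' ss' /(lift s' ss')[y <- Py]; exact: maxx.
Qed.

Lemma best_rem c s w : best c s -> w \in s -> best (c - w) (rem w s).
Proof.
move=> [sc sz maxs] ws; have [sr szr] := opt_rem sc sz ws; split=> // s' ss' sz'.
have [Aw wc _] := sol_rem sc ws.
have E : size s = (size (rem w s)).+1 by rewrite (perm_size (perm_to_rem ws)).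
have := maxs (w :: s'); rewrite (pot_perm (perm_to_rem ws)) /pot !big_cons leq_add2l.
apply; first by rewrite -{1}(subnKC wc); exact: sol_cons.
by rewrite /= sz' -szr -E.
Qed.

Lemma best_top c s : c < B -> 0 < c -> best c s -> top c \in s.
Proof.
move=> cB c0 [sc sz maxs]; have [h1 h2] := topP c0 (sol_feasible sc).
apply/negPn/negP => nt; have [s' [ss' sz' ts']] := opt_of_wit h1.
have := maxs s' ss' sz'; rewrite leqNgt => /negP[].
have r0 w : w \in s -> rho w < rho (top c).
  move=> ws; have hw := wit_of_opt sc sz ws; rewrite ltn_neqAle h2 // andbT.
  apply/eqP => E; move: nt; rewrite -(rho_inj _ _ E) ?ws //; last by case/and4P: h1.
  by case/and4P: hw.
apply: leq_trans (_ : B ^ rho (top c) <= _); last first.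
  by rewrite /pot (big_rem (top c) ts') /= leq_addr.
have B0 : 0 < B by lia.
case: s {maxs nt} sc sz r0 => [|w0 s] sc sz r0; first by rewrite /pot big_nil expn_gt0 B0.
have [n rn] : exists n, rho (top c) = n.+1.
  by have := r0 w0; rewrite inE eqxx => /(_ isT); case: (rho (top c)) => // n _; exists n.
apply: leq_ltn_trans (_ : size (w0 :: s) * B ^ n < _).
  rewrite /pot -sum1_size big_distrl /= big_seq [leqRHS]big_seq; apply: leq_sum => w /r0.
  by rewrite rn ltnS mul1n => h; rewrite leq_pexp2l.
by rewrite rn expnS ltn_pmul2r ?expn_gt0 ?B0 //; have := sol_size sc; lia.
Qed.

Lemma best_canon c s : c < B -> best c s -> perm_eq s (canon c).
Proof.
elim: {s}(size s) {-2}s (erefl (size s)) c => [|n IH] s sz c cB bs.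
  case: s sz bs => // _ [sc szc _].
  by move: szc; rewrite /canon => <-.
have [c0|c0] := posnP c.
  by case: bs => _; rewrite c0 mincoins0 sz.
have ts := best_top cB c0 bs; have br := best_rem bs ts.
have fc : feasible c by case: bs => /sol_feasible.
rewrite canonE //; apply: perm_trans (perm_to_rem ts) _; rewrite perm_cons.
apply: IH => //; last lia.
by move: sz; rewrite (perm_size (perm_to_rem ts)) => -[].
Qed.

Lemma canon_best c : c < B -> feasible c -> best c (canon c).
Proof.
move=> cB fc; have [s bs] := best_exists fc; have p := best_canon cB bs.
case: bs => h1 h2 h3; split; rewrite -?(sol_perm _ p) -?(perm_size p) //.
by move=> s' ss' sz'; rewrite -(pot_perm p); exact: h3.
Qed.

Lemma canon_rem c w : c < B -> feasible c -> w \in canon c ->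
  perm_eq (rem w (canon c)) (canon (c - w)).
Proof.
move=> cB fc wc; apply: best_canon; last exact: best_rem (canon_best cB fc) wc.
lia.
Qed.

Lemma canon_wit c w : c < B -> feasible c -> w \in canon c -> wit c w.
Proof. by move=> cB fc; have [h1 h2 _] := canon_best cB fc; exact: wit_of_opt. Qed.

Lemma binary_inj (n : nat) (f g : nat -> bool) : 1 < B ->
  \sum_(i < n) f i * B ^ i = \sum_(i < n) g i * B ^ i ->
  forall i, i < n -> f i = g i.
Proof.
move=> B1; have lt k (h : nat -> bool) : \sum_(i < k) h i * B ^ i < B ^ k.
  elim: k => [|k IH]; first by rewrite big_ord0 expn_gt0; lia.
  have B2 : 2 * B ^ k <= B * B ^ k by rewrite leq_mul2r B1 orbT.
  rewrite big_ord_recr /= expnS; move: IH B2; set S := \sum_(i < k) _.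
  by case: (h k); rewrite ?mul1n ?mul0n; move: (B ^ k) (B * _) S => x y S; lia.
elim: n => // n IH; rewrite !big_ord_recr /=.
have := lt n f; have := lt n g.
set F := \sum_(i < n) _; set G := \sum_(i < n) _; rewrite -/F => l1 l2 E.
have fg : f n = g n by move: E; case: (f n); case: (g n) => //; lia.
move=> i; rewrite ltnS leq_eqVlt => /orP[/eqP -> //|]; apply: IH.
by move: E; rewrite fg; exact: addIn.
Qed.

Lemma pot_uniq (s : seq nat) n : uniq s -> all A s -> (forall w, w \in s -> rho w < n) ->
  pot s = \sum_(i < n) ((i : nat) \in map rho s) * B ^ i.
Proof.
move=> us /allP As sn.
have um : uniq (map rho s).
  by rewrite map_inj_in_uniq // => x y xs ys; apply: rho_inj; apply: As.
rewrite /pot -(big_map rho xpredT (fun i => B ^ i)).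
rewrite -(big_mkord xpredT (fun i => (i \in map rho s) * B ^ i)).
rewrite [RHS](eq_bigr (fun i => if i \in map rho s then B ^ i else 0)); last first.
  by move=> i _; case: (_ \in _); rewrite ?mul1n ?mul0n.
rewrite -big_mkcond /= -[RHS]big_filter; apply: perm_big.
apply: uniq_perm => //; first by rewrite filter_uniq // iota_uniq.
move=> i; rewrite mem_filter mem_index_iota /=; case h: (i \in _) => //=.
by case/mapP: h => w ws ->; rewrite sn.
Qed.

Lemma pot_inj (s s' : seq nat) : 1 < B -> uniq s -> uniq s' -> all A s -> all A s' ->
  pot s = pot s' -> s =i s'.
Proof.
move=> B1 us us' As As' E.
pose n := (\max_(w <- s ++ s') rho w).+1.
have bn w : w \in s ++ s' -> rho w < n.
  by move=> h; rewrite ltnS; apply: leq_bigmax_seq.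
rewrite (pot_uniq us As (n := n)) in E; last by move=> w ws; apply: bn; rewrite mem_cat ws.
rewrite (pot_uniq us' As' (n := n)) in E; last by move=> w ws; apply: bn; rewrite mem_cat ws orbT.
have H := @binary_inj n (fun i => i \in map rho s) (fun i => i \in map rho s') B1 E.
have sub (x y : seq nat) : all A x -> all A y -> (forall w, w \in x -> rho w < n) ->
    (forall i, i < n -> (i \in map rho x) = (i \in map rho y)) -> {subset x <= y}.
  move=> /allP Ax /allP Ay xn hxy w wx.
  have : rho w \in map rho y by rewrite -hxy ?xn // map_f.
  by case/mapP => v vy /rho_inj -> //; [exact: Ax|exact: Ay].
move=> w; apply/idP/idP; apply: sub => //.
- by move=> v vs; apply: bn; rewrite mem_cat vs.
- by move=> v vs; apply: bn; rewrite mem_cat vs orbT.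
by move=> i hi; rewrite H.
Qed.

Lemma canon_support c h : 1 < B -> c < B -> feasible c ->
  (h.+1) * (h * u).+1 < 2 ^ h -> size (undup (canon c)) < h.
Proof.
move=> B1 cB fc hh; rewrite ltnNge; apply/negP => hs.
have [sc sz maxs] := canon_best cB fc.
pose L := take h (undup (canon c)).
have sL : size L = h by rewrite size_takel.
have uL : uniq L by rewrite take_uniq // undup_uniq.
have LA : all A L.
  by apply/allP => w /mem_take; rewrite mem_undup => ws; case/andP: sc => /allP/(_ _ ws).
have sizeL (m : bitseq) : size (mask m L) <= h.
  by rewrite -sL (size_subseq (mask_subseq m L)).
have AL (m : bitseq) : all A (mask m L) by apply/allP => w /mem_mask; move/(allP LA).
have sumL (m : bitseq) : sumn (mask m L) <= h * u.
  apply: leq_trans (_ : size (mask m L) * u <= _); last by rewrite leq_mul2r sizeL orbT.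
  elim: (mask m L) (AL m) => //= w s IH /andP[/A_range Aw /IH].
  by rewrite mulSn; lia.
pose g (m : h.-tuple bool) : 'I_h.+1 * 'I_(h * u).+1 :=
  (inord (size (mask m L)), inord (sumn (mask m L))).
have ninj : ~~ injectiveb g.
  apply/negP => /injectiveP /leq_card; rewrite card_prod !card_ord card_tuple card_bool.
  by rewrite leqNgt hh.
have /injectivePn[m [m' mm' gE]] := ninj.
have [] : size (mask m L) = size (mask m' L) /\ sumn (mask m L) = sumn (mask m' L).
  case: gE => /(congr1 val) /= e1 /(congr1 val) /= e2; move: e1 e2.
  by rewrite !inordK ?ltnS.
move=> eS eT.
have swap (x y : bitseq) : size (mask x L) = size (mask y L) ->
    sumn (mask x L) = sumn (mask y L) -> pot (mask y L) <= pot (mask x L).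
  move=> e1 e2.
  have sub : subseq (mask x L) (undup (canon c)).
    exact: subseq_trans (mask_subseq _ _) (take_subseq _ _).
  have [z pz] : exists z, perm_eq (canon c) (mask x L ++ z).
    by apply: subseq_perm_cat; exact: subseq_trans sub (undup_subseq _).
  have := maxs (mask y L ++ z); rewrite (pot_perm pz) /pot !big_cat /= leq_add2r; apply.
    move: sc; rewrite (sol_perm _ pz) /sol !all_cat !sumn_cat (AL y) e2.
    by case/andP=> /andP[_ ->].
  by rewrite -sz (perm_size pz) !size_cat e1.
have EP : pot (mask m L) = pot (mask m' L).
  by apply/eqP; rewrite eqn_leq !swap.
have um (x : bitseq) : uniq (mask x L) by exact: mask_uniq.
have EM := pot_inj B1 (um m) (um m') (AL m) (AL m') EP.
case/eqP: mm'; apply/val_inj/(@eq_from_nth _ false); first by rewrite !size_tuple.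
move=> i; rewrite size_tuple => ih.
have iL : nth 0 L i \in L by rewrite mem_nth ?sL.
have := EM (nth 0 L i); rewrite !in_mask // iL /= index_uniq ?sL //.
Qed.

Fixpoint rest_rec (n c : nat) : nat :=
  if n is n'.+1 then
    if top (c - top c) == top c then rest_rec n' (c - top c) else c - top c
  else 0.
Definition rest c := rest_rec c c.

Lemma top_step c : 0 < c -> feasible c ->
  [/\ 0 < top c, top c <= c & feasible (c - top c)].
Proof.
move=> c0 fc; have [hw _] := topP c0 fc; have := wit_pos hw.
by case/and4P: hw => _ -> -> _ /andP[-> _].
Qed.

Lemma top0 : top 0 = 0.
Proof.
rewrite /top; case E: [seq _ <- _ | _] => [|x l] //.
have : x \in x :: l by rewrite inE eqxx.
rewrite -E mem_filter => /andP[/andP[hx _] _].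
by have := wit_pos hx; case/and4P: hx; lia.
Qed.

Lemma rest_rec_fuel n c : feasible c -> c <= n -> rest_rec n c = rest c.
Proof.
suff H : forall n1 n2 c, feasible c -> c <= n1 -> c <= n2 -> rest_rec n1 c = rest_rec n2 c.
  by move=> fc cn; apply: H.
elim=> [|n1 IH] [|n2] {}c fc; rewrite ?leqn0 //=.
- by move=> /eqP c0; rewrite c0 sub0n eqxx => _; elim: n2 => //= n2; rewrite sub0n eqxx.
- by move=> _ /eqP c0; rewrite c0 sub0n eqxx; elim: n1 {IH} => //= n1; rewrite sub0n eqxx.
move=> h1 h2; case: eqP => // E; have [c0|c0] := posnP c.
  by apply: IH; rewrite c0 sub0n // -c0.
by have [? ? ?] := top_step c0 fc; apply: IH => //; lia.
Qed.

Lemma restE c : 0 < c -> feasible c ->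
  rest c = if top (c - top c) == top c then rest (c - top c) else c - top c.
Proof.
move=> c0 fc; have [h1 h2 h3] := top_step c0 fc.
case: c c0 fc h1 h2 h3 => // n _ fc h1 h2 h3; rewrite {1}/rest /=.
by case: eqP => // _; apply: rest_rec_fuel => //; lia.
Qed.

Lemma rest_lt c : 0 < c -> feasible c -> rest c < c /\ feasible (rest c).
Proof.
elim: {c}c.+1 {-2}c (ltnSn c) => // n IH c cn c0 fc.
have [h1 h2 h3] := top_step c0 fc; rewrite restE //; case: eqP => E; last by split=> //; lia.
have c1 : 0 < c - top c by rewrite lt0n; apply/eqP => z; move: E; rewrite z top0; lia.
by have [|//|//|] := IH (c - top c); [lia|split=> //; lia].
Qed.

Lemma top_sub c : 0 < c -> feasible c -> 0 < c - top c ->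
  rho (top (c - top c)) <= rho (top c).
Proof.
move=> c0 fc c1; have [h1 h2 h3] := top_step c0 fc; have [ht hm] := topP c0 fc.
by have [hs _] := topP c1 h3; apply: hm; apply: wit_sub ht hs.
Qed.

Lemma canon_restP c : 0 < c -> feasible c -> c < B ->
  [/\ forall w, w \in canon c -> w = top c \/ w \in canon (rest c),
      {subset canon (rest c) <= canon c} & top c \notin canon (rest c)].
Proof.
elim: {c}c.+1 {-2}c (ltnSn c) => // n IH c cn c0 fc cB.
have [h1 h2 h3] := top_step c0 fc; rewrite restE // (canonE c0 fc).
case: eqP => E.
  have c1 : 0 < c - top c by rewrite lt0n; apply/eqP => z; move: E; rewrite z top0; lia.
  have [||||I1 I2 I3] := IH (c - top c); try lia; try by [].
  rewrite E in I1 I3; split=> //.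
  - by move=> w; rewrite inE => /orP[/eqP ->|/I1 //]; left.
  - by move=> w /I2; rewrite inE => ->; rewrite orbT.
split.
- by move=> w; rewrite inE => /orP[/eqP ->|]; [left|right].
- by move=> w; rewrite inE => ->; rewrite orbT.
apply/negP => tin; have [z|c1] := posnP (c - top c).
  by move: tin; rewrite z canon0.
have hw : wit (c - top c) (top c) by apply: canon_wit tin => //; lia.
have [hs hm] := topP c1 h3; have le1 := hm _ hw; have le2 := top_sub c0 fc c1.
apply: E; apply: rho_inj; [by case/and4P: hs|by case/and4P: hw|].
by apply/eqP; rewrite eqn_leq le1 le2.
Qed.

Lemma rest_chain b n w : feasible b -> b < B -> size (undup (canon b)) <= n ->
  w \in canon b -> exists2 j, j < n & 0 < iter j rest b /\ w = top (iter j rest b).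
Proof.
elim: n b => [|n IH] b fb bB sz wb.
  by move: sz; rewrite leqn0 size_eq0; case: (canon b) wb => // x l _; rewrite -size_eq0 -leqn0 leqNgt -has_predT; have := mem_undup (x :: l) x; rewrite inE eqxx; case: undup.
have b0 : 0 < b by rewrite lt0n; apply/eqP => z; move: wb; rewrite z canon0.
have [H1 H2 H3] := canon_restP b0 fb bB; have [r1 r2] := rest_lt b0 fb.
case: (H1 w wb) => [->|wr]; first by exists 0.
have [||||j jn [jp jw]] := IH (rest b) => //; first lia.
  rewrite -ltnS; apply: leq_trans sz.
  have : size (top b :: undup (canon (rest b))) <= size (undup (canon b)).
    apply: uniq_leq_size; first by rewrite /= mem_undup H3 undup_uniq.
    move=> x; rewrite inE !mem_undup => /orP[/eqP ->|/H2 //].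
    by rewrite canonE // inE eqxx.
  by [].
by exists j.+1 => //; rewrite iterSr.
Qed.

Lemma iter_rest b j : feasible b -> feasible (iter j rest b) /\ iter j rest b <= b.
Proof.
elim: j => //= j IH fb; have [f1 l1] := IH fb.
have [z|p] := posnP (iter j rest b); first by rewrite z /rest /= /feasible mincoins0.
by have [h1 h2] := rest_lt p f1; split=> //; lia.
Qed.

Lemma canon_dup b h : feasible b -> b < B -> size (undup (canon b)) < h ->
  h <= mincoins b ->
  exists w, [/\ wit b w, 0 < b - w, feasible (b - w), w \in canon (b - w) &
     top (b - w) = top b].
Proof.
move=> fb bB sh hm; have [sc sz _] := canon_best bB fb.
have /negbTE nu : ~~ uniq (canon b) by apply/negP => /undup_id E; rewrite E sz in sh; lia.
have [w wb wr] : exists2 w, w \in canon b & w \in rem w (canon b).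
  elim: (canon b) nu => //= x s IH; case xs: (x \in s) => /=.
    by move=> _; exists x; rewrite ?inE eqxx ?xs.
  move/IH => [w ws wr]; exists w; first by rewrite inE ws orbT.
  by case: eqP => // _; rewrite inE wr orbT.
have hw := canon_wit bB fb wb; have /and4P[Aw wlb fbw _] := hw.
have p := canon_rem bB fb wb; have w0 := wit_pos hw.
have wc : w \in canon (b - w) by rewrite -(perm_mem p).
have b1 : 0 < b - w by rewrite lt0n; apply/eqP => z; move: wc; rewrite z canon0.
exists w; split=> //; apply: top_eq.
have b0 : 0 < b by lia.
have bwB : b - w < B by lia.
have [t1 t2] := topP b0 fb.
have tc : top b \in canon (b - w).
  have [->//|tw] := eqVneq (top b) w.
  have : top b \in canon b by rewrite canonE // inE eqxx.
  by rewrite (perm_mem (perm_to_rem wb)) inE (negbTE tw) (perm_mem p).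
split; first exact: canon_wit tc.
by move=> w' hw'; apply: t2; apply: wit_sub hw hw'.
Qed.

End Coins.

(** * The final dynamic program *)

Section DPMath.
Variables (u t : nat) (A : nat -> bool) (rho : nat -> nat).
Hypothesis A_range : forall w, A w -> 0 < w <= u.
Hypothesis rho_inj : forall w w', A w -> A w' -> rho w = rho w' -> w = w'.
Implicit Types F T : nat -> nat.

Local Notation mc := (mincoins u A).
Local Notation fea := (feasible u A).
Local Notation wt := (wit u A).
Local Notation tp := (top u A rho).
Local Notation rst := (rest u A rho).
Local Notation cn := (canon u A rho).

Definition dp_valid F T := forall c, c <= t ->
  F c = t.+1 \/
  [/\ fea c, mc c <= F c, F c <= t & F c = mc c -> 0 < c -> wt c (T c)].

Definition dp_exact F T c := F c = mc c /\ (0 < c -> T c = tp c).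

Definition dp_pushed F T c k r := F c <= k /\ (F c = k -> r <= rho (T c)).

Definition dp_better F T d k x := (k < F d) || (k == F d) && (rho (T d) < rho x).

Definition dp_relaxed F T d k x F' T' :=
  if dp_better F T d k x then
    (forall c, F' c = if c == d then k else F c) /\
    (forall c, T' c = if c == d then x else T c)
  else (forall c, F' c = F c) /\ (forall c, T' c = T c).

Lemma wit_ext b w x : fea b -> wt b x -> A w -> mc (b + w) = (mc b).+1 ->
  wt (b + w) x.
Proof.
move=> fb hx Aw E; have [s [ss sz xs]] := opt_of_wit A_range hx.
apply: (@wit_of_opt u A A_range _ (w :: s)); rewrite ?inE ?xs ?orbT //= ?sz ?E //.
by rewrite addnC; apply: sol_cons.
Qed.

Section Relax.
Variables (F T F' T' : nat -> nat) (b w x : nat).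
Hypotheses (b0 : 0 < b) (fb : fea b) (Aw : A w) (hx : wt b x) (dt : b + w <= t).
Hypothesis R : dp_relaxed F T (b + w) (mc b).+1 x F' T'.

Let w0 := A_range Aw.
Let fd : fea (b + w).
Proof. have [s ss _] := mincoins_sol A_range fb; rewrite addnC; exact: (sol_feasible A_range (sol_cons Aw ss)). Qed.
Let md : mc (b + w) <= (mc b).+1.
Proof. by rewrite addnC; apply: mincoins_step. Qed.

Lemma relax_valid : dp_valid F T -> dp_valid F' T'.
Proof.
move=> V c ct; move: R; rewrite /dp_relaxed; case: ifP => _ [EF ET]; last by rewrite EF ET; exact: V.
rewrite EF ET; case: eqP => [->|_]; last exact: V.
right; split=> //; first by have : mc b <= b := fb; lia.
by move=> E _; apply: wit_ext.
Qed.

Lemma relax_exact c : fea c -> dp_exact F T c -> dp_exact F' T' c.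
Proof.
move=> fc [E1 E2]; move: R; rewrite /dp_relaxed; case: ifP => H [EF ET];
  last by rewrite /dp_exact EF ET.
rewrite /dp_exact EF ET; case: eqP => [cd|] //; move: H.
rewrite /dp_better -cd E1 ltnNge cd md /=; case/andP=> /eqP E.
rewrite -cd E2; last by lia.
have wd := wit_ext fb hx Aw (esym E).
have [_ maxt] : is_top u A rho c (tp c) by apply: topP => //; lia.
by rewrite ltnNge maxt // cd.
Qed.

Lemma relax_pushed c k r : dp_pushed F T c k r -> dp_pushed F' T' c k r.
Proof.
move=> [E1 E2]; move: R; rewrite /dp_relaxed; case: ifP => H [EF ET];
  last by rewrite /dp_pushed EF ET.
rewrite /dp_pushed EF ET; case: eqP => [cd|] //; move: H.
rewrite /dp_better -cd => /orP[lt|/andP[/eqP -> lt]]; first by split; lia.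
by split=> // /E2; lia.
Qed.

Lemma relax_new : dp_pushed F' T' (b + w) (mc b).+1 (rho x).
Proof.
move: R; rewrite /dp_relaxed /dp_pushed; case: ifP => [_|/negbT H] [EF ET].
  by rewrite EF ET eqxx.
rewrite EF ET; move: H; rewrite /dp_better negb_or -leqNgt => /andP[H1 H2].
by split=> // E; move: H2; rewrite E eqxx /= -leqNgt.
Qed.
End Relax.

Variable h : nat.
Hypothesis h_large : h.+1 * (h * u).+1 < 2 ^ h.

Lemma support_lt b : fea b -> size (undup (cn b)) < h.
Proof. by move=> fb; apply: (@canon_support u A A_range rho rho_inj b.+2). Qed.

(* A target with at least [h] coins repeats a coin [w]; it is then reached from
   [b - w], whose canonical solution still contains [w]. *)
Lemma dp_exact_next F T b : b <= t -> fea b -> dp_valid F T ->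
  (mc b <= h -> dp_exact F T b) ->
  (forall b' w, 0 < b' -> fea b' -> w \in cn b' -> b' + w = b ->
     dp_pushed F T b (mc b').+1 (rho (tp b'))) ->
  dp_exact F T b.
Proof.
move=> bt fb V low push; have [/low //|hb] := leqP (mc b) h.
have [w [hw p f' wc E]] := canon_dup A_range rho_inj fb (ltnW (ltnSn b.+1)) (support_lt fb) (ltnW hb).
have /and4P[Aw wb _ /eqP mE] := hw.
have [P1 P2] := push (b - w) w p f' wc (subnK wb).
case: (V b bt) => [Fb|[_ V1 _ V2]].
  by have : mc b <= b := fb; lia.
have FE : F b = mc b by lia.
have b0 : 0 < b by lia.
split=> // _; have h1 := V2 FE b0.
have [t1 t2] := topP A_range rho b0 fb.
apply: rho_inj; [by case/and4P: h1|by case/and4P: t1|].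
apply/eqP; rewrite eqn_leq t2 // -E P2 //; lia.
Qed.

End DPMath.

(* Register conventions of all programs: 1 [u], 2 [t], 3 [n], 4 [b], 5 [h],
   6 [M], 7 [K] with [2 ^ K] the length of the convolutions, 8 [J] their recursion
   depth, 9 [P], 10 [Q], 11 [(u + 1) ^ 2], 13 [u + 1], 14 [2 ^ K], 15 [t + 1],
   16 [b + 1], 18 [2 * K].
   Arrays: 0 coins; 1 [f] and 2 the top coins of small targets; 3 the cells
   [c + f(c) M]; 4 and 5 argument and answer of a query; 6 [A_i]; 7 [A_(i+1)];
   8 targets still to be hit; 9 the last [i] with [w] in [A_i]; 10 [f], 16 the top
   coins, and 17 the targets left after removing all copies of the top coin from a
   canonical solution; 11, 12, 24, 25 and 26 belong to the convolution.
   Here 40 is the current target, 41 runs through the remainders of its canonical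
   solution, 43 is the coin, 44 the new target and 45 its candidate value. *)
Definition rank_key (e : aexp) := Op Ad (Op Mu (Ar 9 e) (Va 13)) e.

Definition dp_relax :=
  Sq (Set_ 44 (Op Ad (Va 40) (Va 43)))
  (Cn (Op Lt (Va 44) (Va 15))
   (Sq (Set_ 45 (Op Ad (Ar 10 (Va 40)) (Nu 1)))
    (Cn (Op Ad (Op Lt (Va 45) (Ar 10 (Va 44)))
               (Op Mu (Op Eq (Va 45) (Ar 10 (Va 44)))
                      (Op Lt (rank_key (Ar 16 (Va 44))) (rank_key (Ar 16 (Va 40))))))
       (Sq (Put 10 (Va 44) (Va 45)) (Put 16 (Va 44) (Ar 16 (Va 40)))) Nop)) Nop).

Definition dp_walk :=
  Fo 42 5 (Sq (Set_ 43 (Ar 16 (Va 41)))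
          (Sq (Cn (Op Lt (Nu 0) (Va 41)) dp_relax Nop)
              (Set_ 41 (Ar 17 (Va 41))))).

Definition dp_body :=
  Cn (Op Mu (Op Lt (Nu 0) (Va 40)) (Op Lt (Ar 10 (Va 40)) (Va 15)))
  (Sq (Set_ 46 (Op Su (Va 40) (Ar 16 (Va 40))))
  (Sq (Cn (Op Eq (Ar 16 (Va 46)) (Ar 16 (Va 40)))
          (Put 17 (Va 40) (Ar 17 (Va 46))) (Put 17 (Va 40) (Va 46)))
  (Sq (Set_ 41 (Va 40)) dp_walk))) Nop.

Definition dp_init :=
  Sq (mapl 10 40 15 (Op Ad (Ar 1 (Va 40)) (Op Mu (Op Eq (Ar 1 (Va 40)) (Nu 0)) (Va 15))))
  (Sq (mapl 16 40 15 (Ar 2 (Va 40)))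
  (Sq (Put 10 (Nu 0) (Nu 0)) (Sq (Put 16 (Nu 0) (Nu 0)) (Put 17 (Nu 0) (Nu 0))))).

Definition dp_prog := Sq dp_init (Fo 40 15 dp_body).

Section DPProg.
Variables (W lim : nat) (ub : nat -> nat).
Variables (u t h : nat) (A : nat -> bool) (a0 : astate).
Hypothesis A_range : forall w, A w -> 0 < w <= u.
Hypothesis h_large : h.+1 * (h * u).+1 < 2 ^ h.
Hypotheses (r5 : rg a0 5 = h) (r13 : rg a0 13 = u.+1) (r15 : rg a0 15 = t.+1).
Hypotheses (ub5 : h <= ub 5) (ub15 : t.+1 <= ub 15).
Hypotheses (lim_ut : u + t + 2 < lim).
Let rho (w : nat) := av a0 9 w * u.+1 + w.
Hypothesis low_lim : forall i, av a0 2 i < lim.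
Local Notation mc := (mincoins u A).
Local Notation fea := (feasible u A).
Local Notation wt := (wit u A).
Local Notation tp := (top u A rho).
Local Notation rst := (rest u A rho).
Local Notation cn := (canon u A rho).
Hypothesis low_ok : forall c, 0 < av a0 1 c ->
  [/\ fea c, 0 < c, av a0 1 c = mc c & av a0 2 c = tp c].
Hypothesis low_all : forall c, 0 < c -> fea c -> mc c <= h -> 0 < av a0 1 c.

Lemma rho_inj w w' : A w -> A w' -> rho w = rho w' -> w = w'.
Proof.
move=> /A_range h1 /A_range h2 /(congr1 (fun x => x %% u.+1)).
by rewrite /rho !modnMDl !modn_small //; lia.
Qed.

Lemma dp_relax_tri a b w x (Q : astate -> Prop) :
  rg a 40 = b -> rg a 43 = w -> rg a 13 = u.+1 -> rg a 15 = t.+1 ->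
  av a 9 = av a0 9 -> b <= t -> w <= u -> fea b -> 
  av a 10 b = mc b -> av a 16 b = x -> x <= u ->
  (forall a', keep dp_relax a a' -> 
     (b + w <= t -> dp_relaxed rho (av a 10) (av a 16) (b + w) (mc b).+1 x (av a' 10) (av a' 16)) ->
     (t < b + w -> av a' 10 = av a 10 /\ av a' 16 = av a 16) -> Q a') ->
  tri W lim ub dp_relax a Q.
Proof.
move=> e40 e43 e13 e15 e9 bt wu fb eF eT xu HQ.
suff: tri W lim ub dp_relax a (fun a' =>
     (b + w <= t -> dp_relaxed rho (av a 10) (av a 16) (b + w) (mc b).+1 x (av a' 10) (av a' 16)) /\
     (t < b + w -> av a' 10 = av a 10 /\ av a' 16 = av a 16)).
  by move/tri_conseq; apply => a' K [h1 h2]; apply: HQ.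
have mb : mc b <= b := fb.
apply: tri_seq; apply: (@tri_set _ _ _ _ _ (b + w)); rewrite /= ?e40 ?e43 //; first lia.
apply: tri_cn => /=; rewrite /upd /= e15; last first.
  move=> /eqP; rewrite eqb0 ltnS -ltnNge => h1; apply: tri_nop; split=> //=.
  by rewrite leqNgt h1.
rewrite -lt0n lt0b ltnS => dt.
apply: tri_seq; apply: (@tri_set _ _ _ _ _ (mc b).+1).
- by rewrite /= /upd /= e40 eF addn1.
- by lia.
have guard : ev W (setr (setr a 44 (b + w)) 45 (mc b).+1) (Op Ad (Op Lt (Va 45) (Ar 10 (Va 44)))
               (Op Mu (Op Eq (Va 45) (Ar 10 (Va 44)))
                      (Op Lt (rank_key (Ar 16 (Va 44))) (rank_key (Ar 16 (Va 40))))))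
    = ((mc b).+1 < av a 10 (b + w)) + ((mc b).+1 == av a 10 (b + w)) * (rho (av a 16 (b + w)) < rho x).
  by rewrite /= /upd /= e40 eT e13 e9.
apply: tri_cn; rewrite guard => g.
  apply: tri_seq; apply: (@tri_put _ _ _ _ _ _ (b + w) (mc b).+1) => //=; first by lia.
  apply: (@tri_put _ _ _ _ _ _ (b + w) x) => //=.
  - by rewrite /upd /= e40.
  - by lia.
  split; last by rewrite ltnNge dt.
  move=> _; rewrite /dp_relaxed (_ : dp_better _ _ _ _ _ _) //.
  by move: g; rewrite /dp_better addn_eq0 muln_eq0 !eqb0 negb_and negb_or !negbK.
apply: tri_nop; split=> //=; move=> _; rewrite /dp_relaxed (_ : dp_better _ _ _ _ _ _ = false) //.
by move/eqP: g; rewrite /dp_better addn_eq0 muln_eq0 !eqb0 -negb_and -negb_or => /negbTE.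
Qed.

Record dp_inv (b : nat) (a : astate) : Prop := DPInv
  { di_valid : dp_valid u t A (av a 10) (av a 16);
    di_low : forall c, c <= t -> fea c -> mc c <= h -> dp_exact u A rho (av a 10) (av a 16) c;
    di_done : forall c, c < b -> c <= t -> fea c ->
      dp_exact u A rho (av a 10) (av a 16) c /\ av a 17 c = rst c;
    di_push : forall b' w, 0 < b' -> b' < b -> fea b' -> w \in cn b' -> b' + w <= t ->
      dp_pushed rho (av a 10) (av a 16) (b' + w) (mc b').+1 (rho (tp b'));
    di_T0 : av a 16 0 = 0;
    di_R0 : av a 17 0 = 0 }.

Record walk_inv (a1 : astate) (b j : nat) (a : astate) : Prop := WalkInv
  { wi_y : rg a 41 = iter j rst b;
    wi_valid : dp_valid u t A (av a 10) (av a 16);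
    wi_exact : forall c, fea c -> dp_exact u A rho (av a1 10) (av a1 16) c ->
      dp_exact u A rho (av a 10) (av a 16) c;
    wi_push : forall c k r, dp_pushed rho (av a1 10) (av a1 16) c k r ->
      dp_pushed rho (av a 10) (av a 16) c k r;
    wi_new : forall i, i < j -> 0 < iter i rst b -> b + tp (iter i rst b) <= t ->
      dp_pushed rho (av a 10) (av a 16) (b + tp (iter i rst b)) (mc b).+1 (rho (tp b));
    wi_T0 : av a 16 0 = 0 }.

Lemma relaxed_ne F T d k x F' T' c : dp_relaxed rho F T d k x F' T' -> c != d ->
  F' c = F c /\ T' c = T c.
Proof.
by rewrite /dp_relaxed; case: ifP => _ [EF ET] /negbTE cd; rewrite EF ET ?cd.
Qed.

Lemma dp_walk_tri a1 b (Q : astate -> Prop) :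
  0 < b -> b <= t -> fea b -> rg a1 40 = b -> rg a1 41 = b ->
  rg a1 5 = h -> rg a1 13 = u.+1 -> rg a1 15 = t.+1 -> av a1 9 = av a0 9 ->
  dp_valid u t A (av a1 10) (av a1 16) -> av a1 16 0 = 0 -> av a1 17 0 = 0 ->
  (forall c, c <= b -> fea c -> dp_exact u A rho (av a1 10) (av a1 16) c /\ av a1 17 c = rst c) ->
  (forall a', walk_inv a1 b h a' -> keep dp_walk a1 a' -> Q a') ->
  tri W lim ub dp_walk a1 Q.
Proof.
move=> b0 bt fb e40 e41 e5 e13 e15 e9 V T0 R0 E HQ.
apply: (@tri_conseq _ _ _ _ _ (walk_inv a1 b h)); last by move=> a' K I; exact: HQ I K.
apply: (@tri_for _ _ _ _ _ _ _ (walk_inv a1 b)); rewrite ?e5 //.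
- move=> j a jh K I; case: I => I1 I2 I3 I4 I5 I6.
  have [fy yb] := iter_rest A_range rho j fb.
  set y := iter j rst b in I1 fy yb *.
  have [Ey Ry] := E y yb fy.
  have [Ea1 Ea2] := I3 y fy Ey.
  have [Eb1 Eb2] := I3 b fb (E b (leqnn b) fb).1.
  have k17 : av a 17 = av a1 17 by apply: (keep_a K).
  have k9 : av a 9 = av a0 9 by rewrite (keep_a K).
  have [hb mb] := topP A_range rho b0 fb.
  have wbp := wit_pos A_range hb.
  have ty : 0 < y -> [/\ A (tp y), tp y <= u & 0 < tp y].
    by move=> y0; have [hy _] := topP A_range rho y0 fy; have /andP[p1 p2] := wit_pos A_range hy; case/and4P: hy.
  have Ty : av a 16 y = tp y.
    by have [z|/Ea2 //] := posnP y; rewrite z I6 (top0 A_range).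
  have tyl : tp y < lim.
    by have [z|/ty[]] := posnP y; [rewrite z (top0 A_range)|]; lia.
  apply: tri_seq; apply: (@tri_set _ _ _ _ _ (tp y)) => //=; first by rewrite /upd /= I1.
  apply: tri_seq.
  apply: (@tri_conseq _ _ _ _ _ (fun a' =>
    [/\ dp_valid u t A (av a' 10) (av a' 16),
     (forall c, fea c -> dp_exact u A rho (av a1 10) (av a1 16) c ->
      dp_exact u A rho (av a' 10) (av a' 16) c),
     (forall c k r, dp_pushed rho (av a1 10) (av a1 16) c k r ->
      dp_pushed rho (av a' 10) (av a' 16) c k r),
     (forall i, i < j.+1 -> 0 < iter i rst b -> b + tp (iter i rst b) <= t ->
      dp_pushed rho (av a' 10) (av a' 16) (b + tp (iter i rst b)) (mc b).+1 (rho (tp b)))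
     & av a' 16 0 = 0])); last first.
    move=> a' K' [J1 J2 J3 J4 J5]; apply: (@tri_set _ _ _ _ _ (rst y)).
    - by rewrite /= (keep_r K') // (keep_a K') //= /upd /= I1 k17 Ry.
    - have [z|yp] := posnP y; first by rewrite z /rest /=; lia.
      by have [] := rest_lt A_range rho yp fy; lia.
    by split.
  apply: tri_cn => /=; rewrite /upd /= I1 -/y.
    rewrite -lt0n lt0b => yp; have [Aty tyu ty0] := ty yp.
    apply: (@dp_relax_tri _ b (tp y) (tp b)) => //=; rewrite /upd /= ?(keep_r K) //.
    - exact: Eb2.
    - by lia.
    move=> a' K' H1 H2.
    have [dt|dt] := leqP (b + tp y) t; last first.
      have [-> ->] := H2 dt; split=> // i; rewrite ltnS leq_eqVlt => /orP[/eqP -> _|]; last exact: I5.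
      by rewrite -/y leqNgt dt.
    have R := H1 dt; split.
    - exact: (relax_valid A_range b0 fb Aty hb dt R I2).
    - by move=> c fc Ec; apply: (relax_exact A_range b0 fb Aty hb dt R) => //; apply: I3.
    - by move=> c k r P; apply: (relax_pushed A_range b0 fb Aty hb dt R); apply: I4.
    - move=> i; rewrite ltnS leq_eqVlt => /orP[/eqP -> _ _|ij ip id]; first exact: (relax_new R).
      by apply: (relax_pushed A_range b0 fb Aty hb dt R); apply: I5.
    by have [|_ ->] := relaxed_ne (c := 0) R; [lia|].
  move=> /eqP; rewrite eqb0 -leqNgt leqn0 => /eqP y0; apply: tri_nop; split=> //.
  move=> i; rewrite ltnS leq_eqVlt => /orP[/eqP ->|]; last exact: I5.
  by rewrite -/y y0.
by move=> a' K [I1 I2 I3 I4 I5 I6]; split.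
Qed.

Lemma dp_prog_tri (Q : astate -> Prop) :
  (forall a', keep dp_prog a0 a' ->
     (forall c, c <= t -> av a' 10 c = if fea c then mc c else t.+1) -> Q a') ->
  tri W lim ub dp_prog a0 Q.
Proof.
move=> HQ.
apply: (@tri_conseq _ _ _ _ _ (fun a' => forall c, c <= t -> av a' 10 c = if fea c then mc c else t.+1)); last first.
  by move=> a' K H; apply: HQ.
apply: tri_seq; apply: (@tri_conseq _ _ _ _ _ (dp_inv 0)).
  apply: tri_seq; apply: (@tri_map _ _ _ _ _ _ _ _ (fun c => if 0 < av a0 1 c then av a0 1 c else t.+1)).
  - by rewrite r15.
  - move=> i a'; rewrite r15 => it e40 Er Ea _; rewrite /= e40 !Ea // Er // r15.
    split; last first.
      move=> _; case: ifP => [/low_ok[fi _ -> _]|_]; last lia.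
      by have : mc i <= i := fi; lia.
    by rewrite lt0n; case: eqP => [->|_] /=; rewrite ?mul1n ?mul0n ?addn0.
  move=> a1 Er1 Ea1 _ E1.
  apply: tri_seq; apply: (@tri_map _ _ _ _ _ _ _ _ (fun c => av a0 2 c)).
  - by rewrite Er1 // r15.
  - by move=> i a' _ e40 Er Ea _; rewrite /= e40 !Ea // Ea1.
  move=> a2 Er2 Ea2 _ E2.
  apply: tri_seq; apply: (@tri_put _ _ _ _ _ _ 0 0) => //=; first lia.
  apply: tri_seq; apply: (@tri_put _ _ _ _ _ _ 0 0) => //=; first lia.
  apply: (@tri_put _ _ _ _ _ _ 0 0) => //=; first lia.
  have F_E c : c <= t -> (if c == 0 then 0 else av a2 10 c) =
      if c == 0 then 0 else if 0 < av a0 1 c then mc c else t.+1.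
    move=> ct; case: eqP => // c0; rewrite Ea2 // E1 r15 ltnS ct.
    by case: ifP => // /low_ok[].
  have T_E c : c <= t -> (if c == 0 then 0 else av a2 16 c) = if c == 0 then 0 else av a0 2 c.
    by move=> ct; case: eqP => // c0; rewrite E2 Er1 // r15 ltnS ct.
  have m0 : fea 0 by rewrite /feasible (mincoins0 A_range).
  split=> //=; rewrite /upd /=.
  - move=> c ct; rewrite F_E // T_E //; case: eqP => [->|/eqP c0].
      by right; rewrite (mincoins0 A_range); split.
    case: ifP => [/low_ok[fc c1 _ ->]|_]; [right|by left].
    split=> //; first by apply: leq_trans ct.
    by move=> _ _; case: (topP A_range rho c1 fc).
  - move=> c ct fc mh; rewrite /dp_exact F_E // T_E //; case: eqP => [->|/eqP].
      by rewrite (mincoins0 A_range).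
    rewrite -lt0n => c0; have l := low_all c0 fc mh; rewrite l.
    by have [] := low_ok l.
move=> a K I0.
have e15 : rg a 15 = t.+1 by rewrite (keep_r K).
apply: (@tri_for _ _ _ _ _ _ _ dp_inv); rewrite ?e15 //; last first.
  move=> a' _ [V _ D _ _ _] c ct /=; case: ifP => fc; first by have [[-> _] _] := D c ct ct fc.
  by case: (V c ct) => [//|[]]; rewrite fc.
move=> b a' bt K' I; rewrite ltnS in bt; case: I => I1 I2 I3 I4 I5 I6.
have e5' : rg a' 5 = h by rewrite (keep_r K') // (keep_r K).
have e13' : rg a' 13 = u.+1 by rewrite (keep_r K') // (keep_r K).
have e15' : rg a' 15 = t.+1 by rewrite (keep_r K').
have e9' : av a' 9 = av a0 9 by rewrite (keep_a K') // (keep_a K).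
have F0 : fea 0 by rewrite /feasible (mincoins0 A_range).
have ex : fea b -> dp_exact u A rho (av a' 10) (av a' 16) b.
  move=> fb; apply: (dp_exact_next A_range rho_inj h_large bt fb I1); first exact: I2.
  move=> b' w b'0 fb' wc E; rewrite -E; apply: I4 => //; last by rewrite E.
  have := canon_wit A_range rho_inj (ltnW (ltnSn b'.+1)) fb' wc.
  by move/(wit_pos A_range); lia.
apply: tri_cn => /=; rewrite /upd /= e15'; last first.
  move=> g; apply: tri_nop; split=> //=; last first.
    move=> b' w p lt fb' wc dt; move: lt; rewrite ltnS leq_eqVlt => /orP[/eqP E|lt]; last exact: I4.
    have [E1 _] := ex (eq_ind _ (fun z => fea z) fb' _ E).
    by move: g; rewrite -{1}E p E1 -E mul1n => /eqP; rewrite eqb0; have : mc b' <= b' := fb'; lia.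
  move=> c; rewrite ltnS leq_eqVlt => /orP[/eqP -> _ fb|]; last exact: I3.
  split; first exact: ex.
  have [z|p] := posnP b; first by rewrite z I6.
  have [E1 _] := ex fb.
  by move: g; rewrite p E1 mul1n => /eqP; rewrite eqb0; have : mc b <= b := fb; lia.
move=> g; have [b0 Fb] : 0 < b /\ av a' 10 b <= t.
  by move: g; case: (0 < b) => //; rewrite mul1n -lt0n lt0b ltnS.
have fb : fea b by case: (I1 b bt) => [E|[]//]; rewrite E in Fb; lia.
have [E1 /(_ b0) E2] := ex fb.
have [s1 s2 s3] := top_step A_range rho b0 fb.
have [D1 D2] := I3 (b - tp b) ltac:(lia) ltac:(lia) s3.
have Tb : av a' 16 (b - tp b) = tp (b - tp b).
  by have [z|/D1.2 //] := posnP (b - tp b); rewrite z I5 (top0 A_range).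
have [rb1 rb2] := rest_lt A_range rho b0 fb.
apply: tri_seq; apply: (@tri_set _ _ _ _ _ (b - tp b)); [by rewrite /= /upd /= E2|lia|].
pose a2 := seta (setr (setr a' 40 b) 46 (b - tp b)) 17 b (rst b).
apply: tri_seq.
have mid : tri W lim ub (Cn (Op Eq (Ar 16 (Va 46)) (Ar 16 (Va 40)))
          (Put 17 (Va 40) (Ar 17 (Va 46))) (Put 17 (Va 40) (Va 46)))
    (setr (setr a' 40 b) 46 (b - tp b)) (fun a3 => a3 = a2).
  apply: tri_cn => /=; rewrite /upd /= Tb E2.
    rewrite -lt0n lt0b => e; apply: (@tri_put _ _ _ _ _ _ b (rst b)) => //=; last by lia.
    by rewrite /upd /= D2 [RHS](restE A_range) // e.
  move=> /eqP; rewrite eqb0 => /negbTE e; apply: (@tri_put _ _ _ _ _ _ b (rst b)) => //=; last by lia.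
  by rewrite /upd /= [RHS](restE A_range) // e.
apply: (tri_conseq mid) => a3 _ -> {mid a3}.
apply: tri_seq; apply: (@tri_set _ _ _ _ _ b); [by rewrite /= /upd|lia|].
apply: (@dp_walk_tri _ b) => //=; rewrite /upd /=.
- by case: eqP => // z; lia.
- move=> c cb fc; case: eqP => [->|/eqP cb']; first by split=> //; exact: ex.
  by apply: I3 => //; lia.
move=> a3 [J1 J2 J3 J4 J5 J6] K3; have k17 : av a3 17 = av a2 17 by rewrite (keep_a K3).
split=> //=.
- by move=> c ct fc mh; apply: J3 => //; apply: I2.
- move=> c cb ct fc; move: cb; rewrite ltnS k17 /a2 /= /upd leq_eqVlt.
  case: eqP => [-> _|_ /= cb]; first by split=> //; apply: J3 => //; exact: ex.
  by have [G1 G2] := I3 c cb ct fc; split=> //; apply: J3.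
- move=> b' w p; rewrite ltnS leq_eqVlt => /orP[/eqP -> fb' wc dt|lt fb' wc dt]; last first.
    by apply: J4; apply: I4.
  have [j jh [jp jw]] := rest_chain A_range rho_inj fb (ltnW (ltnSn b.+1)) (ltnW (support_lt A_range rho_inj h_large fb)) wc.
  by rewrite jw; apply: J5 => //; rewrite -jw.
- by rewrite k17 /a2 /= /upd; case: eqP => // z; lia.
Qed.

End DPProg.

(** * Nussbaumer's convolution *)

Section Nussbaumer.
Local Open Scope ring_scope.
Implicit Types (x f A B C : nat -> int) (y z : algC).

Lemma sum_2n n (F : nat -> algC) :
  \sum_(r < 2 * n) F r = \sum_(r < n) F r + \sum_(r < n) F (n + r)%N.
Proof. by rewrite mul2n -addnn big_split_ord. Qed.

Definition ext (m : nat) f (v : nat) : int :=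
  if (v < m)%N then f v else - f (v - m)%N.

Definition padf (l m : nat) x (i : nat) : int :=
  let r := (i %/ m %% (2 * l))%N in
  if (r < l)%N then x (i %/ m %/ (2 * l) * (l * m) + i %% m * l + r)%N else 0.

Definition stagef (h m : nat) (e : nat -> nat) x (i : nat) : int :=
  let q := (i %% m)%N in let r := (i %/ m %% (2 * h))%N in
  let g := (i %/ m %/ (2 * h))%N in
  let b0 := ((g * (2 * h) + r %% h) * m)%N in
  let b1 := ((g * (2 * h) + r %% h + h) * m)%N in
  let y := ext m (fun v => x (b1 + v)%N) (q + m - e g)%N in
  if (r < h)%N then x (b0 + q)%N - y else x (b0 + q)%N + y.

Definition istagef (h m : nat) (e : nat -> nat) x (i : nat) : int :=
  let q := (i %% m)%N in let r := (i %/ m %% (2 * h))%N in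
  let g := (i %/ m %/ (2 * h))%N in
  let b0 := ((g * (2 * h) + r %% h) * m)%N in
  let b1 := ((g * (2 * h) + r %% h + h) * m)%N in
  if (r < h)%N then x (b0 + q)%N + x (b1 + q)%N
  else ext m (fun v => x (b0 + v)%N - x (b1 + v)%N) (q + e g)%N.

Definition unpadf (l m : nat) x (i : nat) : int :=
  let r := (i %% l)%N in let q := (i %/ l %% m)%N in
  let b := (i %/ l %/ m)%N in
  x ((b * (2 * l) + r) * m + q)%N
  - ext m (fun v => x ((b * (2 * l) + r + l) * m + v)%N) (q + m - 1)%N.

Definition val (m : nat) f y : algC := \sum_(q < m) (f q)%:~R * y ^+ q.

Lemma eq_val m f f' y : (forall q, (q < m)%N -> f q = f' q) ->
  val m f y = val m f' y.
Proof. by move=> E; apply: eq_bigr => q _; rewrite E. Qed.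

Lemma val_rot m f y (e : nat) : (e <= m)%N -> y ^+ m = -1 ->
  val m (fun q => - ext m f (q + m - e)) y = y ^+ e * val m f y.
Proof.
move=> em ym; rewrite /val mulr_sumr.
rewrite -(big_mkord xpredT (fun q => (- ext m f (q + m - e))%:~R * y ^+ q)).
rewrite -(big_mkord xpredT (fun q => y ^+ e * ((f q)%:~R * y ^+ q))).
rewrite (big_cat_nat (n:=e)) //= [RHS](big_cat_nat (n:=(m - e)%N)) ?leq_subr //=.
rewrite addrC; congr (_ + _).
  rewrite -{1}[e]add0n big_addn; apply: eq_big_nat => q hq.
  rewrite /ext; have -> : (q + e + m - e < m)%N = false by lia.
  rewrite opprK; have -> : (q + e + m - e - m)%N = q by lia.
  by rewrite exprD; ring.
rewrite -{1}[(m - e)%N]add0n big_addn subKn //; apply: eq_big_nat => q hq.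
rewrite /ext; have -> : (q + m - e < m)%N by lia.
have -> : (q + m - e = q + (m - e))%N by lia.
have -> : y ^+ e * ((f (q + (m - e))%N)%:~R * y ^+ (q + (m - e))) =
  (f (q + (m - e))%N)%:~R * (y ^+ q * (y ^+ (m - e) * y ^+ e)).
  by rewrite exprD; ring.
by rewrite -exprD subnK // ym rmorphN /=; ring.
Qed.

Lemma val_irot m f y e : (e <= m)%N -> y ^+ m = -1 ->
  y ^+ e * val m (fun q => ext m f (q + e)) y = val m f y.
Proof.
move=> em ym; rewrite -val_rot //; apply: eq_val => q qm.
rewrite /ext; case: (ltnP (q + m - e) m) => h.
  have -> : (q + m - e + e < m)%N = false by lia.
  by rewrite opprK; congr f; lia.
have -> : (q + m - e - m + e < m)%N by lia.
by rewrite opprK; congr f; lia.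
Qed.

Definition bval (n m : nat) x (g : nat) z y : algC :=
  \sum_(r < n) val m (fun q => x ((g * n + r) * m + q)%N) y * z ^+ r.

Lemma bval_split h m x g z y : bval (2 * h) m x g z y =
  \sum_(r < h) val m (fun q => x ((g * (2 * h) + r) * m + q)%N) y * z ^+ r +
  \sum_(r < h) val m (fun q => x ((g * (2 * h) + (h + r)) * m + q)%N) y * z ^+ (h + r).
Proof.
exact: (sum_2n h (fun r => val m (fun q => x ((g * (2 * h) + r) * m + q)%N) y * z ^+ r)).
Qed.

Lemma idx_div m u q : (q < m)%N -> ((u * m + q) %/ m = u)%N.
Proof. by move=> qm; rewrite divnMDl ?divn_small ?addn0 //; lia. Qed.

Lemma idx_mod m u q : (q < m)%N -> ((u * m + q) %% m = q)%N.
Proof. by move=> qm; rewrite modnMDl modn_small. Qed.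

Lemma stage_val h m e x g s r y : y ^+ m = -1 -> (r < h)%N -> (e g <= m)%N ->
  val m (fun q => stagef h m e x ((((2 * g + s) * h + r) * m) + q)%N) y *+ (s < 2)
  = (val m (fun q => x ((g * (2 * h) + r) * m + q)%N) y +
     (-1) ^+ s * (y ^+ e g *
     val m (fun q => x ((g * (2 * h) + (h + r)) * m + q)%N) y)) *+ (s < 2).
Proof.
move=> ym rh eg; case: s => [|[|s]] //; rewrite ?mulr1n ?expr0 ?expr1.
- rewrite mul1r -val_rot // /val -big_split /=; apply: eq_bigr => q _.
  rewrite /stagef idx_div // idx_mod //.
  have -> : ((2 * g + 0) * h + r = g * (2 * h) + r)%N by lia.
  rewrite idx_div ?idx_mod; try lia; rewrite rh (modn_small rh).
  rewrite -addnA [(r + h)%N]addnC; ring.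
rewrite mulN1r -val_rot // /val -sumrN -big_split /=; apply: eq_bigr => q _.
rewrite /stagef idx_div // idx_mod //.
have -> : ((2 * g + 1) * h + r = g * (2 * h) + (h + r))%N by lia.
rewrite idx_div ?idx_mod; try lia.
have -> : (h + r < h)%N = false by lia.
rewrite modnDl (modn_small rh) -addnA [(r + h)%N]addnC.
ring.
Qed.

Lemma stage_bval h m e x g s z y : y ^+ m = -1 -> (e g <= m)%N -> (s < 2)%N ->
  z ^+ h = (-1) ^+ s * y ^+ e g ->
  bval h m (stagef h m e x) (2 * g + s) z y = bval (2 * h) m x g z y.
Proof.
move=> ym eg s2 zh; rewrite bval_split -big_split /=.
apply: eq_bigr => r _; have := @stage_val h m e x g s r y ym (ltn_ord r) eg.
rewrite s2 !mulr1n => ->.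
by rewrite exprD zh; ring.
Qed.

Lemma istage_bval h m e x g s z y : y ^+ m = -1 -> (e g <= m)%N -> (s < 2)%N ->
  z ^+ h = (-1) ^+ s * y ^+ e g ->
  bval (2 * h) m (istagef h m e x) g z y = 2 * bval h m x (2 * g + s) z y.
Proof.
move=> ym eg s2 zh; rewrite bval_split.
rewrite -big_split /= mulr_sumr; apply: eq_bigr => r _.
set A0 := val m (fun q => x ((g * (2 * h) + r) * m + q)%N) y.
set A1 := val m (fun q => x ((g * (2 * h) + r + h) * m + q)%N) y.
have -> : val m (fun q => istagef h m e x ((g * (2 * h) + r) * m + q)%N) y = A0 + A1.
  rewrite /A0 /A1 /val -big_split /=; apply: eq_bigr => q _.
  have rh := ltn_ord r.
  rewrite /istagef !(idx_div, idx_mod) //; try lia.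
  by rewrite rh (modn_small rh) rmorphD mulrDl.
have E : y ^+ e g * val m (fun q => istagef h m e x
    ((g * (2 * h) + (h + r)) * m + q)%N) y = A0 - A1.
  have -> : A0 - A1 = val m (fun v => x ((g * (2 * h) + r) * m + v)%N
    - x ((g * (2 * h) + r + h) * m + v)%N) y.
    by rewrite /A0 /A1 /val -sumrN -big_split /=; apply: eq_bigr => q _; rewrite rmorphB mulrBl.
  rewrite -[RHS](@val_irot m _ y (e g)) //; congr (_ * _); apply: eq_val => v vm.
  have rh := ltn_ord r.
  rewrite /istagef !(idx_div, idx_mod) //; try lia.
  have -> : (h + r < h)%N = false by lia.
  by rewrite modnDl (modn_small rh).
rewrite exprD zh.
have -> : val m (fun q => x (((2 * g + s) * h + r) * m + q)%N) y =
   (if s is 0%N then A0 else A1).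
  case: s s2 {zh} => [|[|s]] // _; apply: eq_val => q _; congr x;
   congr ((_ : nat) * m + _)%N; lia.
case: s s2 {zh} => [|[|s]] // _; rewrite ?expr0 ?expr1.
  transitivity (z ^+ r * (A0 + A1 + (A0 - A1))); last by ring.
  by rewrite -E; ring.
transitivity (z ^+ r * (A0 + A1 - (A0 - A1))); last by ring.
by rewrite -E; ring.
Qed.

Lemma pad_bval l m x b z y : (0 < l)%N ->
  bval (2 * l) m (padf l m x) b z y
  = \sum_(r < l) val m (fun q => x (b * (l * m) + q * l + r)%N) y * z ^+ r.
Proof.
move=> l0; rewrite bval_split [X in _ + X]big1 ?addr0.
  apply: eq_bigr => r _; congr (_ * _); apply: eq_val => q qm.
  have rl := ltn_ord r.
  rewrite /padf !(idx_div, idx_mod) //; try lia.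
  by rewrite rl.
move=> r _; rewrite /val big1 ?mul0r // => q _; have rl := ltn_ord r.
rewrite /padf !(idx_div, idx_mod) //; try lia.
by rewrite (_ : (l + r < l)%N = false) ?mul0r //; lia.
Qed.

Lemma sum_mul_nat (l m : nat) (F : nat -> algC) :
  \sum_(i < l * m) F i = \sum_(r < l) \sum_(q < m) F (q * l + r)%N.
Proof.
rewrite exchange_big /= mulnC.
elim: m => [|m IH]; first by rewrite mul0n !big_ord0.
rewrite mulSn addnC big_ord_recr /= -IH big_split_ord /=; congr (_ + _).
Qed.

Lemma val_mul (l m : nat) f z : val (l * m) f z =
  \sum_(r < l) \sum_(q < m) (f (q * l + r)%N)%:~R * z ^+ (q * l + r).
Proof. exact: (sum_mul_nat l m (fun i => (f i)%:~R * z ^+ i)). Qed.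

Lemma unpad_val l m c b z : (0 < l)%N -> (0 < m)%N -> z ^+ (l * m) = -1 ->
  val (l * m) (fun i => unpadf l m c (b * (l * m) + i)%N) z
  = bval (2 * l) m c b z (z ^+ l).
Proof.
move=> l0 m0; rewrite exprM => ym.
rewrite bval_split -big_split val_mul; apply: eq_bigr => r _ /=.
have rl := ltn_ord r.
rewrite [z ^+ (l + r)]exprD.
have := @val_rot m (fun v => c ((b * (2 * l) + (l + r)) * m + v)%N) (z ^+ l) 1 m0 ym.
rewrite expr1 => E.
have -> : val m (fun q => c ((b * (2 * l) + (l + r)) * m + q)%N) (z ^+ l) * (z ^+ l * z ^+ r)
   = z ^+ l * val m (fun q => c ((b * (2 * l) + (l + r)) * m + q)%N) (z ^+ l) * z ^+ r by ring.
rewrite -E -mulrDl /val -big_split mulr_suml; apply: eq_bigr => q _ /=.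
rewrite /unpadf.
have -> : (b * (l * m) + (q * l + r) = (b * m + q) * l + r)%N by lia.
rewrite !(idx_div, idx_mod) // -[(_ + r + l)%N]addnA [(r + l)%N]addnC.
have -> : z ^+ (q * l + r) = (z ^+ l) ^+ q * z ^+ r by rewrite exprD mulnC exprM.
by rewrite rmorphD /=; ring.
Qed.

Lemma val_blocks l m x b z : 
  val (l * m) (fun i => x (b * (l * m) + i)%N) z
  = \sum_(r < l) val m (fun q => x (b * (l * m) + q * l + r)%N) (z ^+ l) * z ^+ r.
Proof.
rewrite val_mul; apply: eq_bigr => r _; rewrite mulr_suml.
by apply: eq_bigr => q _; rewrite addnA [z ^+ (_ + _)]exprD -exprM [(l * q)%N]mulnC; ring.
Qed.

(* Exponents at the nodes of the splitting tree in heap numbering: the block at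
   node [v] consists of polynomials modulo [Z ^ (2 h) - Y ^ (exn m v)]. *)
Fixpoint exn_rec (m fuel v : nat) : nat :=
  if fuel is fuel'.+1 then
    if (v <= 1)%N then 0%N else ((exn_rec m fuel' v./2)./2 + odd v * m)%N
  else 0%N.
Definition exn (m v : nat) := exn_rec m v v.

Lemma exn_rec_fuel m fuel v : (v <= fuel)%N -> exn_rec m fuel v = exn m v.
Proof.
suff H : forall n1 n2 u, (u <= n1)%N -> (u <= n2)%N -> exn_rec m n1 u = exn_rec m n2 u.
  by move=> h; apply: H.
elim=> [|n1 IH] [|n2] u //=; rewrite ?leqn0.
- by move=> /eqP ->.
- by move=> _ /eqP ->.
- by case: ifP => // /negbT; rewrite -ltnNge => u1 h1 h2; rewrite (IH n2) //; lia.
Qed.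

Lemma exnE m v : exn m v = if (v <= 1)%N then 0%N else ((exn m v./2)./2 + odd v * m)%N.
Proof.
rewrite {1}/exn; case: v => [|v] //=; case: ifP => // /negbT; rewrite -ltnNge => h.
by rewrite exn_rec_fuel //; lia.
Qed.

Lemma exn_dvd c d b : (d <= c.+1)%N -> (b < 2 ^ d)%N ->
  (2 ^ (c.+1 - d) %| exn (2 ^ c) (2 ^ d + b))%N && (exn (2 ^ c) (2 ^ d + b) < 2 * 2 ^ c)%N.
Proof.
elim: d b => [|d IH] b dc bd.
  have -> : b = 0%N by move: bd; rewrite expn0; lia.
  by rewrite addn0 exnE dvdn0 muln_gt0 expn_gt0.
rewrite exnE.
have -> : (2 ^ d.+1 + b <= 1)%N = false.
  by have := expn_gt0 2 d; rewrite expnS; lia.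
have -> : ((2 ^ d.+1 + b)./2 = 2 ^ d + b./2)%N.
  by rewrite expnS mul2n halfD odd_double doubleK.
have := IH b./2 ltac:(lia) ltac:(rewrite expnS in bd; lia).
case/andP=> h1 h2; apply/andP; split; last first.
  by move: h2; case: (odd _); lia.
rewrite subSS; apply: dvdn_add; last by apply: dvdn_mull; rewrite dvdn_exp2l ?leq_subr.
case/dvdnP: h1 => k ->; rewrite subSn; last lia.
by rewrite expnS mulnCA mul2n doubleK dvdn_mull.
Qed.

Definition stexp (c d g : nat) := (exn (2 ^ c) (2 ^ d + g %% 2 ^ d))./2.

Fixpoint fwd (a c d : nat) x : nat -> int :=
  if d is d'.+1 then stagef (2 ^ (a - d')) (2 ^ c) (stexp c d') (fwd a c d' x)
  else x.

Fixpoint bwd (a c d : nat) x : nat -> int :=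
  if d is d'.+1 then bwd a c d' (istagef (2 ^ (a - d')) (2 ^ c) (stexp c d') x)
  else x.

Lemma node_split c d g : (d <= c)%N ->
  exn (2 ^ c) (2 ^ d + g %% 2 ^ d) = (2 * stexp c d g)%N /\ (stexp c d g <= 2 ^ c)%N.
Proof.
move=> dc; have /andP[h1 h2] := @exn_dvd c d (g %% 2 ^ d) ltac:(lia) ltac:(by rewrite ltn_mod expn_gt0).
rewrite /stexp; split; last lia.
rewrite -[LHS]odd_double_half mul2n; suff -> : odd (exn (2 ^ c) (2 ^ d + g %% 2 ^ d)) = false by [].
apply: negbTE; rewrite -dvdn2; apply: dvdn_trans h1.
by rewrite (_ : c.+1 - d = (c - d).+1)%N ?expnS ?dvdn_mulr //; lia.
Qed.

Lemma node_child c d g s : (s < 2)%N ->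
  exn (2 ^ c) (2 ^ d.+1 + (2 * g + s) %% 2 ^ d.+1) = (stexp c d g + s * 2 ^ c)%N.
Proof.
move=> s2; have p := expn_gt0 2 d.
have E : ((2 * g + s) %% 2 ^ d.+1 = 2 * (g %% 2 ^ d) + s)%N.
  rewrite {1}(divn_eq g (2 ^ d)) mulnDr mulnCA -expnS -addnA modnMDl modn_small //.
  by rewrite expnS; have := ltn_pmod g p; lia.
rewrite E exnE.
have -> : (2 ^ d.+1 + (2 * (g %% 2 ^ d) + s) <= 1)%N = false by rewrite expnS; lia.
have -> : ((2 ^ d.+1 + (2 * (g %% 2 ^ d) + s))./2 = 2 ^ d + g %% 2 ^ d)%N.
  by rewrite expnS; lia.
have -> : odd (2 ^ d.+1 + (2 * (g %% 2 ^ d) + s)) = (s == 1)%N by rewrite expnS; lia.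
by congr (_ + _ * _)%N; lia.
Qed.

Lemma fwd_bval a c d x g z y : (a <= c)%N -> (d <= a.+1)%N -> y ^+ (2 ^ c) = -1 ->
  z ^+ (2 ^ (a.+1 - d)) = y ^+ (exn (2 ^ c) (2 ^ d + g %% 2 ^ d)) ->
  bval (2 ^ (a.+1 - d)) (2 ^ c) (fwd a c d x) g z y
  = bval (2 ^ a.+1) (2 ^ c) x (g %/ 2 ^ d) z y.
Proof.
move=> ac + ym; elim: d g z => [|d IH] g z da; first by rewrite subn0 expn0 divn1.
rewrite {1 2}(divn_eq g 2) [(_ * 2)%N]mulnC subSS => zz.
have s2 : (g %% 2 < 2)%N by rewrite ltn_mod.
have {}zz : z ^+ (2 ^ (a - d)) = (-1) ^+ (g %% 2) * y ^+ stexp c d (g %/ 2).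
  by rewrite zz node_child // exprD [(_ %% 2 * _)%N]mulnC [y ^+ (2 ^ c * _)]exprM ym mulrC.
have [E1 E2] := @node_split c d (g %/ 2) ltac:(lia).
rewrite {1}(divn_eq g 2) [(_ * 2)%N]mulnC /= stage_bval //.
have dd : (2 * 2 ^ (a - d) = 2 ^ (a.+1 - d))%N by rewrite -expnS; congr (_ ^ _)%N; lia.
have E0 : ((2 * (g %/ 2) + g %% 2) %/ 2 = g %/ 2)%N by rewrite mulnC -divn_eq.
rewrite E0 dd IH; [by rewrite -divnMA -expnS|by lia|].
by rewrite -dd [(2 * _)%N]mulnC exprM zz E1 exprMn sqrr_sign mul1r -exprM mulnC.
- by rewrite mulnC -divn_eq.
- by rewrite [(2 * _)%N]mulnC -divn_eq.
Qed.

Lemma bwd_bval a c d x (G : nat -> algC -> algC -> algC) : (a <= c)%N -> (d <= a.+1)%N ->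
  (forall g z y, y ^+ (2 ^ c) = -1 ->
    z ^+ (2 ^ (a.+1 - d)) = y ^+ (exn (2 ^ c) (2 ^ d + g %% 2 ^ d)) ->
    bval (2 ^ (a.+1 - d)) (2 ^ c) x g z y = G (g %/ 2 ^ d)%N z y) ->
  forall b z y, y ^+ (2 ^ c) = -1 -> z ^+ (2 ^ a.+1) = 1 ->
    bval (2 ^ a.+1) (2 ^ c) (bwd a c d x) b z y = 2 ^+ d * G b z y.
Proof.
move=> ac; elim: d x G => [|d IH] x G da H b z y ym z1.
  by have := H b z y ym; rewrite subn0 expn0 divn1 mul1r; apply; rewrite modn1 addn0 exnE.
rewrite /= (IH _ (fun b z y => 2 * G b z y)) //; [by rewrite exprS; ring|lia|].
move=> {z1 ym b z y} g z y ym.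
have dd : (2 * 2 ^ (a - d) = 2 ^ (a.+1 - d))%N by rewrite -expnS; congr (_ ^ _)%N; lia.
have [E1 E2] := @node_split c d g ltac:(lia).
rewrite -dd E1 mulnC exprM [(2 * _)%N]mulnC exprM => /eqP; rewrite eqf_sqr => zz.
have [s s2 zs] : exists2 s, (s < 2)%N & z ^+ (2 ^ (a - d)) = (-1) ^+ s * y ^+ stexp c d g.
  by case/orP: zz => /eqP ->; [exists 0%N|exists 1%N]; rewrite // ?expr0 ?mul1r ?expr1 ?mulN1r.
rewrite mulnC (istage_bval _ ym E2 s2 zs); congr (_ * _).
have := H (2 * g + s)%N z y ym; rewrite node_child // subSS => -> //.
  by rewrite expnS divnMA [(2 * g)%N]mulnC divnMDl // (divn_small s2) addn0.
by rewrite zs exprD mulnC [X in _ = _ * X]exprM ym mulrC.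
Qed.

Lemma bval1 m x g z y : bval 1 m x g z y = val m (fun q => x (g * m + q)%N) y.
Proof.
by rewrite /bval big_ord1 expr0 mulr1; apply: eq_val => q _; rewrite muln1 addn0.
Qed.

Lemma roots_of_unity_inj n w (p q : {poly algC}) : n.-primitive_root w ->
  (size p <= n)%N -> (size q <= n)%N ->
  (forall i, p.[w ^+ i] = q.[w ^+ i]) -> p = q.
Proof.
move=> pw sp sq H; apply/eqP; rewrite -subr_eq0; apply/negPn/negP => nz.
have n0 := prim_order_gt0 pw.
pose rs := [seq w ^+ i | i <- index_iota 0 n].
have := @max_poly_roots _ (p - q) rs nz.
rewrite size_map size_iota subn0 => /(_ _ _)/wrap[].
- by apply/allP => _ /mapP[i _ ->]; rewrite /root !hornerE H subrr.
- rewrite map_inj_in_uniq ?iota_uniq // => i j.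
  rewrite !mem_index_iota => /= hi hj /eqP; rewrite (eq_prim_root_expr pw).
  by rewrite !modn_small // => /eqP.
rewrite ltnNge => /negP; apply; apply: leq_trans (size_polyD _ _) _.
by rewrite geq_max size_polyN sp sq.
Qed.

Lemma prim_root_two_power c y : y ^+ (2 ^ c) = -1 -> (2 ^ c.+1).-primitive_root y.
Proof.
move=> yc; have y1 : y ^+ (2 ^ c.+1) = 1 by rewrite expnS mulnC exprM yc sqrrN expr1n.
have [k pk kd] := prim_order_exists (expn_gt0 2 c.+1) y1.
have [e ec kE] : exists2 e, (e <= c.+1)%N & k = (2 ^ e)%N.
  by apply/(dvdn_pfactor _ _ (isT : prime 2)).
move: ec; rewrite leq_eqVlt => /orP[/eqP <-|ec]; first by rewrite -kE.
have : y ^+ (2 ^ c) = 1.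
  apply/eqP; rewrite -(prim_order_dvd pk) kE dvdn_exp2l //.
by rewrite yc => /eqP; rewrite eq_sym -subr_eq0 opprK (eqr_nat algC 2 0).
Qed.

Lemma level_val a c A B C k : (a <= c)%N ->
  (forall g y, y ^+ (2 ^ c) = -1 ->
    val (2 ^ c) (fun q => C (g * 2 ^ c + q)%N) y =
    k * val (2 ^ c) (fun q => fwd a c a.+1 (padf (2 ^ a) (2 ^ c) A) (g * 2 ^ c + q)%N) y
      * val (2 ^ c) (fun q => fwd a c a.+1 (padf (2 ^ a) (2 ^ c) B) (g * 2 ^ c + q)%N) y) ->
  forall b w, w ^+ (2 ^ (a + c)) = -1 ->
    val (2 ^ (a + c)) (fun i => unpadf (2 ^ a) (2 ^ c) (bwd a c a.+1 C) (b * 2 ^ (a + c) + i)%N) w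
    = 2 ^+ a.+1 * k
      * val (2 ^ (a + c)) (fun i => A (b * 2 ^ (a + c) + i)%N) w
      * val (2 ^ (a + c)) (fun i => B (b * 2 ^ (a + c) + i)%N) w.
Proof.
move=> ac HC b w wN; set l := (2 ^ a)%N; set m := (2 ^ c)%N.
have l0 : (0 < l)%N by rewrite expn_gt0.
have m0 : (0 < m)%N by rewrite expn_gt0.
rewrite expnD -/l -/m in wN *; rewrite unpad_val // !val_blocks.
set y := w ^+ l; have ym : y ^+ m = -1 by rewrite -exprM.
pose P X : {poly algC} :=
  \poly_(r < l) val m (fun q => X (b * (l * m) + q * l + r)%N) y.
have PE X z : \sum_(r < l) val m (fun q => X (b * (l * m) + q * l + r)%N) y * z ^+ r = (P X).[z].
  by rewrite horner_poly.
have sP X : (size (P X) <= l)%N by exact: size_poly.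
pose Q : {poly algC} := \poly_(r < 2 * l) val m (fun q => bwd a c a.+1 C ((b * (2 * l) + r) * m + q)%N) y.
have QE z : bval (2 * l) m (bwd a c a.+1 C) b z y = Q.[z] by rewrite horner_poly.
rewrite !PE QE.
suff -> : Q = (2 ^+ a.+1 * k)%:P * P A * P B by rewrite !hornerE.
have l2 : (2 * l = 2 ^ a.+1)%N by rewrite expnS.
have pw := prim_root_two_power ym.
pose om := y ^+ (2 ^ (c - a)).
have pom : (2 ^ a.+1).-primitive_root om.
  have := dvdn_prim_root pw (dvdn_exp2l 2 (_ : a.+1 <= c.+1)%N).
  rewrite ltnS ac -expnB // => /(_ isT).
  by rewrite subSS.
apply: (roots_of_unity_inj pom); rewrite -?l2; first exact: size_poly.
  rewrite -mulrA mul_polyC; apply: leq_trans (size_scale_leq _ _) _.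
  apply: leq_trans (size_polyMleq _ _) _; have := sP A; have := sP B; lia.
move=> i; rewrite -QE !hornerE -!PE l2.
have z1 : (om ^+ i) ^+ (2 ^ a.+1) = 1 by rewrite exprAC (prim_expr_order pom) expr1n.
rewrite (@bwd_bval a c a.+1 C (fun b z y => k *
   (\sum_(r < l) val m (fun q => A (b * (l * m) + q * l + r)%N) y * z ^+ r) *
   (\sum_(r < l) val m (fun q => B (b * (l * m) + q * l + r)%N) y * z ^+ r))) //.
  by rewrite !mulrA.
move=> g z y' ym'; rewrite subnn expn0 expr1 => zy.
have F X : val m (fun q => fwd a c a.+1 (padf l m X) (g * m + q)%N) y' =
  \sum_(r < l) val m (fun q => X (g %/ 2 ^ a.+1 * (l * m) + q * l + r)%N) y' * z ^+ r.
  rewrite -(pad_bval _ _ _ _ _ l0) l2.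
  have := @fwd_bval a c a.+1 (padf l m X) g z y' ac (leqnn _) ym'.
  by rewrite subnn expn0 expr1 bval1 => ->.
by rewrite bval1 HC // !F.
Qed.

Definition basef A B (i : nat) : int :=
  let j := (2 * (i %/ 2))%N in
  if (i %% 2 == 0)%N then A j * B j - A j.+1 * B j.+1
  else A j * B j.+1 + A j.+1 * B j.

Fixpoint mulf (J k : nat) A B : nat -> int :=
  if J is J'.+1 then
    let a := k./2 in let c := (k - a)%N in
    unpadf (2 ^ a) (2 ^ c) (bwd a c a.+1 (mulf J' c
      (fwd a c a.+1 (padf (2 ^ a) (2 ^ c) A))
      (fwd a c a.+1 (padf (2 ^ a) (2 ^ c) B))))
  else basef A B.

Fixpoint shf (J k : nat) : nat :=
  if J is J'.+1 then (k./2.+1 + shf J' (k - k./2))%N else 0%N.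

Lemma mulf_val J k A B : iter J uphalf k = 1%N ->
  forall b w, w ^+ (2 ^ k) = -1 ->
    val (2 ^ k) (fun i => mulf J k A B (b * 2 ^ k + i)%N) w
    = 2 ^+ shf J k * val (2 ^ k) (fun i => A (b * 2 ^ k + i)%N) w
      * val (2 ^ k) (fun i => B (b * 2 ^ k + i)%N) w.
Proof.
elim: J k A B => [|J IH] k A B /=.
  move=> -> b w; rewrite expn1 expr0 mul1r => w2.
  rewrite /val !big_ord_recr !big_ord0 /= !add0r /basef.
  rewrite !addn0 !modnMDl !divnMDl //= !addn0 addn1 [(2 * b)%N]mulnC.
  rewrite modnMl mulnK // eqxx mulnC rmorphB rmorphD !rmorphM /= !expr0 !expr1.
  set a0 := (A (b * 2)%N)%:~R; set a1 := (A _)%:~R.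
  set b0 := (B (b * 2)%N)%:~R; set b1 := (B _)%:~R.
  transitivity (a0 * b0 + (a0 * b1 + a1 * b0) * w + a1 * b1 * w ^+ 2).
    by rewrite w2; ring.
  by ring.
rewrite -iterS iterSr /= uphalf_half => kJ b w.
set a := k./2; set c := (k - a)%N.
have kE : k = (a + c)%N by rewrite /c /a; lia.
have ac : (a <= c)%N by rewrite /c /a; lia.
have {}kJ : iter J uphalf c = 1%N.
  by rewrite -kJ; congr iter; rewrite /c /a; lia.
rewrite kE => wN.
by rewrite (level_val ac (IH c _ _ kJ)) // exprD.
Qed.

Lemma sum_coef_conv (n : nat) A B :
  (forall i, (n <= i)%N -> A i = 0) -> (forall i, (n <= i)%N -> B i = 0) ->
  forall i, (\poly_(i < n) (A i)%:~R * \poly_(i < n) (B i)%:~R : {poly algC})`_i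
   = (\sum_(p < i.+1) A p * B (i - p)%N)%:~R.
Proof.
move=> zA zB i; rewrite coefM rmorph_sum; apply: eq_bigr => p _ /=.
rewrite !coef_poly rmorphM /=; case: ltnP => hp; last by rewrite zA // !mul0r.
by case: ltnP => hq //; rewrite zB // !mulr0.
Qed.

Theorem mulf_conv J k A B na nb : iter J uphalf k = 1%N ->
  (forall i, (na <= i)%N -> A i = 0) -> (forall i, (nb <= i)%N -> B i = 0) ->
  (na + nb <= (2 ^ k).+1)%N -> (0 < na)%N -> (0 < nb)%N -> forall i, (i < 2 ^ k)%N ->
  mulf J k A B i = 2 ^+ shf J k * \sum_(p < i.+1) A p * B (i - p)%N.
Proof.
move=> kJ zA zB nn na0 nb0.
have [w pw] := C_prim_root_exists (expn_gt0 2 k.+1 : (0 < 2 ^ k.+1)%N).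
have wk : w ^+ (2 ^ k) = -1.
  have := prim_expr_order pw; rewrite expnS mulnC exprM => /eqP.
  rewrite sqrf_eq1 => /orP[] /eqP // h.
  have := eq_prim_root_expr pw (2 ^ k) 0; rewrite h expr0 eqxx mod0n.
  by rewrite modn_small ?ltn_exp2l // => /esym; rewrite expn_eq0.
set n := (2 ^ k)%N in nn wk *.
pose pA : {poly algC} := \poly_(i < n) (A i)%:~R.
pose pB : {poly algC} := \poly_(i < n) (B i)%:~R.
pose pC : {poly algC} := \poly_(i < n) (mulf J k A B i)%:~R.
have vE X v : val n X v = (\poly_(i < n) (X i)%:~R : {poly algC}).[v].
  by rewrite horner_poly.
have sA : (size pA <= na)%N.
  apply/leq_sizeP => j hj; rewrite coef_poly; case: ifP => // _; by rewrite zA.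
have sB : (size pB <= nb)%N.
  apply/leq_sizeP => j hj; rewrite coef_poly; case: ifP => // _; by rewrite zB.
have sAB : (size (2 ^+ shf J k *: (pA * pB)) <= n)%N.
  apply: leq_trans (size_scale_leq _ _) _.
  have [-> |nzA] := eqVneq pA 0; first by rewrite mul0r size_poly0.
  have [-> |nzB] := eqVneq pB 0; first by rewrite mulr0 size_poly0.
  by rewrite size_mul //; move: sA sB nn; move: (size pA) (size pB) => sa sb; clear; lia.
have E : pC \Po (w *: 'X) = (2 ^+ shf J k *: (pA * pB)) \Po (w *: 'X).
  have pw2 : n.-primitive_root (w ^+ 2).
    have := dvdn_prim_root pw (dvdn_exp2l 2 (leqnSn k)).
    by rewrite -expnB // subSn // subnn.
  have sz (p : {poly algC}) : (size p <= n)%N -> (size (p \Po (w *: 'X)) <= n)%N.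
    move=> sp; apply: leq_trans (size_comp_poly_leq _ _) _.
    have := size_scale_leq w 'X; rewrite size_polyX.
    have : (0 < n)%N by rewrite expn_gt0.
    move: sp; move: (size p) (size (w *: 'X)) => sp sw; clear.
    by case: sw => [|[|[|sw]]] //=; lia.
  apply: (roots_of_unity_inj pw2); [apply: sz; exact: size_poly|exact: sz|].
  move=> i; rewrite !horner_comp !hornerE /=.
  set v := w * _; have vn : v ^+ n = -1.
    by rewrite /v exprMn wk [_ ^+ i ^+ n]exprAC [_ ^+ 2 ^+ n]exprAC wk sqrrN !expr1n mulr1.
  have M : val n (mulf J k A B) v = 2 ^+ shf J k * val n A v * val n B v.
    exact: (mulf_val A B kJ 0 vn).
  by rewrite !vE in M; rewrite M ?mulrA.
have w0 : w != 0.
  apply/eqP => w0; move: wk; rewrite w0 expr0n expn_eq0 /= => /eqP.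
  by rewrite eq_sym oppr_eq0 oner_eq0.
have {}E : pC = 2 ^+ shf J k *: (pA * pB).
  have := congr1 (fun p => p \Po (w^-1 *: 'X)) E.
  rewrite -!comp_polyA comp_polyZ comp_polyX scalerA divff // scale1r.
  by rewrite !comp_polyXr.
move=> i hi; have := congr1 (fun p : {poly algC} => p`_i) E.
rewrite coef_poly hi coefZ sum_coef_conv => [||j hj]; try by move=> j hj; rewrite ?zA ?zB //; lia.
  by rewrite -[2 ^+ _]/(2%:~R ^+ _) -rmorphXn -rmorphM /= => /intr_inj.
by rewrite zB //; lia.
Qed.

End Nussbaumer.

(** * Isolating residues *)

Section Primes.

Definition primes_upto (n : nat) := \sum_(p < n.+1) prime p.

Lemma sum_bool_iota (f : nat -> bool) n :
  \sum_(i < n) f i = size [seq i <- iota 0 n | f i].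
Proof.
rewrite -(big_mkord xpredT (fun i => f i : nat)) size_filter -sum1_count.
by rewrite [RHS]big_mkcond /index_iota subn0; apply: eq_bigr => i _; case: (f i).
Qed.

Lemma sum_mem_leq (s : seq nat) (f : nat -> bool) n :
  (forall i, f i -> i \in s) -> \sum_(i < n) f i <= size s.
Proof.
move=> H; rewrite sum_bool_iota; apply: uniq_leq_size.
  by rewrite filter_uniq // iota_uniq.
by move=> i; rewrite mem_filter => /andP[/H].
Qed.

Lemma prod_primes n : 0 < n -> n = \prod_(p <- primes n) p ^ logn p n.
Proof.
by move=> n0; rewrite {1}(prod_prime_decomp n0) prime_decompE big_map.
Qed.

Lemma size_primes_exp d : 0 < d -> 2 ^ size (primes d) <= d.
Proof.
move=> d0; rewrite {2}(prod_primes d0).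
have : {subset primes d <= primes d} by [].
elim: {1 3 4}(primes d) => [|p s IH] sub; first by rewrite big_nil.
rewrite big_cons expnS leq_mul //; last first.
  by apply: IH => q qs; apply: sub; rewrite inE qs orbT.
have := sub p; rewrite inE eqxx => /(_ isT) h.
have pp : prime p by move: h; rewrite mem_primes => /andP[].
apply: leq_trans (prime_gt1 pp) _; rewrite -{1}[p]expn1 leq_exp2l ?prime_gt1 //.
by rewrite logn_gt0.
Qed.

Lemma primes_dividing d b n : 0 < d -> d < 2 ^ b ->
  \sum_(p < n) (prime p && (p %| d)) <= b.
Proof.
move=> d0 db; apply: leq_trans (@sum_mem_leq (primes d) (fun p => prime p && (p %| d)) n _) _.
  by move=> p /andP[pp pd]; rewrite mem_primes pp d0.
rewrite -(@leq_exp2l 2) //; apply: leq_trans (size_primes_exp d0) _; exact: ltnW.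
Qed.

Lemma exp2_bin n : 2 ^ n <= 'C(2 * n, n).
Proof.
elim: n => // n IH; rewrite expnS [in leqRHS]mul2n doubleS -mul2n binS.
have h1 : 'C(2 * n, n) <= 'C((2 * n).+1, n.+1) by rewrite binS leq_addl.
have h2 : 'C(2 * n, n) <= 'C((2 * n).+1, n).
  by case: n {IH h1} => [|n] //; rewrite [leqRHS]binS leq_addr.
lia.
Qed.

Lemma pow_logn_bin p n : prime p -> 0 < n -> p ^ logn p 'C(2 * n, n) <= 2 * n.
Proof.
move=> pp n0; have p1 := prime_gt1 pp.
have n2 : 0 < 2 * n by lia.
apply: leq_trans (trunc_logP p1 n2); rewrite leq_exp2l //.
have nn : n <= 2 * n by lia.
have := congr1 (logn p) (bin_fact nn).
rewrite (_ : 2 * n - n = n); last lia.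
rewrite lognM ?muln_gt0 ?fact_gt0 ?bin_gt0 // lognM ?fact_gt0 // !logn_fact //.
have -> : \sum_(1 <= k < n.+1) n %/ p ^ k = \sum_(1 <= k < (2 * n).+1) n %/ p ^ k.
  have h1 : n.+1 <= (2 * n).+1 by lia.
  rewrite [RHS](big_cat_nat _ h1) //=.
  rewrite [X in _ = _ + X]big1_seq ?addn0 // => k; rewrite mem_index_iota => /andP[_ /andP[kn _]].
  by rewrite divn_small //; apply: leq_ltn_trans (ltn_expl _ p1); lia.
rewrite -big_split /= => E.
set L := trunc_log p (2 * n).
have : \sum_(1 <= k < (2 * n).+1) (2 * n) %/ p ^ k <=
   \sum_(1 <= k < (2 * n).+1) ((k <= L) + (n %/ p ^ k + n %/ p ^ k)).
  apply: leq_sum => k _; have pk : 0 < p ^ k by rewrite expn_gt0; lia.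
  case: (leqP k L) => kL /=.
    have := divn_eq n (p ^ k); have := ltn_pmod n pk.
    set q := n %/ _; set r := n %% _ => hr hn.
    have : (2 * n) %/ p ^ k < 2 * q + 2 by rewrite ltn_divLR //; nia.
    by lia.
  rewrite divn_small //; apply: leq_trans (trunc_log_ltn _ p1) _.
  by rewrite leq_exp2l.
rewrite big_split /= -E.
have : \sum_(1 <= k < (2 * n).+1) (k <= L) <= L.
  rewrite big_add1 /= -{2}[L]card_ord -sum1_card big_mkord.
  apply: leq_trans (@sum_mem_leq (iota 0 L) (fun i => i < L) (2 * n) _) _.
    by move=> i; rewrite mem_iota.
  by rewrite size_iota sum1_card card_ord.
lia.
Qed.

Lemma chebyshev n : 0 < n -> 2 ^ n <= (2 * n) ^ primes_upto (2 * n).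
Proof.
move=> n0; apply: leq_trans (exp2_bin n) _.
have c0 : 0 < 'C(2 * n, n) by rewrite bin_gt0; lia.
have sz : size (primes 'C(2 * n, n)) <= primes_upto (2 * n).
  rewrite /primes_upto sum_bool_iota; apply: uniq_leq_size; first exact: primes_uniq.
  move=> p; rewrite mem_primes mem_filter mem_iota => /and3P[pp _ pd] /=.
  rewrite pp add0n ltnS /=.
  have : 0 < logn p 'C(2 * n, n) by rewrite logn_gt0 mem_primes pp c0.
  have := pow_logn_bin pp n0; case: (logn _ _) => // k h _.
  apply: leq_trans h; rewrite expnS leq_pmulr // expn_gt0.
  by have := prime_gt1 pp; lia.
apply: leq_trans (_ : (2 * n) ^ size (primes 'C(2 * n, n)) <= _); last first.
  by rewrite leq_pexp2l //; lia.
rewrite {1}(prod_primes c0).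
have : {subset primes 'C(2 * n, n) <= primes 'C(2 * n, n)} by [].
elim: {1 3 4}(primes _) => [|p s IH] sub; first by rewrite big_nil.
rewrite big_cons expnS leq_mul //; last first.
  by apply: IH => q qs; apply: sub; rewrite inE qs orbT.
apply: pow_logn_bin => //.
by have := sub p; rewrite inE eqxx mem_primes => /(_ isT) /andP[].
Qed.

Lemma primes_upto_lower n e : 0 < n -> 2 * n <= 2 ^ e ->
  n <= e * primes_upto (2 * n).
Proof.
move=> n0 ne; rewrite -(@leq_exp2l 2) //; apply: leq_trans (chebyshev n0) _.
by rewrite expnM; case: (primes_upto _) => [|k] //; rewrite leq_exp2r.
Qed.

End Primes.

Section Residues.
Variables (b P : nat).

Definition isolated (s : seq nat) (p w : nat) :=
  all (fun w' => (w' == w) || (w' != w %[mod p])) s.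

Lemma non_isolated s w : (forall x, x \in s -> x < 2 ^ b) -> w < 2 ^ b ->
  \sum_(p < P.+1) (prime p && ~~ isolated s p w) <= size s * b.
Proof.
move=> sb wb.
apply: leq_trans (_ : \sum_(p < P.+1) \sum_(x <- s) ((x != w) && (prime p && (p %| (x - w) + (w - x)))) <= _).
  apply: leq_sum => p _; case pp: (prime p) => //=.
  rewrite -has_predC; case: hasP => // -[x xs /=].
  rewrite negb_or negbK => /andP[xw xm].
  rewrite (big_rem x xs) /= xw /=.
  suff -> : p %| x - w + (w - x) by [].
  case: (leqP w x) => h.
    by rewrite (eqP h) addn0 -eqn_mod_dvd.
  rewrite (_ : x - w + (w - x) = w - x); last lia.
  by rewrite -(eqn_mod_dvd _ (ltnW h)) eq_sym.
rewrite exchange_big /= -sum1_size big_distrl /= big_seq [leqRHS]big_seq.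
apply: leq_sum => x xs; rewrite mul1n; have [->|xw] := eqVneq x w.
  by rewrite big1.
apply: primes_dividing; first lia.
have := sb x xs; lia.
Qed.

Lemma residues_lower s p : 0 < p -> uniq s ->
  size [seq w <- s | isolated s p w] <=
    \sum_(r < p) has (fun w => w %% p == r) s.
Proof.
move=> p0 us.
rewrite (sum_bool_iota (fun r => has (fun w => w %% p == r) s)).
rewrite -(size_map (fun w => w %% p)); apply: uniq_leq_size.
  rewrite map_inj_in_uniq ?filter_uniq // => x y.
  rewrite !mem_filter => /andP[_ xs] /andP[/allP/(_ _ xs)/orP[/eqP //|/eqP h] _].
  by move/h.
move=> r /mapP[x]; rewrite !mem_filter => /andP[_ xs] ->.
rewrite mem_iota add0n ltn_pmod // leq0n !andbT.
by apply/hasP; exists x.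
Qed.

Lemma residues_many s Q : uniq s -> (forall x, x \in s -> x < 2 ^ b) ->
  Q <= size s -> 2 * (Q * b) <= primes_upto P ->
  Q * primes_upto P <=
    2 * \sum_(p < P) \sum_(r < p.+1) has (fun w => w %% p.+1 == r) s.
Proof.
move=> us sb Qs pi.
pose s' := take Q s.
have sQ : size s' = Q by rewrite size_takel.
have us' : uniq s' by rewrite take_uniq.
have ss' : {subset s' <= s} by move=> x; exact: mem_take.
apply: leq_trans (_ : 2 * \sum_(p < P) \sum_(r < p.+1) has (fun w => w %% p.+1 == r) s' <= _); last first.
  rewrite leq_mul2l /=; apply: leq_sum => p _; apply: leq_sum => r _.
  case h: (has _ s') => //; case/hasP: h => x xs xr.
  by rewrite (_ : has _ _) //; apply/hasP; exists x => //; apply: ss'.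
apply: leq_trans (_ : 2 * \sum_(p < P.+1) \sum_(w <- s') (prime p && isolated s' p w) <= _); last first.
  rewrite leq_mul2l /= big_ord_recl /= big1 ?add0n => [|w _]; last by [].
  apply: leq_sum => p _; case pp: (prime _); last by rewrite big1.
  apply: leq_trans (residues_lower _ us'); last by [].
  by rewrite size_filter -sum1_count [leqRHS]big_mkcond /=; apply: leq_sum => w _; case: isolated.
rewrite exchange_big /=.
have : \sum_(w <- s') (primes_upto P - Q * b) <= \sum_(w <- s') \sum_(p < P.+1) (prime p && isolated s' p w).
  rewrite big_seq [leqRHS]big_seq; apply: leq_sum => w ws.
  have := @non_isolated s' w (fun x xs => sb x (ss' x xs)) (sb w (ss' w ws)).
  rewrite sQ leq_subLR => h; apply: leq_trans (leq_add h (leqnn _)).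
  rewrite -big_split; apply: leq_sum => p _ /=.
  by case: (prime p) => //; case: isolated.
rewrite big_const_seq count_predT iter_addn_0 sQ.
have : primes_upto P <= 2 * (primes_upto P - Q * b) by lia.
move=> h1 h2; apply: leq_trans (leq_mul (leqnn Q) h1) _.
by rewrite mulnCA leq_mul2l /= mulnC.
Qed.

Lemma isolating_prime s w Q : (forall x, x \in s -> x < 2 ^ b) -> w < 2 ^ b ->
  size s <= Q -> Q * b < primes_upto P ->
  exists p, [&& 0 < p, p <= P & isolated s p w].
Proof.
move=> sb wb sQ pi; have h := non_isolated sb wb.
have : \sum_(p < P.+1) (prime p && ~~ isolated s p w) < \sum_(p < P.+1) prime p.
  by apply: leq_ltn_trans h (leq_ltn_trans _ pi); rewrite leq_mul2r sQ orbT.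
case: (pickP (fun p : 'I_P.+1 => prime p && isolated s p w)) => [p /andP[pp pi'] _|H].
  by exists p; rewrite prime_gt0 // -ltnS ltn_ord.
rewrite ltnNge => /negP[]; apply: leq_sum => p _; have := H p.
by case: (prime p) => //= ->.
Qed.

End Residues.

(** * Derandomised nested sampling *)

Section Round.
Implicit Types (A U H X Y : nat -> bool).
Variables (u1 Nc b P Q kap : nat) (wit : nat -> nat -> bool).

Definition wcnt (X : nat -> bool) (c : nat) := \sum_(w < u1) (X w && wit c w).
Definition csize (X : nat -> bool) := \sum_(w < u1) X w.
Definition csz (U : nat -> bool) := \sum_(c < Nc) U c.
Definition hits (U X : nat -> bool) := \sum_(c < Nc) (U c && (0 < wcnt X c)).
Definition tst (A : nat -> bool) (p r w : nat) := A w && (w %% p == r).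

Lemma wcnt_gt0 X c : reflect (exists2 w, w < u1 & X w && wit c w) (0 < wcnt X c).
Proof.
rewrite lt0n sum_nat_eq0; apply: (iffP forallPn) => [[w]|[w wu Xw]].
  by rewrite /= eqb0 negbK => Xw; exists w.
by exists (Ordinal wu); rewrite /= Xw.
Qed.

Lemma wcnt_mono X Y c : (forall w, X w -> Y w) ->
  wcnt X c <= wcnt Y c.
Proof.
by move=> XY; apply: leq_sum => w _; case h: (X w) => //=; rewrite (XY _ h).
Qed.

Lemma csz_le U : csz U <= Nc.
Proof.
apply: leq_trans (_ : \sum_(c < Nc) 1 <= _); last by rewrite sum1_card card_ord.
by apply: leq_sum => c _; case: (U c).
Qed.

Lemma csize_le X : csize X <= u1.
Proof.
apply: leq_trans (_ : \sum_(c < u1) 1 <= _); last by rewrite sum1_card card_ord.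
by apply: leq_sum => c _; case: (X c).
Qed.

Lemma sum_tst A p : 0 < p -> \sum_(r < p) csize (tst A p r) = csize A.
Proof.
move=> p0; rewrite exchange_big /=; apply: eq_bigr => w _.
rewrite (bigD1 (Ordinal (ltn_pmod w p0))) //= /tst eqxx andbT big1 ?addn0 //.
move=> r; rewrite -val_eqE /= eq_sym => /negbTE ->; by rewrite andbF.
Qed.

Definition wsum (X : nat -> bool) (c : nat) := \sum_(w < u1) (X w && wit c w) * w.

Lemma wcnt1 X c : wcnt X c = 1 ->
  [/\ wsum X c < u1, X (wsum X c), wit c (wsum X c) &
    forall w, w < u1 -> X w && wit c w -> w = wsum X c].
Proof.
move=> E; have /wcnt_gt0[w wu Xw] : 0 < wcnt X c by rewrite E.
have uni w' : w' < u1 -> X w' && wit c w' -> w' = w.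
  move=> w'u Xw'; apply/eqP; apply/negPn/negP => ne; move: E; rewrite /wcnt.
  rewrite (bigD1 (Ordinal wu)) //= Xw (bigD1 (Ordinal w'u)) //=.
  by rewrite Xw'; lia.
have sE : wsum X c = w.
  rewrite /wsum (bigD1 (Ordinal wu)) //= Xw mul1n big1 ?addn0 // => i.
  rewrite -val_eqE /= => iw; case h: (X i && wit c i); rewrite ?mul0n //.
  by move: iw; rewrite (uni _ (ltn_ord i) h) eqxx.
rewrite sE; case/andP: Xw => h1 h2; split=> //.
Qed.

Lemma wsum_lt X c : wsum X c < u1 * u1 \/ u1 = 0.
Proof.
have [->|u0] := posnP u1; [by right|left].
apply: leq_ltn_trans (_ : \sum_(w < u1) (u1.-1) < _); last first.
  by rewrite sum_nat_const card_ord ltn_pmul2l //; lia.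
apply: leq_sum => w _; have := ltn_ord w; case: (_ && _); lia.
Qed.

Hypotheses (u1b : u1 <= 2 ^ b) (Q0 : 0 < Q) (kap0 : 0 < kap) (P0 : 0 < P).
Hypotheses (Qb : 2 * (Q * b) <= primes_upto P)
  (QP : 4 * (kap * P) <= Q * primes_upto P).

Lemma sum_hits_lower A c : Q <= wcnt A c ->
  Q * primes_upto P <= 2 * \sum_(p < P) \sum_(r < p.+1) (0 < wcnt (tst A p.+1 r) c).
Proof.
pose s := [seq w <- iota 0 u1 | A w && wit c w].
have -> : wcnt A c = size s.
  exact: (sum_bool_iota (fun w => A w && wit c w)).
move=> Qs; apply: leq_trans (residues_many (s := s) _ _ Qs Qb) _.
- by rewrite filter_uniq // iota_uniq.
- by move=> x; rewrite mem_filter mem_iota add0n => /andP[_ /andP[_ h]]; lia.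
rewrite leq_mul2l /=; apply: leq_sum => p _; apply: leq_sum => r _.
case h: (has _ _) => //; case/hasP: h => x; rewrite mem_filter mem_iota.
move=> /andP[/andP[Ax wx] /andP[_ xu]] xr.
rewrite (_ : 0 < _) //; apply/wcnt_gt0; exists x => //.
by rewrite /tst Ax xr.
Qed.

Record pass_inv (A U0 H0 : nat -> bool) (done : nat -> nat -> Prop)
    (U H : nat -> bool) : Prop := PassInv
  { pi_sub : forall c, c < Nc -> U c -> U0 c;
    pi_size : kap * csz U0 * csize H + csize A * csz U <=
      kap * csz U0 * csize H0 + csize A * csz U0;
    pi_zero : csz U0 = 0 -> csize H = csize H0;
    pi_rem : forall c, c < Nc -> U0 c -> ~~ U c -> 0 < wcnt H c;
    pi_HA : forall w, H w -> A w;
    pi_H0 : forall w, H0 w -> H w;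
    pi_done : forall p r, done p r ->
      csize A * hits U (tst A p r) <= kap * csz U0 * csize (tst A p r) }.

Lemma pass_inv0 A U0 H0 : (forall w, H0 w -> A w) ->
  pass_inv A U0 H0 (fun _ _ => False) U0 H0.
Proof. by move=> h; split=> // c _ ->. Qed.

Definition accept A U0 U X := kap * csize X * csz U0 < hits U X * csize A.

Lemma pass_step A U0 H0 done U H p r U' H' :
  pass_inv A U0 H0 done U H ->
  (forall c, c < Nc -> U' c = U c && ~~ (accept A U0 U (tst A p r) && (0 < wcnt (tst A p r) c))) ->
  (forall w, H' w = H w || accept A U0 U (tst A p r) && tst A p r w) ->
  pass_inv A U0 H0 (fun p' r' => done p' r' \/ p' = p /\ r' = r) U' H'.
Proof.
move=> [I1 I2 I3 I4 I5 I6 I7]; set X := tst A p r => EU EH.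
have HH w : H w -> H' w by rewrite EH => ->.
have hU' Y : hits U' Y <= hits U Y.
  apply: leq_sum => c _; rewrite EU //; case: (U c) => //=.
  by case: (~~ _).
have [acc|nacc] := boolP (accept A U0 U X); last first.
  rewrite (negbTE nacc) /= in EU EH.
  have sH : csize H' = csize H by apply: eq_bigr => w _; rewrite EH orbF.
  have sU : csz U' = csz U by apply: eq_bigr => c _; rewrite EU // andbT.
  split; rewrite ?sH ?sU //.
  - by move=> c cN; rewrite EU // andbT; exact: I1.
  - move=> c cN; rewrite EU // andbT => h1 h2.
    by apply: leq_trans (I4 c cN h1 h2) (wcnt_mono _ _).
  - by move=> w; rewrite EH orbF; exact: I5.
  - by move=> w /I6 /HH.
  move=> p' r' [/I7|[-> ->]]; first by move=> h; apply: leq_trans h; rewrite leq_mul2l hU' orbT.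
  rewrite -/X; move: nacc; rewrite /accept -leqNgt => h.
  have := hU' X; have := leq_mul (leqnn (csize A)) (hU' X); nia.
rewrite acc /= in EU EH.
have sH : csize H' <= csize H + csize X.
  by rewrite /csize -big_split; apply: leq_sum => w _ /=; rewrite EH; case: (H w); case: (X w).
have sU : csz U = csz U' + hits U X.
  rewrite /csz /hits -big_split; apply: eq_bigr => c _ /=; rewrite EU //.
  by case: (U c) => //=; case: (0 < _).
rewrite /accept in acc.
split.
- by move=> c cN; rewrite EU // => /andP[/(I1 c cN)].
- apply: leq_trans I2; rewrite sU mulnDr addnCA addnC.
  have := leq_mul (leqnn (kap * csz U0)) sH; move: (ltnW acc).
  by move: (csize H) (csize H') (csize X) (csz U0) (hits U X) (csize A) => *; lia.
- move=> z; have : csz U <= csz U0.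
    by apply: leq_sum => c _; case h: (U c) => //; rewrite (I1 _ _ h).
  by rewrite z sU; move: acc; rewrite z; nia.
- move=> c cN h; rewrite EU // negb_and negbK => /orP[nU|hc].
    by apply: leq_trans (I4 c cN h nU) (wcnt_mono _ _).
  apply: leq_trans hc (wcnt_mono _ _) => w Xw; by rewrite EH Xw orbT.
- by move=> w; rewrite EH => /orP[/I5 //|/andP[]].
- by move=> w /I6 /HH.
move=> p' r' [/I7|[-> ->]]; first by move=> h; apply: leq_trans h; rewrite leq_mul2l hU' orbT.
rewrite (_ : hits U' _ = 0) ?muln0 //; apply: big1 => c _.
by rewrite EU //; case: (U c) => //=; rewrite -/X; case: (0 < _).
Qed.

Lemma pass_end A U0 H0 (done : nat -> nat -> Prop) U H :
  pass_inv A U0 H0 done U H ->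
  (forall c, c < Nc -> U0 c -> Q <= wcnt A c) ->
  (forall p r, p < P -> r < p.+1 -> done p.+1 r) ->
  2 * csz U <= csz U0.
Proof.
move=> [I1 I2 I3 I4 I5 I6 I7] HQ D.
have [sA|sA] := posnP (csize A).
  have z c : wcnt A c = 0.
    apply/eqP; rewrite -leqn0 -sA; apply: leq_sum => w _.
    by case: (A w) => //=; case: (wit _ _).
  rewrite (_ : csz U = 0) //; apply: big1 => c _.
  by case h: (U c) => //; have := HQ c (ltn_ord c) (I1 _ (ltn_ord c) h); rewrite z; lia.
have up : csize A * \sum_(p < P) \sum_(r < p.+1) hits U (tst A p.+1 r) <=
    kap * csz U0 * (P * csize A).
  rewrite [leqLHS]big_distrr /=.
  apply: leq_trans (_ : \sum_(p < P) kap * csz U0 * csize A <= _); last first.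
    by rewrite sum_nat_const card_ord mulnCA.
  apply: leq_sum => p _; rewrite -{2}(@sum_tst A p.+1) // [leqLHS]big_distrr [leqRHS]big_distrr /=.
  by apply: leq_sum => r _; apply: I7; apply: D.
have lo : csz U * (Q * primes_upto P) <=
    2 * \sum_(p < P) \sum_(r < p.+1) hits U (tst A p.+1 r).
  have -> : \sum_(p < P) \sum_(r < p.+1) hits U (tst A p.+1 r) =
      \sum_(c < Nc) U c * \sum_(p < P) \sum_(r < p.+1) (0 < wcnt (tst A p.+1 r) c).
    transitivity (\sum_(p < P) \sum_(c < Nc) \sum_(r < p.+1) (U c && (0 < wcnt (tst A p.+1 r) c))).
      by apply: eq_bigr => p _; rewrite exchange_big.
    rewrite exchange_big /=; apply: eq_bigr => c _.
    rewrite big_distrr /=; apply: eq_bigr => p _.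
    by rewrite big_distrr /=; apply: eq_bigr => r _; case: (U c) => //; rewrite ?mul1n.
  rewrite [in leqRHS]big_distrr /= /csz.
  have := sum_hits_lower; set X := Q * primes_upto P => lower.
  rewrite big_distrl /=; apply: leq_sum => c _.
  case h: (U c); rewrite ?mul0n // !mul1n.
  by apply: lower; apply: HQ => //; apply: I1.
move: up lo; set S := \sum_(p < P) _ => up lo.
have {}up : S <= kap * csz U0 * P by rewrite -(leq_pmul2l sA); nia.
have kP : 0 < kap * P by rewrite muln_gt0 kap0.
rewrite -(leq_pmul2l kP).
have := leq_mul (leqnn (csz U)) QP; nia.
Qed.

Lemma pass_size A U0 H0 done U H : pass_inv A U0 H0 done U H ->
  kap * csize H <= kap * csize H0 + csize A.
Proof.
move=> [_ I2 I3 _ _ _ _]; have [/I3 ->|us] := posnP (csz U0); first by lia.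
rewrite -(leq_pmul2l us); nia.
Qed.

Record round_inv (A U0 : nat -> bool) (j : nat) (U H : nat -> bool) : Prop := RoundInv
  { ri_sub : forall c, c < Nc -> U c -> U0 c;
    ri_half : 2 ^ j * csz U <= csz U0;
    ri_size : kap * csize H <= j * csize A;
    ri_HA : forall w, H w -> A w;
    ri_hit : forall c, c < Nc -> U0 c -> ~~ U c -> 0 < wcnt H c }.

Lemma round_inv0 A U0 : round_inv A U0 0 U0 (fun _ => false).
Proof.
split=> //; rewrite ?mul1n ?mul0n //; last by move=> c _ ->.
by rewrite /csize big1 ?muln0.
Qed.

Lemma round_step A U0 j U H (done : nat -> nat -> Prop) U' H' :
  round_inv A U0 j U H -> pass_inv A U H done U' H' ->
  (forall c, c < Nc -> U0 c -> Q <= wcnt A c) ->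
  (forall p r, p < P -> r < p.+1 -> done p.+1 r) ->
  round_inv A U0 j.+1 U' H'.
Proof.
move=> [R1 R2 R3 R4 R5] I HQ D.
have E := pass_end I (fun c cN Uc => HQ c cN (R1 c cN Uc)) D.
have S := pass_size I; case: I => [I1 I2 I3 I4 I5 I6 I7].
split=> //.
- by move=> c cN /(I1 c cN) /(R1 c cN).
- by rewrite expnSr -mulnA; apply: leq_trans R2; rewrite leq_mul2l E orbT.
- by rewrite mulSn; lia.
move=> c cN h0 h'; have [h|h] := boolP (U c); first exact: I4.
by apply: leq_trans (R5 c cN h0 h) (wcnt_mono _ _).
Qed.

Lemma round_end A U0 K U H : round_inv A U0 K U H -> kap = 2 * K ->
  Nc < 2 ^ K -> 2 * csize H <= csize A /\
  forall c, c < Nc -> U0 c -> 0 < wcnt H c.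
Proof.
move=> [R1 R2 R3 R4 R5] kE NK; split.
  have K0 : 0 < K by lia.
  by rewrite -(leq_pmul2l K0); rewrite kE in R3; lia.
have U00 : csz U = 0.
  have := leq_ltn_trans R2 (leq_ltn_trans (csz_le U0) NK).
  case: (csz U) => // n; rewrite mulnS -[in X in _ < X](addn0 (2 ^ K)) ltn_add2l //.
move=> c cN h; apply: R5 => //; apply/negP => Uc.
move/eqP: U00; rewrite sum_nat_eq0 => /forallP/(_ (Ordinal cN)).
by rewrite /= Uc.
Qed.

(* [T] is the largest of the witnesses isolated by the tests done so far. *)
Record top_inv (A : nat -> bool) (done : nat -> nat -> Prop) (c T : nat) : Prop := TopInv
  { ti_mem : T = 0 \/ [/\ T < u1, A T & wit c T];
    ti_max : forall p r w, done p r -> wcnt (tst A p r) c = 1 ->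
      w < u1 -> tst A p r w && wit c w -> w <= T }.

Lemma top_inv_step A done c T p r T' : top_inv A done c T ->
  T' = (if wcnt (tst A p r) c == 1 then maxn T (wsum (tst A p r) c) else T) ->
  top_inv A (fun p' r' => done p' r' \/ p' = p /\ r' = r) c T'.
Proof.
move=> [I1 I2] ->; case: eqP => [/wcnt1[h1 h2 h3 h4]|ne].
  split.
    case/andP: h2 => h2 _.
    by case: (leqP T (wsum (tst A p r) c)) => h; rewrite ?(maxn_idPr h) ?(maxn_idPl (ltnW h)); [right|].
  move=> p' r' w [d|[-> ->]] c1 wu Xw; first by rewrite leq_max (I2 p' r').
  by rewrite leq_max -(h4 w wu Xw) leqnn orbT.
split=> // p' r' w [d|[-> ->]] c1; first exact: (I2 p' r').
by case: ne.
Qed.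

Lemma top_end A (done : nat -> nat -> Prop) c T : top_inv A done c T ->
  (forall p r, p < P -> r < p.+1 -> done p.+1 r) ->
  0 < wcnt A c <= Q -> (forall w, A w && wit c w -> 0 < w) ->
  [/\ T < u1, A T, wit c T & forall w, w < u1 -> A w -> wit c w -> w <= T].
Proof.
move=> [I1 I2] D /andP[h0 hQ] pos.
pose s := [seq w <- iota 0 u1 | A w && wit c w].
have sE : wcnt A c = size s by exact: (sum_bool_iota (fun w => A w && wit c w)).
have ms w : w \in s = [&& w < u1, A w & wit c w].
  by rewrite mem_filter mem_iota add0n andbC.
have maxs w : w < u1 -> A w -> wit c w -> w <= T.
  move=> wu Aw ww.
  have sb x : x \in s -> x < 2 ^ b by rewrite ms => /andP[h _]; lia.
  have sQ : size s <= Q by rewrite -sE.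
  have wb : w < 2 ^ b by lia.
  have pi : Q * b < primes_upto P.
    have [b0|b0] := posnP b; last by nia.
    have : 0 < primes_upto P by case: (primes_upto P) QP => //; rewrite muln0; nia.
    by rewrite b0 muln0.
  have [p /and3P[p0 pP iso]] := isolating_prime sb wb sQ pi.
  have tw : tst A p (w %% p) w && wit c w by rewrite /tst Aw eqxx.
  apply: (I2 p (w %% p)) => //.
    case: p p0 pP {iso tw} => // p _ pP; apply: D => //; by rewrite ltn_mod.
  rewrite /wcnt (bigD1 (Ordinal wu)) //= tw big1 // => i; rewrite -val_eqE /= => iw.
  apply/eqP; rewrite eqb0; apply/negP => /andP[/andP[Ai im] wi].
  have := allP iso i; rewrite ms ltn_ord Ai wi => /(_ isT).
  by rewrite (negbTE iw) im.
have /wcnt_gt0[w wu /andP[Aw ww]] := h0.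
have Tw := maxs w wu Aw ww; have := pos w; rewrite Aw ww => /(_ isT) w0.
by case: I1 => [T0|[? ? ?]]; [lia|split].
Qed.

Lemma pass_weak A U0 H0 (d d' : nat -> nat -> Prop) U H :
  (forall p r, d' p r -> d p r) ->
  pass_inv A U0 H0 d U H -> pass_inv A U0 H0 d' U H.
Proof. by move=> dd [I1 I2 I3 I4 I5 I6 I7]; split=> // p r /dd; exact: I7. Qed.

Lemma top_weak A (d d' : nat -> nat -> Prop) c T :
  (forall p r, d' p r -> d p r) -> top_inv A d c T -> top_inv A d' c T.
Proof. by move=> dd [I1 I2]; split=> // p r w /dd; exact: I2. Qed.

Lemma wcnt_tst0 A c p r : wcnt A c = 0 -> wcnt (tst A p r) c = 0.
Proof.
move=> z; apply/eqP; rewrite -leqn0 -z; apply: wcnt_mono => w.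
by case/andP.
Qed.

End Round.

(** * The convolution program *)

Section Words.
Variable W : nat.

Definition rz (n : nat) (z : int) : Prop :=
  n < 2 ^ W /\ (n%:Z = z %[mod (2 ^ W)%N])%Z.

Lemma rz_mod n : ((n %% 2 ^ W)%N%:Z = n%:Z %[mod (2 ^ W)%N])%Z.
Proof. by rewrite !modz_nat modn_mod. Qed.

Lemma rz_cong (n : nat) (x y : int) : (x = y %[mod (2 ^ W)%N])%Z -> rz n x -> rz n y.
Proof. by move=> E [h1 h2]; split=> //; rewrite h2. Qed.

Lemma modz_congD d (x x' y y' : int) : (x = x' %[mod d])%Z -> (y = y' %[mod d])%Z ->
  (x + y = x' + y' %[mod d])%Z.
Proof. by move=> h1 h2; rewrite -modzDm h1 h2 modzDm. Qed.

Lemma modz_congM d (x x' y y' : int) : (x = x' %[mod d])%Z -> (y = y' %[mod d])%Z ->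
  (x * y = x' * y' %[mod d])%Z.
Proof. by move=> h1 h2; rewrite -modzMm h1 h2 modzMm. Qed.

Lemma modz_congN d (x x' : int) : (x = x' %[mod d])%Z -> (- x = - x' %[mod d])%Z.
Proof. by move=> h1; rewrite -modzNm h1 modzNm. Qed.

Lemma rz_nat n : n < 2 ^ W -> rz n n%:Z. Proof. by []. Qed.

Lemma rz_add m n x y : rz m x -> rz n y -> rz (ev_op W MA m n) (x + y)%R.
Proof.
move=> [_ h1] [_ h2]; split; first by rewrite ltn_mod expn_gt0.
by rewrite rz_mod PoszD; apply: modz_congD.
Qed.

Lemma rz_mul m n x y : rz m x -> rz n y -> rz (ev_op W MM m n) (x * y)%R.
Proof.
move=> [_ h1] [_ h2]; split; first by rewrite ltn_mod expn_gt0.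
by rewrite rz_mod PoszM; apply: modz_congM.
Qed.

Lemma rz_sub m n x y : rz m x -> rz n y -> rz (ev_op W MS m n) (x - y)%R.
Proof.
move=> [_ h1] [hn h2]; split; first by rewrite ltn_mod expn_gt0.
rewrite rz_mod (modn_small hn) PoszD; apply: modz_congD => //.
rewrite -subzn ?(ltnW hn) // addrC -[X in _ = modz X _]addr0.
by apply: modz_congD; [exact: modz_congN|rewrite modzz mod0z].
Qed.

Lemma rz_eq n z : rz n z -> (0 <= z < Posz (2 ^ W)%N)%R -> Posz n = z.
Proof.
move=> [h1 h2] /andP[z0 zW]; rewrite !modz_small ?z0 ?zW // in h2.
Qed.

End Words.

Definition bigmap (X rb : nat) (e : aexp) :=
  Sq (mapl 26 62 rb e) (mapl X 62 rb (Ar 26 (Va 62))).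

Local Notation "x '+&' y" := (Op Ad x y) (at level 50, left associativity).
Local Notation "x '*&' y" := (Op Mu x y) (at level 40, left associativity).
Local Notation "x '/&' y" := (Op Di x y) (at level 40, left associativity).
Local Notation "x '%&' y" := (Op Mo x y) (at level 40, left associativity).
Local Notation "x '-&' y" := (Op Su x y) (at level 50, left associativity).
Local Notation "x '<&' y" := (Op Lt x y) (at level 70).

Definition nega (p : aexp) := Nu 1 -& p.
(* [z] if [p = 1], and [- z] if [p = 0] *)
Definition sgn (p z : aexp) := Op MS (Op MM (p +& p) z) z.

(* 54 [l], 55 [m], 60 [h], 61 number of nodes, 62 running index *)
Definition e_q := Va 62 %& Va 55.
Definition e_rr := Va 62 /& Va 55.
Definition e_h2 := Va 60 +& Va 60.
Definition e_r := e_rr %& e_h2.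
Definition e_g := e_rr /& e_h2.
Definition e_b0 := (e_g *& e_h2 +& e_r %& Va 60) *& Va 55.
Definition e_b1 := (e_g *& e_h2 +& e_r %& Va 60 +& Va 60) *& Va 55.
Definition e_e := Ar 11 (Va 61 +& e_g %& Va 61) /& Nu 2.

Definition pad_exp (X : nat) :=
  Op MM (e_rr %& (Va 54 +& Va 54) <& Va 54)
    (Ar X (e_rr /& (Va 54 +& Va 54) *& (Va 54 *& Va 55) +& e_q *& Va 54
           +& e_rr %& (Va 54 +& Va 54))).

Definition stage_exp (X : nat) :=
  let v := (e_q +& Va 55) -& e_e in
  Op MA (Ar X (e_b0 +& e_q))
    (sgn (Op Eq (Op Eq (e_r <& Va 60) (v <& Va 55)) (Nu 0)) (Ar X (e_b1 +& v %& Va 55))).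

Definition istage_exp (X : nat) :=
  let s := nega (e_r <& Va 60) in
  let v := e_q +& s *& e_e in
  Op MA (sgn (v <& Va 55) (Ar X (e_b0 +& v %& Va 55)))
        (sgn (nega (s *& (v <& Va 55))) (Ar X (e_b1 +& v %& Va 55))).

Definition unpad_exp (X : nat) :=
  let r := Va 62 %& Va 54 in let q := Va 62 /& Va 54 %& Va 55 in
  let b := Va 62 /& Va 54 /& Va 55 in
  let v := (q +& Va 55) -& Nu 1 in
  Op MA (Ar X ((b *& (Va 54 +& Va 54) +& r) *& Va 55 +& q))
    (sgn (nega (v <& Va 55))
      (Ar X ((b *& (Va 54 +& Va 54) +& r +& Va 54) *& Va 55 +& v %& Va 55))).

Definition base_exp :=
  let e := Va 62 %& Nu 2 in let j := Nu 2 *& (Va 62 /& Nu 2) in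
  Op MA (Op MM (Ar 24 j) (Ar 25 (j +& e)))
    (sgn e (Op MM (Ar 24 (j +& Nu 1)) (Ar 25 (j +& nega e)))).

Section StepLemmas.
Variables (W lim : nat) (ub : nat -> nat).
Hypothesis W2 : 2 < 2 ^ W.

Lemma rz_sgn (p : bool) z x (P Z : aexp) a : ev W a P = p -> ev W a Z = z -> rz W z x ->
  rz W (ev W a (sgn P Z)) (if p then x else - x)%R.
Proof.
move=> EP EZ h; rewrite /= EP EZ.
have h1 : rz W (p + p) (Posz (p + p)) by apply: rz_nat; case: p {EP}; lia.
have := rz_sub (rz_mul h1 h) h; apply: rz_cong; congr (modz _ _).
by case: p {EP h1} => /=; lia.
Qed.

Definition rep_on (S X : nat) (a : astate) (f : nat -> int) :=
  forall i, i < S -> rz W (av a X i) (f i).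

Lemma tri_bigmap X rb e a (f : nat -> int) (Q : astate -> Prop) :
  24 <= X -> X != 26 -> rb != 62 -> rg a rb <= ub rb ->
  (forall i a', i < rg a rb -> rg a' 62 = i ->
     (forall r', r' != 62 -> rg a' r' = rg a r') ->
     (forall j, j != 26 -> av a' j = av a j) -> rz W (ev W a' e) (f i)) ->
  (forall a', (forall r', r' != 62 -> rg a' r' = rg a r') ->
     (forall j, j != 26 -> j != X -> av a' j = av a j) ->
     rep_on (rg a rb) X a' f -> Q a') ->
  tri W lim ub (bigmap X rb e) a Q.
Proof.
move=> X24 X26 rb62 hub He HQ; rewrite /bigmap.
pose v i := ev W (setr a 62 i) e.
apply: tri_seq.
have [okm runm] : tri W lim ub (mapl 26 62 rb e) a (fun a1 =>
   [/\ forall r', r' != 62 -> rg a1 r' = rg a r',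
     forall j, j != 26 -> av a1 j = av a j &
     forall i, i < rg a rb -> rz W (av a1 26 i) (f i)]).
  apply: (@tri_for _ _ _ _ _ _ _ (fun i a1 =>
    forall x, x < i -> rz W (av a1 26 x) (f x))) => //.
    move=> i a1 ir K I.
    have kr r' : r' != 62 -> rg a1 r' = rg a r'.
      by move=> h; apply: (keep_r K); rewrite inE (negbTE h).
    have ka j : j != 26 -> av a1 j = av a j.
      by move=> h; apply: (keep_a K); rewrite inE (negbTE h).
    apply: (@tri_put _ _ _ _ _ _ i (ev W (setr a1 62 i) e)) => // x.
    rewrite /= ltnS leq_eqVlt /upd; case: eqP => [-> _|_ /= xi]; last exact: I.
    apply: He => // r' h /=; rewrite /upd (negbTE h); exact: kr.
  move=> a1 K I; split=> //=.
    move=> r' h; rewrite /upd (negbTE h); apply: (keep_r K).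
    by rewrite inE (negbTE h).
  by move=> j h; apply: (keep_a K); rewrite inE (negbTE h).
split=> //; case: runm => E1 E2 E3.
move: (run _ _ _) E1 E2 E3 => a1 E1 E2 E3.
apply: (@tri_map _ _ _ _ _ _ _ _ (fun i => av a1 26 i)).
- by rewrite E1.
- move=> i a2 _ e62 Er Ea _; rewrite /= e62 Ea //; first by split=> //; lia.
  by rewrite eq_sym.
move=> a2 Er Ea _ E; apply: HQ.
- by move=> r' h; rewrite Er // E1.
- by move=> j h1 h2; rewrite Ea // E2.
by move=> i ir; rewrite E E1 // ir; exact: E3.
Qed.

Lemma idx_lt (S h m g r v : nat) : 0 < h -> 0 < m -> 2 * h * m %| S ->
  g * (2 * h * m) < S -> r < 2 * h -> v < m -> (g * (2 * h) + r) * m + v < S.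
Proof.
move=> h0 m0 /dvdnP[k ->] gk rh vm.
have gk' : g < k by move: gk; rewrite ltn_pmul2r // !muln_gt0 h0 m0.
have : (g.+1) * (2 * h * m) <= k * (2 * h * m) by rewrite leq_mul2r gk' orbT.
have : (r.+1) * m <= 2 * h * m by rewrite leq_mul2r rh orbT.
rewrite [g.+1 * _]mulSn [r.+1 * m]mulSn mulnDl -[g * (2 * h) * m]mulnA; lia.
Qed.

Lemma mod_sub m x : m <= x -> x < m + m -> x %% m = x - m.
Proof. by move=> h1 h2; rewrite -{1}(subnK h1) modnDr modn_small //; lia. Qed.

Section Stage.
Variables (l m h pd : nat) (ex : nat -> nat) (S : nat) (X : nat) (f : nat -> int).
Variables (a a' : astate) (i : nat).
Hypotheses (X24 : 24 <= X < 26) (iS : i < S) (m0 : 0 < m).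
Hypotheses (e62 : rg a' 62 = i) (Er : forall r', r' != 62 -> rg a' r' = rg a r').
Hypothesis Ea : forall j, j != 26 -> av a' j = av a j.
Hypothesis RX : rep_on S X a f.

Let X26 : X != 26. Proof. by case: (X =P 26) X24 => // ->. Qed.

Section Butterfly.
Hypotheses (h0 : 0 < h) (dvd : 2 * h * m %| S).
Hypotheses (e55 : rg a 55 = m) (e60 : rg a 60 = h) (e61 : rg a 61 = pd).
Hypothesis eE : forall g, (av a 11 (pd + g %% pd)) %/ 2 = ex g.
Hypothesis exm : forall g, ex g <= m.

Let g := i %/ m %/ (2 * h).
Let r := i %/ m %% (2 * h).
Let q := i %% m.
Let qm : q < m. Proof. by rewrite ltn_mod. Qed.
Let rh : r %% h < h. Proof. by rewrite ltn_mod. Qed.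
Let rh2 : r %% h < 2 * h. Proof. by move: rh; clear; lia. Qed.
Let rh3 : r %% h + h < 2 * h. Proof. by move: rh; clear; lia. Qed.
Let gS : g * (2 * h * m) < S.
Proof.
apply: leq_ltn_trans iS; rewrite /g -divnMA [m * _]mulnC.
exact: leq_trunc_div.
Qed.

Let ev_q : ev W a' e_q = q. Proof. by rewrite /= e62 Er // e55. Qed.
Let ev_r : ev W a' e_r = r.
Proof. by rewrite /= e62 !Er // e55 e60 addnn -mul2n. Qed.
Let ev_b0 : ev W a' e_b0 = (g * (2 * h) + r %% h) * m.
Proof. by rewrite /= e62 !Er // e55 e60 addnn -mul2n. Qed.
Let ev_b1 : ev W a' e_b1 = (g * (2 * h) + r %% h + h) * m.
Proof. by rewrite /= e62 !Er // e55 e60 addnn -mul2n. Qed.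
Let ev_e : ev W a' e_e = ex g.
Proof. by rewrite /= e62 !Er // e55 e60 e61 addnn -mul2n Ea // eE. Qed.

Lemma stage_ok : rz W (ev W a' (stage_exp X)) (stagef h m ex f i).
Proof.
rewrite /stage_exp; set v := (_ -& e_e).
have ev_v : ev W a' v = q + m - ex g.
  by rewrite -[LHS]/(ev W a' e_q + rg a' 55 - ev W a' e_e) ev_q ev_e Er // e55.
have vm : (q + m - ex g) %% m < m by rewrite ltn_mod.
pose z := f ((g * (2 * h) + r %% h + h) * m + (q + m - ex g) %% m).
pose p : bool := ((r < h) == (q + m - ex g < m)) == false.
have h1 : rz W (ev W a' (Ar X (e_b0 +& e_q))) (f ((g * (2 * h) + r %% h) * m + q)).
  rewrite -[ev _ _ _]/(av a' X (ev W a' e_b0 + ev W a' e_q)) Ea // ev_b0 ev_q.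
  by apply: RX; exact: (idx_lt h0 m0 dvd gS rh2 qm).
have h2 : rz W (ev W a' (sgn (Op Eq (Op Eq (e_r <& Va 60) (v <& Va 55)) (Nu 0))
   (Ar X (e_b1 +& v %& Va 55)))) (if p then z else - z)%R.
  apply: (@rz_sgn p (av a X ((g * (2 * h) + r %% h + h) * m + (q + m - ex g) %% m))).
  - rewrite -[LHS]/(nat_of_bool (nat_of_bool (nat_of_bool (ev W a' e_r < rg a' 60) == nat_of_bool (ev W a' v < rg a' 55)) == 0)) ev_r ev_v !Er // e55 e60 /p.
    by case: (r < h); case: (_ < m).
  - by rewrite -[LHS]/(av a' X (ev W a' e_b1 + ev W a' v %% rg a' 55)) Ea // ev_b1 ev_v Er // e55.
  by apply: RX; rewrite -[_ + _ + h]addnA; exact: (idx_lt h0 m0 dvd gS rh3 vm).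
have := rz_add h1 h2; rewrite -/(ev W a' (Op MA _ _)); apply: rz_cong; congr (modz _ _).
rewrite /stagef -/q -/r -/g /ext /p /z.
have exg := exm g.
case: (ltnP (q + m - ex g) m) => hv.
  by rewrite (modn_small hv); case: (r < h).
rewrite (mod_sub hv); last by move: qm; clear; lia.
case: (r < h) => //=; rewrite ?opprK //.
Qed.

Lemma istage_ok : rz W (ev W a' (istage_exp X)) (istagef h m ex f i).
Proof.
rewrite /istage_exp; set s := nega _; set v := (e_q +& _).
have ev_s : ev W a' s = ~~ (r < h).
  by rewrite /s /nega -[LHS]/(1 - (ev W a' e_r < rg a' 60)) ev_r Er // e60; case: (r < h).
have ev_v : ev W a' v = q + ~~ (r < h) * ex g.
  by rewrite -[LHS]/(ev W a' e_q + ev W a' s * ev W a' e_e) ev_q ev_s ev_e.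
set vv := q + _ in ev_v.
have vm : vv %% m < m by rewrite ltn_mod.
have exg := exm g.
pose z0 := f ((g * (2 * h) + r %% h) * m + vv %% m).
pose z1 := f ((g * (2 * h) + r %% h + h) * m + vv %% m).
have h1 : rz W (ev W a' (sgn (v <& Va 55) (Ar X (e_b0 +& v %& Va 55))))
  (if (vv < m)%N then z0 else - z0)%R.
  apply: (@rz_sgn (vv < m) (av a X ((g * (2 * h) + r %% h) * m + vv %% m))).
  - by rewrite -[LHS]/(nat_of_bool (ev W a' v < rg a' 55)) ev_v Er // e55.
  - by rewrite -[LHS]/(av a' X (ev W a' e_b0 + ev W a' v %% rg a' 55)) Ea // ev_b0 ev_v Er // e55.
  by apply: RX; exact: (idx_lt h0 m0 dvd gS rh2 vm).
pose p := ~~ (~~ (r < h) && (vv < m)).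
have h2 : rz W (ev W a' (sgn (nega (s *& (v <& Va 55))) (Ar X (e_b1 +& v %& Va 55))))
  (if p then z1 else - z1)%R.
  apply: (@rz_sgn p (av a X ((g * (2 * h) + r %% h + h) * m + vv %% m))).
  - rewrite -[LHS]/(1 - ev W a' s * (ev W a' v < rg a' 55)) ev_v ev_s Er // e55 /p.
    by case: (r < h); case: (vv < m).
  - by rewrite -[LHS]/(av a' X (ev W a' e_b1 + ev W a' v %% rg a' 55)) Ea // ev_b1 ev_v Er // e55.
  by apply: RX; rewrite -[_ + _ + h]addnA; exact: (idx_lt h0 m0 dvd gS rh3 vm).
have := rz_add h1 h2; rewrite -/(ev W a' (Op MA _ _)); apply: rz_cong; congr (modz _ _).
rewrite /istagef -/q -/r -/g /ext /p /z0 /z1 /vv.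
case: (r < h) => /=.
  by rewrite mul0n addn0 qm (modn_small qm).
rewrite mul1n; case: (ltnP (q + ex g) m) => hv /=; first by rewrite (modn_small hv).
rewrite (mod_sub hv); last by move: qm exg; clear; lia.
by rewrite opprB addrC.
Qed.

End Butterfly.
End Stage.

Lemma pad_ok l m S X f a a' i : 24 <= X < 26 -> 0 < l -> 0 < m -> l * m %| S -> i < 2 * S ->
  rg a' 62 = i -> rg a' 54 = l -> rg a' 55 = m ->
  (forall j, j != 26 -> av a' j = av a j) -> rep_on S X a f ->
  rz W (ev W a' (pad_exp X)) (padf l m f i).
Proof.
move=> X24 l0 m0 dvd iS e62 e54 e55 Ea RX.
have X26 : X != 26 by case: (X =P 26) X24 => // ->.
rewrite /pad_exp /padf; set r := i %/ m %% (2 * l).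
set j := i %/ m %/ (2 * l) * (l * m) + i %% m * l + r.
rewrite [ev _ _ _]/= e62 e54 e55 addnn -mul2n Ea // -/r -/j.
case: (ltnP r l) => rl; last first.
  by rewrite /= mul0n mod0n; split=> //; rewrite expn_gt0.
have jS : j < S.
  have g2 : i %/ m %/ (2 * l) * (l * m) < S.
    have lm0 : 0 < l * m by rewrite muln_gt0 l0.
    rewrite -divnMA; case/dvdnP: dvd iS => k -> ik.
    rewrite ltn_pmul2r // ltn_divLR ?muln_gt0 ?m0 //; lia.
  case/dvdnP: dvd g2 => k -> gk.
  have gk' : i %/ m %/ (2 * l) < k by move: gk; rewrite ltn_pmul2r // muln_gt0 l0.
  have : (i %/ m %/ (2 * l)).+1 * (l * m) <= k * (l * m) by rewrite leq_mul2r gk' orbT.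
  have : (i %% m).+1 * l <= m * l by rewrite leq_mul2r ltn_mod m0 orbT.
  rewrite /j [_.+1 * (l * m)]mulSn [(i %% m).+1 * l]mulSn [m * l]mulnC.
  by lia.
have := rz_mul (rz_nat (_ : 1 < 2 ^ W)) (RX j jS); rewrite mul1r; apply; lia.
Qed.

Lemma unpad_ok l m S X f a a' i : 24 <= X < 26 -> 0 < l -> 0 < m -> l * m %| S -> i < S ->
  rg a' 62 = i -> rg a' 54 = l -> rg a' 55 = m ->
  (forall j, j != 26 -> av a' j = av a j) -> rep_on (2 * S) X a f ->
  rz W (ev W a' (unpad_exp X)) (unpadf l m f i).
Proof.
move=> X24 l0 m0 dvd iS e62 e54 e55 Ea RX.
have X26 : X != 26 by case: (X =P 26) X24 => // ->.
rewrite /unpad_exp /unpadf.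
set r := i %% l; set q := i %/ l %% m; set b := i %/ l %/ m.
set v := (_ -& Nu 1); have ev_v : ev W a' v = q + m - 1 by rewrite /= e62 e54 e55.
have rl : r < l by rewrite ltn_mod.
have rl2 : r < 2 * l by move: rl; clear; lia.
have rl3 : r + l < 2 * l by move: rl; clear; lia.
have qm : q < m by rewrite ltn_mod.
have vm : (q + m - 1) %% m < m by rewrite ltn_mod.
have dvd2 : 2 * l * m %| 2 * S by rewrite -mulnA dvdn_pmul2l.
have b2 : b * (2 * l * m) < 2 * S.
  rewrite -mulnA mulnCA ltn_pmul2l //; apply: leq_ltn_trans iS.
  by rewrite /b -divnMA; exact: leq_trunc_div.
have h1 : rz W (ev W a' (Ar X ((Va 62 /& Va 54 /& Va 55 *& (Va 54 +& Va 54) +& Va 62 %& Va 54) *& Va 55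
     +& Va 62 /& Va 54 %& Va 55))) (f ((b * (2 * l) + r) * m + q)).
  rewrite /= e62 e54 e55 addnn -mul2n Ea //.
  by apply: RX; exact: (idx_lt l0 m0 dvd2 b2 rl2 qm).
pose z1 := f ((b * (2 * l) + r + l) * m + (q + m - 1) %% m).
have h2 : rz W (ev W a' (sgn (nega (v <& Va 55)) (Ar X ((Va 62 /& Va 54 /& Va 55 *& (Va 54 +& Va 54)
     +& Va 62 %& Va 54 +& Va 54) *& Va 55 +& v %& Va 55))))
   (if ~~ (q + m - 1 < m)%N then z1 else - z1)%R.
  apply: (@rz_sgn _ (av a X ((b * (2 * l) + r + l) * m + (q + m - 1) %% m))).
  - rewrite -[LHS]/(1 - (ev W a' v < rg a' 55)) ev_v e55; by case: (_ < _).
  - by rewrite /= e62 e54 e55 addnn -mul2n Ea.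
  by apply: RX; rewrite -[_ + _ + l]addnA; exact: (idx_lt l0 m0 dvd2 b2 rl3 vm).
have := rz_add h1 h2; rewrite -/(ev W a' (Op MA _ _)); apply: rz_cong; congr (modz _ _).
rewrite /ext /z1; case: (ltnP (q + m - 1) m) => hv /=; first by rewrite (modn_small hv).
rewrite (mod_sub hv); last by move: qm; clear; lia.
by rewrite opprK.
Qed.

Lemma base_ok S f g a a' i : 2 %| S -> i < S -> rg a' 62 = i ->
  (forall j, j != 26 -> av a' j = av a j) -> rep_on S 24 a f -> rep_on S 25 a g ->
  rz W (ev W a' base_exp) (basef f g i).
Proof.
move=> dvd iS e62 Ea RF RG; rewrite /base_exp /basef.
set j := 2 * (i %/ 2).
have jS : j.+1 < S.
  by case/dvdnP: dvd iS => k ->; rewrite /j => h; have := divn_eq i 2; have := ltn_pmod i (isT : 0 < 2); lia.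
have E : i %% 2 = (i %% 2 != 0) by have := ltn_pmod i (isT : 0 < 2); case: (i %% 2) => [|[]].
set p := i %% 2 != 0 in E.
have hf0 := RF j (ltnW jS). have hf1 := RF j.+1 jS.
have hg0 := RG j (ltnW jS). have hg1 := RG j.+1 jS.
pose j1 := if p then j.+1 else j; pose j2 := if p then j else j.+1.
have h1 : rz W (ev W a' (Op MM (Ar 24 (Nu 2 *& (Va 62 /& Nu 2))) (Ar 25 (Nu 2 *& (Va 62 /& Nu 2) +& Va 62 %& Nu 2))))
  (f j * g j1)%R.
  rewrite /= e62 -/j E !Ea //; apply: rz_mul => //.
  by rewrite /j1; case: (p); rewrite ?addn1 ?addn0.
have h2 : rz W (ev W a' (sgn (Va 62 %& Nu 2) (Op MM (Ar 24 (Nu 2 *& (Va 62 /& Nu 2) +& Nu 1))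
     (Ar 25 (Nu 2 *& (Va 62 /& Nu 2) +& nega (Va 62 %& Nu 2))))))
  (if p then f j.+1%N * g j2 else - (f j.+1%N * g j2))%R.
  apply: (@rz_sgn _ (ev_op W MM (av a 24 j.+1) (av a 25 j2))).
  - by rewrite /= e62.
  - by rewrite /= e62 -/j E !Ea // addn1 /j2; case: (p); rewrite ?addn0 ?addn1.
  by apply: rz_mul => //; rewrite /j2; case: (p).
have := rz_add h1 h2; rewrite -/(ev W a' (Op MA _ _)); apply: rz_cong; congr (modz _ _).
by rewrite /j1 /j2 /p; case: eqP.
Qed.

End StepLemmas.

(* 51 [k], 52 [a = k / 2], 53 [c = k - a], 54 [2 ^ a], 55 [2 ^ c], 59 number of
   stages, 65 size of the table of exponents, which is array 11 *)
Definition level_params :=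
  Sq (Set_ 52 (Va 51 /& Nu 2)) (Sq (Set_ 53 (Va 51 -& Va 52))
  (Sq (Set_ 54 (Op Sl (Nu 1) (Va 52))) (Sq (Set_ 55 (Op Sl (Nu 1) (Va 53)))
  (Sq (Set_ 65 (Va 54 +& Va 54)) (Sq (Set_ 59 (Va 52 +& Nu 1))
  (Fo 66 65 (Cn (Va 66 <& Nu 2) (Put 11 (Va 66) (Nu 0))
    (Put 11 (Va 66) (Ar 11 (Va 66 /& Nu 2) /& Nu 2 +& Va 66 %& Nu 2 *& Va 55))))))))).

Definition fwd_stages :=
  Fo 58 59 (Sq (Set_ 60 (Op Sl (Nu 1) (Va 52 -& Va 58))) (Sq (Set_ 61 (Op Sl (Nu 1) (Va 58)))
    (Sq (bigmap 24 57 (stage_exp 24)) (bigmap 25 57 (stage_exp 25))))).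

Definition level_fwd :=
  Sq (Put 12 (Va 50) (Va 51)) (Sq level_params (Sq (Set_ 57 (Va 56 +& Va 56))
  (Sq (bigmap 24 57 (pad_exp 24)) (Sq (bigmap 25 57 (pad_exp 25))
  (Sq fwd_stages
  (Sq (Set_ 56 (Va 57)) (Sq (Set_ 63 (Va 63 +& Va 59)) (Set_ 51 (Va 53))))))))).

Definition bwd_stages :=
  Fo 58 59 (Sq (Set_ 60 (Op Sl (Nu 1) (Va 58))) (Sq (Set_ 61 (Op Sl (Nu 1) (Va 52 -& Va 58)))
    (bigmap 24 56 (istage_exp 24)))).

Definition level_bwd :=
  Sq (Set_ 51 (Ar 12 (Va 8 -& Nu 1 -& Va 50))) (Sq level_params (Sq bwd_stages
  (Sq (Set_ 56 (Va 56 /& Nu 2)) (bigmap 24 56 (unpad_exp 24))))).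

Definition conv_prog :=
  Sq (Set_ 51 (Va 7)) (Sq (Set_ 56 (Va 14)) (Sq (Set_ 63 (Nu 0)) (Sq (Fo 50 8 level_fwd)
  (Sq (bigmap 24 56 base_exp) (Fo 50 8 level_bwd))))).

Lemma shf_le n k : 0 < k -> shf n k < k + n.
Proof.
by elim: n k => [|n IH] k k0 /=; [lia|have := IH (k - k./2); lia].
Qed.

Section ConvProg.
Variables (W lim : nat) (ub : nat -> nat) (K J : nat).
Hypotheses (limW : lim <= 2 ^ W) (limK : 2 ^ (K + J).+2 < lim).
Hypotheses (ub56 : 2 ^ (K + J) <= ub 56) (ub57 : 2 ^ (K + J) <= ub 57)
  (ub65 : 2 ^ K.+1 <= ub 65) (ub59 : K.+1 <= ub 59) (ub8 : J <= ub 8).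
Hypotheses (K0 : 0 < K) (KJ : iter J uphalf K = 1).

Let kk j := iter j uphalf K.

Lemma kk_gt0 j : 0 < kk j.
Proof. by elim: j => //= j IH; rewrite /kk /= uphalf_half in IH *; move: IH; set x := iter _ _ _; lia. Qed.

Lemma kk_le j : kk j <= K.
Proof. by elim: j => //= j IH; rewrite /kk /= uphalf_half in IH *; move: IH; set x := iter _ _ _; lia. Qed.

Lemma two_lim e : e <= (K + J).+2 -> 2 ^ e < lim.
Proof. by move=> h; apply: leq_ltn_trans limK; rewrite leq_exp2l. Qed.

Lemma two_W e : e <= (K + J).+2 -> (1 * 2 ^ e) %% 2 ^ W = 2 ^ e.
Proof.
by move=> h; rewrite mul1n modn_small //; apply: leq_trans limW; exact: two_lim.
Qed.

Lemma small_lim e : e <= (K + J).+2 -> e < lim.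
Proof. by move=> h; apply: leq_ltn_trans (two_lim h); apply: ltnW; exact: ltn_expl. Qed.

Lemma W2 : 2 < 2 ^ W.
Proof.
apply: leq_trans limW; apply: leq_ltn_trans limK.
by rewrite -{1}[2]expn1 leq_exp2l.
Qed.

Record params_post (k : nat) (a' : astate) : Prop := ParamsPost
  { pp52 : rg a' 52 = k./2; pp53 : rg a' 53 = k - k./2;
    pp54 : rg a' 54 = 2 ^ k./2; pp55 : rg a' 55 = 2 ^ (k - k./2);
    pp59 : rg a' 59 = k./2.+1;
    pp11 : forall v, v < 2 ^ k./2.+1 -> av a' 11 v = exn (2 ^ (k - k./2)) v }.

Lemma exn_lt k v : k <= K -> v < 2 ^ k./2.+1 -> exn (2 ^ (k - k./2)) v < lim.
Proof.
move=> kK vl; case: v vl => [|v] vl; first by rewrite exnE /=; apply: small_lim.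
set d := trunc_log 2 v.+1.
have /andP[d1 d2] := trunc_log_bounds (isT : 1 < 2) (ltn0Sn v).
have dk : d < k./2.+1 by rewrite -(@ltn_exp2l 2) //; apply: leq_ltn_trans vl.
have := @exn_dvd (k - k./2) d (v.+1 - 2 ^ d) ltac:(lia).
rewrite subnKC // ltn_subLR // addnn -mul2n -expnS => /(_ d2)/andP[_ h].
by apply: ltn_trans h _; rewrite -expnS; apply: two_lim; lia.
Qed.

Lemma level_params_tri k a (Q : astate -> Prop) : rg a 51 = k -> k <= K ->
  (forall a', keep level_params a a' -> params_post k a' -> Q a') ->
  tri W lim ub level_params a Q.
Proof.
move=> e51 kK HQ.
apply: (@tri_conseq _ _ _ _ _ (params_post k)); last by move=> a' h1 h2; apply: HQ.
apply: tri_seq; apply: (@tri_set _ _ _ _ _ k./2); [by rewrite /= e51 divn2| |].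
  by apply: small_lim; lia.
apply: tri_seq; apply: (@tri_set _ _ _ _ _ (k - k./2)); [by rewrite /= /upd /= e51| |].
  by apply: small_lim; lia.
apply: tri_seq; apply: (@tri_set _ _ _ _ _ (2 ^ k./2)).
- by rewrite /= /upd /= two_W //; lia.
- by apply: two_lim; lia.
apply: tri_seq; apply: (@tri_set _ _ _ _ _ (2 ^ (k - k./2))).
- by rewrite /= /upd /= two_W //; lia.
- by apply: two_lim; lia.
apply: tri_seq; apply: (@tri_set _ _ _ _ _ (2 ^ k./2.+1)).
- by rewrite /= /upd /= expnS mul2n addnn.
- by apply: two_lim; lia.
apply: tri_seq; apply: (@tri_set _ _ _ _ _ k./2.+1).
- by rewrite /= /upd /= addn1.
- by apply: small_lim; lia.
set a1 := setr _ 59 _.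
have e65 : rg a1 65 = 2 ^ k./2.+1 by [].
apply: (@tri_for _ _ _ _ _ _ _ (fun i a' => forall v, v < i ->
   av a' 11 v = exn (2 ^ (k - k./2)) v)); rewrite ?e65 //.
- by apply: leq_trans ub65; rewrite leq_exp2l //; lia.
- move=> i a' ik Kp I.
  have e55 : rg a' 55 = 2 ^ (k - k./2) by rewrite (keep_r Kp).
  have step v a2 : v = exn (2 ^ (k - k./2)) i -> a2 = seta (setr a' 66 i) 11 i v ->
     forall x, x < i.+1 -> av a2 11 x = exn (2 ^ (k - k./2)) x.
    move=> vE -> x /=; rewrite ltnS leq_eqVlt /upd; case: eqP => [-> //|_ /= xi]; exact: I.
  have el := exn_lt kK ik.
  apply: tri_cn => /=; rewrite /upd /=.
    rewrite -lt0n lt0b => i2; apply: (@tri_put _ _ _ _ _ _ i 0) => //; first by lia.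
    by apply: step => //; rewrite exnE -ltnS i2.
  move=> /eqP; rewrite eqb0 -leqNgt => i2.
  apply: (@tri_put _ _ _ _ _ _ i (exn (2 ^ (k - k./2)) i)) => //; last exact: step.
  rewrite /= /upd /= e55 I; last by rewrite ltn_Pdiv //; lia.
  by rewrite [RHS]exnE !divn2 modn2 leqNgt i2.
by move=> a' Kp I; split; rewrite /= /upd //= ?(keep_r Kp) //.
Qed.

Definition fl k (X : nat -> int) := 
  fwd k./2 (k - k./2) k./2.+1 (padf (2 ^ k./2) (2 ^ (k - k./2)) X).
Definition bl k (X : nat -> int) :=
  unpadf (2 ^ k./2) (2 ^ (k - k./2)) (bwd k./2 (k - k./2) k./2.+1 X).

Fixpoint lvl (X : nat -> int) j := if j is j'.+1 then fl (kk j') (lvl X j') else X.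

Lemma uphalf_sub k : k - k./2 = uphalf k. Proof. by rewrite uphalf_half; lia. Qed.

Definition mid A B j := mulf (J - j) (kk j) (lvl A j) (lvl B j).

Lemma mid_step A B j : j < J -> mid A B j = bl (kk j) (mid A B j.+1).
Proof.
move=> jJ; rewrite /mid -(subnSK jJ) /= /bl /fl -uphalf_sub //.
Qed.

Section Stages.
Variables (k j : nat) (kK : k <= K) (k0 : 0 < k) (jJ : j < J).
Let a0 := k./2.
Let c0 := k - k./2.
Let S := 2 ^ (K + j).+1.

Let S_J : S <= 2 ^ (K + J). Proof. by rewrite leq_exp2l //; lia. Qed.

Lemma stage_facts d a : d <= a0 -> params_post k a ->
  [/\ 0 < 2 ^ (a0 - d), 2 * 2 ^ (a0 - d) * 2 ^ c0 %| S,
      forall g, av a 11 (2 ^ d + g %% 2 ^ d) %/ 2 = stexp c0 d g &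
      forall g, stexp c0 d g <= 2 ^ c0].
Proof.
move=> da P; split=> [||g|g]; first by rewrite expn_gt0.
- by rewrite -expnS -expnD dvdn_exp2l //; rewrite /a0 /c0 in da *; lia.
- rewrite divn2 (pp11 P) //; apply: leq_trans (_ : 2 ^ d.+1 <= _).
    by rewrite expnS mul2n -addnn ltn_add2l ltn_mod expn_gt0.
  by rewrite leq_exp2l.
by have [] := @node_split c0 d g ltac:(rewrite /a0 /c0 in da *; lia).
Qed.

Lemma params_keep a a' : params_post k a ->
  (forall r, r \in [:: 52; 53; 54; 55; 59] -> rg a' r = rg a r) -> av a' 11 = av a 11 ->
  params_post k a'.
Proof.
by move=> [h1 h2 h3 h4 h5 h6] H E; split; rewrite ?H ?E.
Qed.

Lemma fwd_stages_tri a f g (Q : astate -> Prop) : params_post k a ->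
  rg a 57 = S -> rep_on W S 24 a f -> rep_on W S 25 a g ->
  (forall a', keep fwd_stages a a' -> rep_on W S 24 a' (fwd a0 c0 a0.+1 f) ->
     rep_on W S 25 a' (fwd a0 c0 a0.+1 g) -> Q a') ->
  tri W lim ub fwd_stages a Q.
Proof.
move=> P e57 rf rgg HQ.
pose I d a' := rep_on W S 24 a' (fwd a0 c0 d f) /\ rep_on W S 25 a' (fwd a0 c0 d g).
apply: (@tri_conseq _ _ _ _ _ (I a0.+1)); last by move=> a' h [h1 h2]; apply: HQ.
have e59 := pp59 P.
apply: (@tri_for _ _ _ _ _ _ _ I); rewrite ?e59 //.
  by apply: leq_trans ub59; rewrite /a0; lia.
move=> d a1 da Kp [r1 r2]; rewrite ltnS in da.
have P1 : params_post k a1.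
  apply: (params_keep P); last exact: (keep_a Kp).
  by move=> r; rewrite !inE => /or4P[|||/orP[]] /eqP ->; exact: (keep_r Kp).
have e57' : rg a1 57 = S by rewrite (keep_r Kp).
apply: tri_seq; apply: (@tri_set _ _ _ _ _ (2 ^ (a0 - d))).
- by rewrite /= /upd /= (pp52 P1) two_W //; rewrite /a0; lia.
- by apply: two_lim; rewrite /a0; lia.
apply: tri_seq; apply: (@tri_set _ _ _ _ _ (2 ^ d)).
- by rewrite /= /upd /= two_W //; rewrite /a0 in da; lia.
- by apply: two_lim; rewrite /a0 in da; lia.
set a2 := setr _ 61 _.
have P2 : params_post k a2.
  apply: (params_keep P1) => // r; rewrite !inE => /or4P[|||/orP[]] /eqP -> //.
have [h1 h2 h3 h4] := stage_facts da P2.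
have e57a : rg a2 57 = S by [].
apply: tri_seq; apply: (tri_bigmap _ W2 (f := fwd a0 c0 d.+1 f)) => //.
- by rewrite e57a (leq_trans S_J).
- move=> i a' + e62 Er Ea; rewrite e57a => iS.
  apply: (stage_ok W2 (a := a2) (S := S) (h := 2 ^ (a0 - d)) (pd := 2 ^ d)) => //.
  + by rewrite expn_gt0.
  + exact: (pp55 P2).
move=> a3 Er Ea r3.
have e57b : rg a3 57 = S by rewrite Er.
have P3 : params_post k a3.
  apply: (params_keep P2) => [r|]; last exact: Ea.
  by rewrite !inE => /or4P[|||/orP[]] /eqP ->; rewrite Er.
apply: (tri_bigmap _ W2 (f := fwd a0 c0 d.+1 g)) => //.
- by rewrite e57b (leq_trans S_J).
- move=> i a' + e62 Er' Ea'; rewrite e57b => iS.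
  apply: (stage_ok W2 (a := a3) (S := S) (h := 2 ^ (a0 - d)) (pd := 2 ^ d)) => //.
  + by rewrite expn_gt0.
  + by move=> x xS; rewrite Ea //; apply: r2.
  + exact: (pp55 P3).
  + by rewrite Er.
  + by rewrite Er.
  + by rewrite Ea.
move=> a4 Er4 Ea4 r4; split=> [x xS|x xS]; last by apply: r4; rewrite e57b.
by rewrite Ea4 //; apply: r3; rewrite e57a.
Qed.

Lemma bwd_stages_tri a f (Q : astate -> Prop) : params_post k a ->
  rg a 56 = S -> rep_on W S 24 a f ->
  (forall a', keep bwd_stages a a' -> rep_on W S 24 a' (bwd a0 c0 a0.+1 f) -> Q a') ->
  tri W lim ub bwd_stages a Q.
Proof.
move=> P e56 rf HQ.
pose I d a' := exists2 x, rep_on W S 24 a' x & bwd a0 c0 a0.+1 f = bwd a0 c0 (a0.+1 - d) x.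
apply: (@tri_conseq _ _ _ _ _ (I a0.+1)); last first.
  by move=> a' h [x rx E]; apply: HQ => //; rewrite E subnn.
have e59 := pp59 P.
apply: (@tri_for _ _ _ _ _ _ _ I); rewrite ?e59 //.
- by apply: leq_trans ub59; rewrite /a0; lia.
- by exists f; rewrite ?subn0.
move=> d a1 da Kp [x rx Ex]; rewrite ltnS in da.
have P1 : params_post k a1.
  apply: (params_keep P); last exact: (keep_a Kp).
  by move=> r; rewrite !inE => /or4P[|||/orP[]] /eqP ->; exact: (keep_r Kp).
have e56' : rg a1 56 = S by rewrite (keep_r Kp).
apply: tri_seq; apply: (@tri_set _ _ _ _ _ (2 ^ d)).
- by rewrite /= /upd /= two_W //; rewrite /a0 in da; lia.
- by apply: two_lim; rewrite /a0 in da; lia.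
apply: tri_seq; apply: (@tri_set _ _ _ _ _ (2 ^ (a0 - d))).
- by rewrite /= /upd /= (pp52 P1) two_W //; rewrite /a0; lia.
- by apply: two_lim; rewrite /a0; lia.
set a2 := setr _ 61 _.
have P2 : params_post k a2.
  apply: (params_keep P1) => // r; rewrite !inE => /or4P[|||/orP[]] /eqP -> //.
have [|h1 h2 h3 h4] := @stage_facts (a0 - d) a2 _ P2; first by rewrite leq_subr.
rewrite subKn // in h1 h2.
have e56a : rg a2 56 = S by [].
apply: (tri_bigmap _ W2 (f := istagef (2 ^ d) (2 ^ c0) (stexp c0 (a0 - d)) x)) => //.
- by rewrite e56a (leq_trans S_J).
- move=> i a' + e62 Er Ea; rewrite e56a => iS.
  apply: (istage_ok W2 (a := a2) (S := S) (pd := 2 ^ (a0 - d))) => //.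
  + by rewrite expn_gt0.
  + exact: (pp55 P2).
move=> a3 Er Ea r3; exists (istagef (2 ^ d) (2 ^ c0) (stexp c0 (a0 - d)) x).
  by rewrite -e56a.
rewrite Ex subSn // [a0.+1 - d.+1]subSS /=; by rewrite subKn.
Qed.

End Stages.

Record fwd_inv (A B : nat -> int) (j : nat) (a : astate) : Prop := FwdInv
  { fi51 : rg a 51 = kk j; fi56 : rg a 56 = 2 ^ (K + j);
    fi63 : rg a 63 + shf (J - j) (kk j) = shf J K;
    fi24 : rep_on W (2 ^ (K + j)) 24 a (lvl A j);
    fi25 : rep_on W (2 ^ (K + j)) 25 a (lvl B j);
    fi12 : forall i, i < j -> av a 12 i = kk i }.

Lemma level_fwd_tri A B j a : j < J -> fwd_inv A B j a -> rg a 50 = j ->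
  tri W lim ub level_fwd a (fwd_inv A B j.+1).
Proof.
move=> jJ [e51 e56 e63 rA rB e12] e50.
have kK := kk_le j; have k0 := kk_gt0 j; set k := kk j in e51 e63 kK k0.
apply: tri_seq; apply: (@tri_put _ _ _ _ _ _ j k) => //.
  by move=> _; apply: small_lim; lia.
apply: tri_seq; apply: (@level_params_tri k) => // a1 K1 P1.
have f1 : rg a1 56 = 2 ^ (K + j) by rewrite (keep_r K1).
have g1 : rg a1 63 = rg a 63 by rewrite (keep_r K1).
have m1 : av a1 12 = av (seta a 12 j k) 12 by rewrite (keep_a K1).
have rA1 : rep_on W (2 ^ (K + j)) 24 a1 (lvl A j) by move=> x xs; rewrite (keep_a K1) //; apply: rA.
have rB1 : rep_on W (2 ^ (K + j)) 25 a1 (lvl B j) by move=> x xs; rewrite (keep_a K1) //; apply: rB.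
apply: tri_seq; apply: (@tri_set _ _ _ _ _ (2 ^ (K + j).+1)).
- by rewrite /= f1 expnS mul2n addnn.
- by apply: two_lim; lia.
set a2 := setr a1 57 _.
have P2 : params_post k a2.
  apply: (params_keep P1) => // r; rewrite !inE => /or4P[|||/orP[]] /eqP -> //.
have S_J : 2 ^ (K + j).+1 <= ub 57 by apply: leq_trans ub57; rewrite leq_exp2l //; lia.
have dv : 2 ^ k./2 * 2 ^ (k - k./2) %| 2 ^ (K + j).
  by rewrite -expnD dvdn_exp2l //; lia.
have p2 e : 0 < 2 ^ e by rewrite expn_gt0.
apply: tri_seq; apply: (tri_bigmap _ W2 (f := padf (2 ^ k./2) (2 ^ (k - k./2)) (lvl A j))) => //.
  move=> i a' iS e62 Er Ea; apply: (pad_ok W2 (a := a2) (S := 2 ^ (K + j))) => //.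
  - by rewrite -expnS.
  - by rewrite Er //; exact: (pp54 P2).
  - by rewrite Er //; exact: (pp55 P2).
move=> a3 Er3 Ea3 r3; rewrite -/(rg a2 57) [rg a2 57]/= /upd /= in r3.
have P3 : params_post k a3.
  apply: (params_keep P2) => [r|]; last exact: Ea3.
  by rewrite !inE => /or4P[|||/orP[]] /eqP ->; rewrite Er3.
have e57 : rg a3 57 = 2 ^ (K + j).+1 by rewrite Er3.
apply: tri_seq; apply: (tri_bigmap _ W2 (f := padf (2 ^ k./2) (2 ^ (k - k./2)) (lvl B j))) => //.
- by rewrite e57.
- rewrite e57 => i a' iS e62 Er Ea; apply: (pad_ok W2 (a := a3) (S := 2 ^ (K + j))) => //.
  + by rewrite -expnS.
  + by rewrite Er //; exact: (pp54 P3).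
  + by rewrite Er //; exact: (pp55 P3).
  + by move=> x xS; rewrite Ea3 //; apply: rB1.
rewrite e57 => a4 Er4 Ea4 r4.
have P4 : params_post k a4.
  apply: (params_keep P3) => [r|]; last exact: Ea4.
  by rewrite !inE => /or4P[|||/orP[]] /eqP ->; rewrite Er4.
apply: tri_seq; apply: (fwd_stages_tri kK k0 jJ P4).
- by rewrite Er4.
- by move=> x xS; rewrite Ea4 //; apply: r3.
- exact: r4.
move=> a5 K5 r5 r5'.
have e57' : rg a5 57 = 2 ^ (K + j).+1 by rewrite (keep_r K5) // Er4.
have e59' : rg a5 59 = k./2.+1 by rewrite (keep_r K5) // (pp59 P4).
have e53' : rg a5 53 = k - k./2 by rewrite (keep_r K5) // (pp53 P4).
have e63' : rg a5 63 = rg a 63 by rewrite (keep_r K5) // Er4 // Er3.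
have e12' : av a5 12 = av (seta a 12 j k) 12 by rewrite (keep_a K5) // Ea4 // Ea3.
have shE : shf (J - j) k = k./2.+1 + shf (J - j.+1) (uphalf k).
  by rewrite -(subnSK jJ) /= uphalf_sub.
have := shf_le J K0; rewrite -e63 shE => sl.
apply: tri_seq; apply: (@tri_set _ _ _ _ _ (2 ^ (K + j).+1)) => //; first by apply: two_lim; lia.
apply: tri_seq; apply: (@tri_set _ _ _ _ _ (rg a 63 + k./2.+1)).
- by rewrite /= /upd /= e63' e59'.
- by apply: small_lim; lia.
apply: (@tri_set _ _ _ _ _ (k - k./2)).
- by rewrite /= /upd /= e53'.
- by apply: small_lim; lia.
split; rewrite /= /upd /= ?addnS //.
- exact: uphalf_sub.
- rewrite -e63 shE -[uphalf (iter _ _ _)]/(uphalf k); lia.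
move=> i; rewrite ltnS leq_eqVlt e12' /= /upd; case: eqP => [-> //|_ /= ij]; exact: e12.
Qed.

Record bwd_inv (A B : nat -> int) (n : nat) (i : nat) (a : astate) : Prop := BwdInv
  { bi56 : rg a 56 = 2 ^ (K + (J - i));
    bi63 : rg a 63 = n;
    bi24 : rep_on W (2 ^ (K + (J - i))) 24 a (mid A B (J - i));
    bi12 : forall i, i < J -> av a 12 i = kk i }.

Lemma level_bwd_tri A B n i a : i < J -> bwd_inv A B n i a -> rg a 50 = i -> rg a 8 = J ->
  tri W lim ub level_bwd a (bwd_inv A B n i.+1).
Proof.
move=> iJ [e56 e63 r24 e12] e50 e8.
set j := J - 1 - i; have jJ : j < J by rewrite /j; lia.
have Ji : J - i = j.+1 by rewrite /j; lia.
have Ji1 : J - i.+1 = j by rewrite /j; lia.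
rewrite Ji addnS in e56 r24.
have kK := kk_le j; have k0 := kk_gt0 j; set k := kk j in kK k0.
apply: tri_seq; apply: (@tri_set _ _ _ _ _ k).
- by rewrite /= e8 e50 e12.
- by apply: small_lim; lia.
apply: tri_seq; apply: (@level_params_tri k) => // a1 K1 P1.
apply: tri_seq; apply: (bwd_stages_tri (f := mid A B j.+1) kK k0 jJ P1).
- by rewrite (keep_r K1).
- by move=> x xS; rewrite (keep_a K1) //; apply: r24.
move=> a2 K2 r2.
have f2 : rg a2 56 = 2 ^ (K + j).+1 by rewrite (keep_r K2) // (keep_r K1).
apply: tri_seq; apply: (@tri_set _ _ _ _ _ (2 ^ (K + j))).
- by rewrite /= f2 expnS mulKn.
- by apply: two_lim; lia.
set a3 := setr a2 56 _.
have S_J : 2 ^ (K + j) <= ub 56 by apply: leq_trans ub56; rewrite leq_exp2l //; lia.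
have p2 e : 0 < 2 ^ e by rewrite expn_gt0.
apply: (tri_bigmap _ W2 (f := bl k (mid A B j.+1))) => //.
  move=> x a' xS e62 Er Ea; apply: (unpad_ok W2 (a := a3) (S := 2 ^ (K + j))) => //.
  - by rewrite -expnD dvdn_exp2l //; lia.
  - by rewrite Er //= /upd /= (keep_r K2) // (pp54 P1).
  - by rewrite Er //= /upd /= (keep_r K2) // (pp55 P1).
  - by rewrite -expnS.
move=> a4 Er4 Ea4 r4; split; rewrite ?Ji1.
- by rewrite Er4.
- by rewrite Er4 //= /upd /= (keep_r K2) // (keep_r K1).
- by rewrite mid_step.
by move=> x xJ; rewrite Ea4 //= (keep_a K2) // (keep_a K1) //; apply: e12.
Qed.

Lemma conv_tri (A B : nat -> int) a (Q : astate -> Prop) :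
  rg a 7 = K -> rg a 8 = J -> rg a 14 = 2 ^ K ->
  rep_on W (2 ^ K) 24 a A -> rep_on W (2 ^ K) 25 a B ->
  (forall a', keep conv_prog a a' -> rg a' 63 = shf J K ->
     rep_on W (2 ^ K) 24 a' (mulf J K A B) -> Q a') ->
  tri W lim ub conv_prog a Q.
Proof.
move=> e7 e8 e14 rA rB HQ.
apply: (@tri_conseq _ _ _ _ _ (fun a' => rg a' 63 = shf J K /\ rep_on W (2 ^ K) 24 a' (mulf J K A B))).
  apply: tri_seq; apply: (@tri_set _ _ _ _ _ K) => //; first by apply: small_lim; lia.
  apply: tri_seq; apply: (@tri_set _ _ _ _ _ (2 ^ K)) => //; first by apply: two_lim; lia.
  apply: tri_seq; apply: (@tri_set _ _ _ _ _ 0) => //; first by apply: small_lim; lia.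
  set a1 := setr _ 63 _.
  have e8' : rg a1 8 = J by [].
  apply: tri_seq; apply: (@tri_for _ _ _ _ _ _ _ (fwd_inv A B)); rewrite ?e8' //.
  - by split; rewrite ?subn0 ?addn0 //= /upd /= ?e7.
  - move=> j a2 jJ K2 [? ? ? ? ? ?]; apply: level_fwd_tri => //; split=> //.
  move=> a2 K2 [f51 f56 f63 f24 f25 f12].
  rewrite subnn /= addn0 in f63.
  set a3 := setr a2 50 J.
  apply: tri_seq; apply: (tri_bigmap _ W2 (f := basef (lvl A J) (lvl B J))) => //.
  - by rewrite /= /upd /= f56.
  - move=> i a' + e62 Er Ea; rewrite [rg a3 56]/= /upd /= f56 => iS.
    apply: (base_ok W2 (a := a3) (S := 2 ^ (K + J))) => //.
    by rewrite -{1}[2]expn1 dvdn_exp2l //; lia.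
  move=> a4 Er4 Ea4 r4; rewrite [rg a3 56]/= /upd /= f56 in r4.
  have e8'' : rg a4 8 = J by rewrite Er4 //= /upd /= (keep_r K2).
  apply: (@tri_for _ _ _ _ _ _ _ (bwd_inv A B (shf J K))); rewrite ?e8'' //.
  - split; rewrite ?subn0 //.
    + by rewrite Er4.
    + by rewrite Er4.
    + by rewrite /mid subnn.
    + by move=> i iJ; rewrite Ea4 //; apply: f12.
  - move=> i a5 iJ K5 [? ? ? ?]; apply: level_bwd_tri => //.
    by rewrite /= /upd /= (keep_r K5).
  move=> a5 K5 [_ g63 g24 _]; split; first by [].
  by move: g24; rewrite subnn addn0 /mid subn0.
by move=> a' Kp [h1 h2]; apply: HQ.
Qed.

End ConvProg.

(** * Small targets *)

Definition conv_query :=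
  Sq (mapl 24 62 14 (Ar 3 (Va 62))) (Sq (mapl 25 62 14 (Ar 4 (Va 62))) conv_prog).

Definition level_mark :=
  Cn (Op Eq (Ar 1 (Va 71)) (Nu 0) *& ((Nu 0 <& Va 71) *&
       (Nu 0 <& Op Sr (Ar 24 (Va 71 +& Va 70 *& Va 6)) (Va 63))))
    (Sq (Put 1 (Va 71) (Va 70 +& Nu 1))
        (Put 3 (Va 71 +& (Va 70 +& Nu 1) *& Va 6) (Nu 1))) Nop.

Definition levels :=
  Sq (mapl 4 62 13 (Ar 0 (Va 62))) (Sq (Put 3 (Nu 0) (Nu 1))
  (Fo 70 5 (Sq conv_query (Fo 71 6 level_mark)))).

Lemma mincoins_lower u (A : nat -> bool) c : (forall w, A w -> 0 < w <= u) ->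
  feasible u A c -> c <= mincoins u A c * u.
Proof.
move=> A_range /(mincoins_sol A_range)[s /andP[As /eqP <-] <-].
elim: s As => //= w s IH /andP[/A_range Aw /IH]; rewrite mulSn; lia.
Qed.

Section Query.
Variables (W lim : nat) (ub : nat -> nat) (K J : nat).
Hypotheses (lim0 : 128 <= lim) (limW : lim ^ 12 <= 2 ^ W) (limK : 2 ^ (K + J).+2 < lim).
Hypotheses (ub14 : 2 ^ K <= ub 14)
  (ub56 : 2 ^ (K + J) <= ub 56) (ub57 : 2 ^ (K + J) <= ub 57)
  (ub65 : 2 ^ K.+1 <= ub 65) (ub59 : K.+1 <= ub 59) (ub8 : J <= ub 8).
Hypotheses (K0 : 0 < K) (KJ : iter J uphalf K = 1).

Lemma limW1 : lim <= 2 ^ W.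
Proof. by apply: leq_trans limW; rewrite -{1}[lim]expn1 leq_pexp2l //; lia. Qed.

Definition conv_sum (a : astate) i := \sum_(p < i.+1) av a 3 p * av a 4 (i - p).

Lemma conv_query_tri na nb a (Q : astate -> Prop) :
  rg a 7 = K -> rg a 8 = J -> rg a 14 = 2 ^ K ->
  0 < na -> 0 < nb -> na + nb <= (2 ^ K).+1 ->
  (forall i, na <= i -> i < 2 ^ K -> av a 3 i = 0) ->
  (forall i, nb <= i -> i < 2 ^ K -> av a 4 i = 0) ->
  (forall i, i < 2 ^ K -> av a 3 i < lim) ->
  (forall i, i < 2 ^ K -> av a 4 i < lim) ->
  (forall i, i < 2 ^ K -> conv_sum a i < lim) ->
  (forall a', keep conv_query a a' ->
     (forall i, i < 2 ^ K -> av a' 24 i %/ 2 ^ rg a' 63 = conv_sum a i) -> Q a') ->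
  tri W lim ub conv_query a Q.
Proof.
move=> e7 e8 e14 na0 nb0 nn z3 z4 l3 l4 sl HQ.
apply: (@tri_conseq _ _ _ _ _ (fun a' => forall i, i < 2 ^ K ->
  av a' 24 i %/ 2 ^ rg a' 63 = conv_sum a i)); last by move=> a' k h; apply: HQ.
apply: tri_seq; apply: (@tri_map _ _ _ _ _ _ _ _ (fun i => av a 3 i)).
- by rewrite e14.
- by move=> i a' _ e62 _ Ea _; rewrite /= e62 Ea.
rewrite e14 => a1 Er1 Ea1 _ E1.
apply: tri_seq; apply: (@tri_map _ _ _ _ _ _ _ _ (fun i => av a 4 i)).
- by rewrite Er1 // e14.
- by move=> i a' _ e62 _ Ea _; rewrite /= e62 Ea // Ea1.
rewrite Er1 // e14 => a2 Er2 Ea2 _ E2.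
pose fA i : int := if i < na then Posz (av a 3 i) else 0%R.
pose fB i : int := if i < nb then Posz (av a 4 i) else 0%R.
have fAE i : i < 2 ^ K -> fA i = Posz (av a 3 i).
  by move=> iK; rewrite /fA; case: ltnP => // h; rewrite z3.
have fBE i : i < 2 ^ K -> fB i = Posz (av a 4 i).
  by move=> iK; rewrite /fB; case: ltnP => // h; rewrite z4.
have rz_lim n : n < lim -> rz W n (Posz n).
  by move=> h; split=> //; apply: leq_trans limW1.
apply: (conv_tri (K := K) (J := J) limW1 limK ub56 ub57 ub65 ub59 ub8 K0 KJ (A := fA) (B := fB)).
- by rewrite Er2 // Er1.
- by rewrite Er2 // Er1.
- by rewrite Er2 // Er1.
- by move=> i iK; rewrite Ea2 // E1 iK fAE //; apply: rz_lim; exact: l3.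
- by move=> i iK; rewrite E2 iK fBE //; apply: rz_lim; exact: l4.
move=> a3 K3 e63 r3 i iK.
have := r3 i iK; rewrite (mulf_conv KJ (na := na) (nb := nb)) //; last first.
- by move=> x; rewrite /fB ltnNge => ->.
- by move=> x; rewrite /fA ltnNge => ->.
have -> : (\sum_(p < i.+1) fA p * fB (i - p)%N)%R = Posz (conv_sum a i).
  rewrite /conv_sum -natz natr_sum; apply: eq_bigr => p _.
  have pi := ltn_ord p.
  by rewrite fAE ?fBE ?natrM ?natz //; lia.
have -> : (2 ^+ shf J K)%R = Posz (2 ^ shf J K) by rewrite -natz natrX natz.
rewrite -PoszM.
move/rz_eq => E.
have : Posz (av a3 24 i) = Posz (2 ^ shf J K * conv_sum a i).
  apply: E; rewrite lez_nat leq0n ltz_nat /=.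
  apply: leq_trans limW; apply: leq_trans (_ : lim ^ 2 <= _); last by rewrite leq_pexp2l //; lia.
  rewrite -mulnn; apply: ltn_mul; last exact: sl.
  apply: ltn_trans limK; rewrite ltn_exp2l //.
  by have := shf_le J K0; lia.
by case=> ->; rewrite e63 mulKn // expn_gt0.
Qed.

Section Levels.
Variables (u h : nat) (A : nat -> bool).
Hypothesis A_range : forall w, A w -> 0 < w <= u.
Hypothesis h0 : 0 < h.
Let M := (h * u).+1.
Hypothesis MK : h.+1 * M + u.+1 <= 2 ^ K.
Local Notation mc := (mincoins u A).
Local Notation fea := (feasible u A).
Local Notation wt := (wit u A).

Definition row (k i : nat) : bool :=
  [&& fea (i %% M), mc (i %% M) == i %/ M & i %/ M < k].

Lemma row_lt k i : row k i -> k <= h.+1 -> i < h * M + M.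
Proof.
case/and3P=> h1 /eqP h2 h3 kh.
by rewrite (divn_eq i M) -mulSnr; have := ltn_pmod i (isT : 0 < M); nia.
Qed.

Lemma div_M q c : c < M -> (c + q * M) %/ M = q /\ (c + q * M) %% M = c.
Proof.
by move=> cM; rewrite addnC divnMDl // modnMDl divn_small ?modn_small ?addn0.
Qed.

(* The row of [c] starts at a multiple of [M > h u], hence a coin larger than
   [c] would lead to a cell of the preceding row beyond its populated part. *)
Lemma row_shift k q c w : q < k -> q < h -> c < M -> w <= u -> w <= c + q * M ->
  row k (c + q * M - w) = [&& w <= c, fea (c - w) & mc (c - w) == q].
Proof.
move=> qk qh cM wu wi; case: (leqP w c) => wc /=.
  have -> : c + q * M - w = (c - w) + q * M by lia.
  have [h1 h2] := @div_M q (c - w) ltac:(lia).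
  by rewrite /row h1 h2 qk andbT.
have uM : u < M by rewrite ltnS leq_pmull.
case: q qk qh wi => [|q] qk qh wi; first by move: wi; rewrite mul0n addn0 leqNgt wc.
have -> : c + q.+1 * M - w = (M - (w - c)) + q * M by rewrite mulSn; lia.
have [h1 h2] := @div_M q (M - (w - c)) ltac:(lia).
rewrite /row h1 h2; apply/negP => /and3P[f /eqP m _].
have := mincoins_lower A_range f; rewrite m.
have : q.+2 * u <= h * u by rewrite leq_mul2r; apply/orP; right; lia.
by rewrite !mulSn /M; lia.
Qed.

Lemma conv_row a k q c (x : nat -> nat) : q < k -> q < h -> c < M ->
  (forall i, i < 2 ^ K -> av a 3 i = row k i) ->
  (forall i, i < 2 ^ K -> av a 4 i = if i < u.+1 then x i else 0) ->
  conv_sum a (c + q * M) =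
  \sum_(w < u.+1) x w * [&& w <= c, fea (c - w) & mc (c - w) == q].
Proof.
move=> qk qh cM E3 E4; set i := c + q * M.
have iK : i < 2 ^ K.
  apply: leq_trans MK; apply: leq_trans (leq_addr _ _).
  have : q.+1 * M <= h.+1 * M by rewrite leq_mul2r; apply/orP; right; lia.
  by rewrite /i mulSn; lia.
transitivity (\sum_(w < i.+1) (if w < u.+1 then x w * row k (i - w) else 0)).
  rewrite /conv_sum (reindex_inj rev_ord_inj) /=; apply: eq_bigr => w _.
  have wi : w <= i by rewrite -ltnS.
  have h1 : w < 2 ^ K by apply: leq_ltn_trans iK.
  have h2 : i - w < 2 ^ K by apply: leq_ltn_trans (leq_subr _ _) iK.
  rewrite subSS subKn // (E3 _ h2) (E4 _ h1).
  by case: ifP; rewrite ?muln0 // => _; rewrite mulnC.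
pose F w := x w * [&& w <= c, fea (c - w) & mc (c - w) == q].
transitivity (\sum_(w < i.+1) (if w < u.+1 then F w else 0)).
  apply: eq_bigr => w _; case: ifP => // wu; rewrite /F row_shift // -ltnS; exact: ltn_ord.
rewrite (big_ord_widen (maxn i.+1 u.+1) (fun w => if w < u.+1 then F w else 0)) ?leq_maxl //.
rewrite (big_ord_widen (maxn i.+1 u.+1) F) ?leq_maxr // big_mkcond [RHS]big_mkcond /=.
apply: eq_bigr => w _; case: (ltnP w i.+1) => wi; case: ifP => // wu.
rewrite /F; case: leqP => wc; last by rewrite muln0.
by move: wi; rewrite leqNgt ltnS (leq_trans wc) // /i leq_addr.
Qed.

Lemma conv_sum_le a i k (x : nat -> nat) :
  (forall i, i < 2 ^ K -> av a 3 i = row k i) ->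
  (forall i, i < 2 ^ K -> av a 4 i = if i < u.+1 then x i else 0) ->
  i < 2 ^ K -> conv_sum a i <= \sum_(w < u.+1) x w.
Proof.
move=> E3 E4 iK.
apply: leq_trans (_ : \sum_(w < i.+1) (if w < u.+1 then x w else 0) <= _).
  rewrite /conv_sum (reindex_inj rev_ord_inj) /=; apply: leq_sum => w _.
  have wi : w <= i by rewrite -ltnS.
  have h1 : w < 2 ^ K by apply: leq_ltn_trans iK.
  have h2 : i - w < 2 ^ K by apply: leq_ltn_trans (leq_subr _ _) iK.
  rewrite subSS subKn // (E3 _ h2) (E4 _ h1).
  by case: ifP => _; case: row; rewrite ?mul1n ?mul0n ?muln0.
rewrite (big_ord_widen (maxn i.+1 u.+1) (fun w => if w < u.+1 then x w else 0)) ?leq_maxl //.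
rewrite (big_ord_widen (maxn i.+1 u.+1) x) ?leq_maxr // big_mkcond [leqRHS]big_mkcond /=.
by apply: leq_sum => w _; case: (ltnP w i.+1) => wi; case: ifP.
Qed.

Lemma query_tri k a (x : nat -> nat) (Q : astate -> Prop) : k <= h.+1 -> 0 < u ->
  rg a 7 = K -> rg a 8 = J -> rg a 14 = 2 ^ K ->
  (forall i, i < 2 ^ K -> av a 3 i = row k i) ->
  (forall i, i < 2 ^ K -> av a 4 i = if i < u.+1 then x i else 0) ->
  \sum_(w < u.+1) x w < lim ->
  (forall a', keep conv_query a a' ->
     (forall i, i < 2 ^ K -> av a' 24 i %/ 2 ^ rg a' 63 = conv_sum a i) -> Q a') ->
  tri W lim ub conv_query a Q.
Proof.
move=> kh u0 e7 e8 e14 E3 E4 sl HQ.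
apply: (@conv_query_tri (h * M + M) u.+1) => //.
- by rewrite addn_gt0 orbT.
- by rewrite -mulSnr; exact: leqW MK.
- move=> i hi iK; rewrite E3 //; apply/eqP; rewrite eqb0; apply/negP => /row_lt/(_ kh).
  by rewrite ltnNge hi.
- by move=> i hi iK; rewrite E4 // ltnNge hi.
- by move=> i iK; rewrite E3 //; case: row; lia.
- move=> i iK; rewrite E4 //; case: ifP => [iu|_]; last lia.
  by apply: leq_ltn_trans sl; rewrite (bigD1 (Ordinal iu)) //= leq_addr.
by move=> i iK; apply: leq_ltn_trans sl; exact: (conv_sum_le E3 E4).
Qed.

Definition low (k c : nat) : nat :=
  if [&& 0 < c, fea c & mc c <= k] then mc c else 0.

Lemma level_next k c : 0 < c ->
  (0 < \sum_(w < u.+1) A w * [&& w <= c, fea (c - w) & mc (c - w) == k]) ->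
  fea c /\ mc c <= k.+1.
Proof.
move=> c0; rewrite lt0n sum_nat_eq0 => /forallPn[w].
rewrite /= muln_eq0 !eqb0 negb_or !negbK => /andP[Aw /and3P[wc fw /eqP mw]].
have [s ss sz] := mincoins_sol A_range fw.
have := sol_cons Aw ss; rewrite subnKC // => sc.
by split; [exact: (sol_feasible A_range sc)|rewrite -mw -sz; exact: (mincoins_min A_range sc)].
Qed.

Lemma level_next_wit k c : 0 < c -> fea c -> mc c = k.+1 ->
  0 < \sum_(w < u.+1) A w * [&& w <= c, fea (c - w) & mc (c - w) == k].
Proof.
move=> c0 fc mk; have [w hw] := wit_exists A_range c0 fc.
have wu : w < u.+1 by have := wit_pos A_range hw; lia.
case/and4P: hw => Aw wc fw; rewrite mk eqSS => mw.
by rewrite (bigD1 (Ordinal wu)) //= Aw wc fw eq_sym mw.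
Qed.

Lemma levels_tri a (Q : astate -> Prop) : 0 < u ->
  rg a 5 = h -> rg a 6 = M -> rg a 7 = K -> rg a 8 = J -> rg a 13 = u.+1 -> rg a 14 = 2 ^ K ->
  h <= ub 5 -> M <= ub 6 -> u.+1 <= ub 13 -> u.+2 <= lim -> M < lim -> h < lim ->
  (forall w, w < u.+1 -> av a 0 w = A w) ->
  (forall i, av a 1 i = 0) -> (forall i, av a 3 i = 0) -> (forall i, av a 4 i = 0) ->
  (forall a', keep levels a a' ->
     (forall c, c < M -> av a' 1 c = low h c) -> (forall c, M <= c -> av a' 1 c = 0) ->
     (forall i, i < 2 ^ K -> av a' 3 i = row h.+1 i) ->
     (forall i, u < i -> av a' 4 i = 0) -> Q a') ->
  tri W lim ub levels a Q.
Proof.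
move=> u0 e5 e6 e7 e8 e13 e14 b5 b6 b13 ul Ml hl E0 E1 E3 E4 HQ.
apply: (@tri_conseq _ _ _ _ _ (fun a' => [/\
     forall c, c < M -> av a' 1 c = low h c, forall c, M <= c -> av a' 1 c = 0,
     forall i, i < 2 ^ K -> av a' 3 i = row h.+1 i & forall i, u < i -> av a' 4 i = 0]));
  last by move=> a' k [*]; apply: HQ.
apply: tri_seq; apply: (@tri_map _ _ _ _ _ _ _ _ (fun w => A w)).
- by rewrite e13.
- move=> i a'; rewrite e13 => iu e62 _ Ea _; rewrite /= e62 Ea // E0 //; split=> // _.
  by case: (A i); lia.
rewrite e13 => a1 Er1 Ea1 _ E41.
apply: tri_seq; apply: (@tri_put _ _ _ _ _ _ 0 1) => //; first by lia.
set a2 := seta a1 3 0 1.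
have fea0 : fea 0 by rewrite /feasible (mincoins0 A_range).
have z4 i : u < i -> av a2 4 i = 0 by move=> ui; rewrite /= E41 ltnS leqNgt ui /= E4.
pose I k a' := [/\ forall c, c < M -> av a' 1 c = low k c, forall c, M <= c -> av a' 1 c = 0,
     forall i, i < 2 ^ K -> av a' 3 i = row k.+1 i & forall i, u < i -> av a' 4 i = 0].
have init_row i : i < 2 ^ K -> av a2 3 i = row 1 i.
  move=> iK; rewrite /= /upd /row; case: eqP => [->|/eqP i0].
    by rewrite mod0n div0n fea0 (mincoins0 A_range).
  rewrite Ea1 // E3; apply/esym/eqP; rewrite eqb0; apply/negP => /and3P[_ m d].
  have {}d : i %/ M = 0 by apply/eqP; rewrite -leqn0 -ltnS.
  move: m; rewrite d.
  rewrite -leqn0 leqNgt => /negP; apply; apply: (mincoins_gt0 A_range).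
  rewrite lt0n; apply: contra i0 => /eqP m; rewrite (divn_eq i M) m addn0.
  by rewrite d.
have e5' : rg a2 5 = h by rewrite /= Er1.
apply: (@tri_for _ _ _ _ _ _ _ I); rewrite ?e5' //.
  split.
  - move=> c cM; rewrite /= Ea1 // E1 /low; case: ifP => // /and3P[c0 _].
    by have := mincoins_gt0 A_range c0; case: mincoins.
  - by move=> c cM; rewrite /= Ea1 // E1.
  - exact: init_row.
  - exact: z4.
move=> k a3 kh K3 [I1 I2 I3 I4].
have r3 r : r \notin modr (Fo 70 5 (Sq conv_query (Fo 71 6 level_mark))) -> rg a3 r = rg a2 r.
  exact: (keep_r K3).
have x4 i : i < 2 ^ K -> av a3 4 i = if i < u.+1 then nat_of_bool (A i) else 0.
  by move=> _; rewrite (keep_a K3) //= E41; case: ifP => // _; rewrite E4.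
apply: tri_seq; apply: (@query_tri k.+1 _ (fun w => A w)) => //=; rewrite /upd /= ?r3 //= ?Er1 //.
- by lia.
- apply: leq_ltn_trans ul; apply: leq_trans (_ : \sum_(w < u.+1) 1 <= _); last by rewrite sum_nat_const card_ord muln1.
  by apply: leq_sum => w _; case: (A w).
move=> a4 K4 G4.
have cs c : c < M -> conv_sum (setr a3 70 k) (c + k * M) =
   \sum_(w < u.+1) A w * [&& w <= c, fea (c - w) & mc (c - w) == k].
  by move=> cM; apply: (@conv_row _ k.+1 k c (fun w => A w)).
have cK c : c < M -> c + k.+1 * M < 2 ^ K.
  move=> cM; apply: leq_trans MK; apply: leq_trans (leq_addr _ _).
  have : k.+2 * M <= h.+1 * M by rewrite leq_mul2r; apply/orP; right; lia.
  by rewrite [k.+2 * M]mulSn; lia.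
pose done c0 i := [&& fea (i %% M), mc (i %% M) == i %/ M &
   (i %/ M < k.+1) || (i %/ M == k.+1) && (i %% M < c0)].
pose I' c0 a' := [/\ forall c, c < M -> av a' 1 c = low (if c < c0 then k.+1 else k) c,
     forall c, M <= c -> av a' 1 c = 0,
     forall i, i < 2 ^ K -> av a' 3 i = done c0 i,
     rg a' 63 = rg a4 63 & av a' 24 = av a4 24].
have e6' : rg a4 6 = M by rewrite (keep_r K4) //= /upd /= r3 //= Er1.
have e70 : rg a4 70 = k by rewrite (keep_r K4) //= /upd /=.
apply: (@tri_for _ _ _ _ _ _ _ I'); rewrite ?e6' //.
- split=> // [c cM|c cM|i iK].
  + by rewrite (keep_a K4) //= I1.
  + by rewrite (keep_a K4) //= I2.
  by rewrite (keep_a K4) //= I3 // /done /row ltn0 andbF orbF.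
- move=> c a5 cM K5 [J1 J2 J3 J4 J5].
  have f70 : rg a5 70 = k by rewrite (keep_r K5).
  have f6 : rg a5 6 = M by rewrite (keep_r K5).
  have guard : ev W (setr a5 71 c) (Op Eq (Ar 1 (Va 71)) (Nu 0) *& ((Nu 0 <& Va 71) *&
       (Nu 0 <& Op Sr (Ar 24 (Va 71 +& Va 70 *& Va 6)) (Va 63)))) =
     (low k c == 0) * ((0 < c) * (0 < conv_sum (setr a3 70 k) (c + k * M))).
    rewrite /= /upd /= f70 f6 J4 J5 J1 // ltnn G4 //.
    by have := cK c cM; rewrite mulSn; lia.
  have next : (fea c && (mc c == k.+1)) = (low k c == 0) && ((0 < c) && (0 < conv_sum (setr a3 70 k) (c + k * M))).
    rewrite cs // /low; have [->|c0] := posnP c.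
      by rewrite (mincoins0 A_range) /= ?andbF.
    rewrite /=; apply/andP/andP => [[fc /eqP mk]|[l /(level_next c0)[fc mk]]].
      by rewrite fc mk ltnn; split=> //; exact: level_next_wit.
    split=> //; move: l; rewrite fc /=; case: leqP => [_ |]; last by lia.
    by rewrite -leqn0 leqNgt (mincoins_gt0 A_range c0).
  have low_next c' : low k.+1 c' = if fea c' && (mc c' == k.+1) then k.+1 else low k c'.
    rewrite /low; case fc: (fea c') => /=; last by rewrite !andbF.
    rewrite [mc c' <= k.+1]leq_eqVlt ltnS; case: eqP => [mk|_] //=.
    have -> : 0 < c' by case: posnP mk => // -> ; rewrite (mincoins0 A_range).
    by rewrite mk.
  have lowS c' : (if c' < c.+1 then k.+1 else k) = (if c' == c then k.+1 else if c' < c then k.+1 else k).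
    by rewrite ltnS leq_eqVlt; case: eqP.
  have doneS i : done c.+1 i = if i == c + k.+1 * M then fea c && (mc c == k.+1) else done c i.
    rewrite /done; have [->|/eqP ne] := eqVneq i (c + k.+1 * M).
      by have [-> ->] := div_M k.+1 cM; rewrite eqxx !ltnSn orbT !andbT.
    congr [&& _, _ & _ || _]; case: eqP => //= d.
    rewrite ltnS leq_eqVlt; case: eqP => // m; case: ne.
    by rewrite (divn_eq i M) d m addnC.
  apply: tri_cn; rewrite guard => g.
    have [fc mk] : fea c /\ mc c = k.+1.
      suff : fea c && (mc c == k.+1) by case/andP=> ? /eqP.
      rewrite next; move: g; rewrite !muln_eq0 !eqb0 !negb_or !negbK.
      by case/and3P=> -> -> ->.
    apply: tri_seq; apply: (@tri_put _ _ _ _ _ _ c k.+1) => //=.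
    - by rewrite /upd /= f70 addn1.
    - by lia.
    apply: (@tri_put _ _ _ _ _ _ (c + k.+1 * M) 1) => //=; last split=> //=.
    - by rewrite /upd /= f70 f6 addn1.
    - by lia.
    - move=> c' c'M; rewrite /upd lowS J1 //.
      by case: eqP => [->|//]; rewrite low_next fc mk eqxx.
    - by move=> c' Mc; rewrite /upd J2 //; case: eqP => // e; lia.
    by move=> i iK; rewrite /upd doneS J3 //; case: eqP => [_|//]; rewrite fc mk eqxx.
  have nx : (fea c && (mc c == k.+1)) = false.
    apply: negbTE; rewrite next; move/eqP: g; rewrite !muln_eq0 !eqb0.
    by case: (low k c == 0) => //=; case: (0 < c).
  apply: tri_nop; split=> //=.
  - move=> c' c'M; rewrite lowS J1 //.
    by case: eqP => [->|//]; rewrite low_next nx ltnn.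
  - move=> i iK; rewrite doneS J3 //; case: eqP => [->|//].
    by rewrite nx /done; have [-> ->] := div_M k.+1 cM; rewrite !ltnn ?andbF.
move=> a5 K5 [J1 J2 J3 J4 J5]; split=> //=.
- by move=> c cM; rewrite J1 // cM.
- move=> i iK; rewrite J3 // /done /row ltn_pmod // andbT.
  by congr [&& _, _ & _]; lia.
by move=> i ui; rewrite (keep_a K5) // (keep_a K4) // I4.
Qed.

End Levels.
End Query.

(** * The sampling program *)

Local Notation "x '=&' y" := (Op Eq x y) (at level 70).

(* The weight [(u + 1) ^ 2 + w] of a coin makes the answer of a query determine
   both the number of coins counted, as quotient by [(u + 1) ^ 2], and their sum, as
   remainder. *)
Definition testq :=
  Sq (mapl 4 81 13 (Ar 6 (Va 81) *& (((Va 81 %& Va 76) =& Va 75) *& (Va 11 +& Va 81))))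
  (Sq conv_query
      (mapl 5 81 6 (Op Sr (Ar 24 (Va 81 +& (Ar 1 (Va 81) -& Nu 1) *& Va 6)) (Va 63)))).

(* 77, 78, 79, 80 hold the sizes of [A_i], of the targets at the start of the
   pass, of the residue class, and of the targets hit by it. *)
Definition accept_upd :=
  Cn ((Va 18 *& Va 79 *& Va 78) <& (Va 80 *& Va 77))
    (Sq (mapl 7 81 13 (Nu 0 <& (Ar 7 (Va 81) +& Ar 4 (Va 81))))
        (mapl 8 81 6 (Ar 8 (Va 81) *& ((Ar 5 (Va 81) /& Va 11) =& Nu 0)))) Nop.

Definition top_upd :=
  mapl 2 81 6 (Ar 2 (Va 81) +&
    (((Ar 5 (Va 81) /& Va 11) =& Nu 1) *& ((Ar 5 (Va 81) %& Va 11) -& Ar 2 (Va 81)))).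

Definition test_body :=
  Sq testq (Sq (suml 79 81 13 (Nu 0 <& Ar 4 (Va 81)))
  (Sq (suml 80 81 6 (Ar 8 (Va 81) *& (Nu 0 <& (Ar 5 (Va 81) /& Va 11))))
  (Sq accept_upd top_upd))).

Definition pass_prog :=
  Sq (suml 78 81 6 (Ar 8 (Va 81)))
     (Fo 74 9 (Sq (Set_ 76 (Va 74 +& Nu 1)) (Fo 75 76 test_body))).

Definition round_prog :=
  Sq (mapl 9 81 13 (Ar 9 (Va 81) *& (Nu 1 -& Ar 6 (Va 81)) +& Va 72 *& Ar 6 (Va 81)))
  (Sq (Set_ 76 (Nu 1)) (Sq (Set_ 75 (Nu 0)) (Sq testq
  (Sq (mapl 8 81 6 (Va 10 <& (Ar 5 (Va 81) /& Va 11)))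
  (Sq (mapl 2 81 6 (Ar 2 (Va 81) *& ((Ar 5 (Va 81) /& Va 11) =& Nu 0)))
  (Sq (mapl 7 81 13 (Nu 0))
  (Sq (suml 77 81 13 (Ar 6 (Va 81)))
  (Sq (Fo 73 7 pass_prog)
      (mapl 6 81 13 (Ar 7 (Va 81))))))))))).

Definition rounds_prog :=
  Sq (mapl 9 81 13 (Nu 0)) (Sq (mapl 6 81 13 (Ar 0 (Va 81))) (Fo 72 16 round_prog)).

Section Rounds.
Variables (W lim : nat) (ub : nat -> nat) (K J : nat).
Hypotheses (lim0 : 128 <= lim) (limW : lim ^ 12 <= 2 ^ W) (limK : 2 ^ (K + J).+2 < lim).
Hypotheses (ub14 : 2 ^ K <= ub 14)
  (ub56 : 2 ^ (K + J) <= ub 56) (ub57 : 2 ^ (K + J) <= ub 57)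
  (ub65 : 2 ^ K.+1 <= ub 65) (ub59 : K.+1 <= ub 59) (ub8 : J <= ub 8).
Hypotheses (K0 : 0 < K) (KJ : iter J uphalf K = 1).
Variables (u h : nat) (A : nat -> bool).
Hypothesis A_range : forall w, A w -> 0 < w <= u.
Hypotheses (h0 : 0 < h) (u0 : 0 < u).
Let M := (h * u).+1.
Hypothesis MK : h.+1 * M + u.+1 <= 2 ^ K.
Let BIG := u.+1 * u.+1.
Variables (P Q b : nat).
Let kap := 2 * K.
Hypotheses (u1b : u.+1 <= 2 ^ b) (Q0 : 0 < Q) (P0 : 0 < P).
Hypotheses (Qb : 2 * (Q * b) <= primes_upto P)
  (QP : 4 * (kap * P) <= Q * primes_upto P).
Hypotheses (limB : u.+1 * (BIG + u.+1) < lim) (limM : M < lim) (limP : P < lim)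
  (limb : b < lim).
Hypotheses (ub6 : M <= ub 6) (ub7 : K <= ub 7) (ub9 : P <= ub 9) (ub13 : u.+1 <= ub 13)
  (ub16 : b.+1 <= ub 16) (ub76 : P <= ub 76).

Definition wt c w := (0 < low u A h c) && wit u A c w.

Record rctx (Ai : nat -> bool) (a : astate) : Prop := RCtx
  { rc6 : rg a 6 = M; rc7 : rg a 7 = K; rc8 : rg a 8 = J; rc9 : rg a 9 = P;
    rc10 : rg a 10 = Q; rc11 : rg a 11 = BIG; rc13 : rg a 13 = u.+1;
    rc14 : rg a 14 = 2 ^ K; rc16 : rg a 16 = b.+1; rc18 : rg a 18 = kap;
    rca0 : forall w, w < u.+1 -> av a 0 w = A w;
    rca1 : forall c, c < M -> av a 1 c = low u A h c;
    rca3 : forall i, i < 2 ^ K -> av a 3 i = row u h A h.+1 i;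
    rca4 : forall i, u < i -> av a 4 i = 0;
    rca6 : forall w, w < u.+1 -> av a 6 w = Ai w;
    rcA : forall w, Ai w -> A w }.

Definition ctx_regs := [:: 6; 7; 8; 9; 10; 11; 13; 14; 16; 18].

Lemma rctx_eq Ai a a' : rctx Ai a ->
  (forall r, r \in ctx_regs -> rg a' r = rg a r) ->
  (forall j, j \in [:: 0; 1; 3; 4; 6] -> av a' j = av a j) -> rctx Ai a'.
Proof.
case=> r6 r7 r8 r9 r10 r11 r13 r14 r16 r18 a0 a1 a3 a4 a6 aA Er Ea.
by split; rewrite ?Er ?Ea.
Qed.

Local Notation cnt := (wcnt u.+1 wt).
Local Notation sm := (wsum u.+1 wt).
Local Notation siz := (csize u.+1).

Lemma kap0 : 0 < kap. Proof. by rewrite muln_gt0. Qed.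

Lemma sm_lt X c : sm X c < BIG.
Proof. by case: (wsum_lt u.+1 wt X c). Qed.

Lemma MK1 c q : c < M -> q <= h -> c + q * M < 2 ^ K.
Proof.
move=> cM qh; apply: leq_trans MK; apply: leq_trans (leq_addr _ _).
have : q.+1 * M <= h.+1 * M by rewrite leq_mul2r ltnS qh orbT.
by rewrite mulSn; apply: leq_trans; rewrite -addSn leq_add2r.
Qed.

Lemma BIG_lim w : w < u.+1 -> BIG + w < lim.
Proof. by move=> wu; apply: leq_ltn_trans limB; rewrite mulSn; apply: leq_trans (leq_addr _ _); rewrite leq_add2l ltnW. Qed.

Lemma big_sum_le (x : nat -> nat) B : (forall w, w < u.+1 -> x w <= B) ->
  \sum_(w < u.+1) x w <= u.+1 * B.
Proof.
move=> h1; apply: leq_trans (_ : \sum_(w < u.+1) B <= _).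
  by apply: leq_sum => w _; exact: h1.
by rewrite sum_nat_const card_ord.
Qed.

Lemma wt_low c w : A w ->
  wt c w = [&& w <= c, feasible u A (c - w) & mincoins u A (c - w) == (low u A h c).-1].
Proof.
move=> Aw; rewrite /wt /wit Aw /= /low; case: ifP => [/and3P[c1 f l]|nl] /=.
  have m0 := mincoins_gt0 A_range c1.
  by rewrite m0; congr [&& _, _ & _]; lia.
apply/esym/negP => /and3P[wc f /eqP m0]; move/negP: nl; apply.
have [w0 _] := andP (A_range Aw).
have cw : c = w + 0.
  case: (posnP (c - w)) => [z|c0]; first by lia.
  by have := mincoins_gt0 A_range c0; rewrite m0.
have f0 : feasible u A 0 by rewrite /feasible (mincoins0 A_range).
have [s ss _] := mincoins_sol A_range f0.
rewrite cw (sol_feasible A_range (sol_cons Aw ss)) addn0 w0 /=.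
apply: leq_trans h0; rewrite -(mincoins0 A_range) -[w in mincoins _ _ w]addn0.
exact: mincoins_step.
Qed.

Lemma testq_tri Ai a p r (R : astate -> Prop) : rctx Ai a ->
  rg a 76 = p -> rg a 75 = r ->
  (forall a', keep testq a a' -> rctx Ai a' ->
     (forall w, w < u.+1 -> av a' 4 w = tst Ai p r w * (BIG + w)) ->
     (forall c, c < M -> av a' 5 c = cnt (tst Ai p r) c * BIG + sm (tst Ai p r) c) ->
     R a') -> tri W lim ub testq a R.
Proof.
move=> C e76 e75 HR; have [r6 r7 r8 r9 r10 r11 r13 r14 r16 r18 c0 c1 c3 c4 c6 cA] := C.
pose X := tst Ai p r; pose x w := X w * (BIG + w).
apply: (@tri_conseq _ _ _ _ _ (fun a' => [/\ rctx Ai a',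
  forall w, w < u.+1 -> av a' 4 w = x w &
  forall c, c < M -> av a' 5 c = cnt X c * BIG + sm X c])); last by move=> a' k [*]; apply: HR.
have xB w : w < u.+1 -> x w <= BIG + u.+1.
  by move=> wu; rewrite /x; case: (X w); rewrite ?mul0n // mul1n leq_add2l ltnW.
apply: tri_seq; apply: (@tri_map _ _ _ _ _ _ _ _ x).
- by rewrite r13.
- move=> i a'; rewrite r13 => iu e81 Er Ea _; rewrite /= e81 !Er // Ea // e76 e75 r11 c6 //.
  split; first by rewrite /x /X /tst; case: (Ai i); rewrite ?mul1n ?mul0n.
  move=> _; apply: leq_ltn_trans (xB _ iu) _; apply: leq_ltn_trans limB.
  by rewrite -{1}[BIG + _]mul1n leq_mul2r orbT.
rewrite r13 => a1 Er1 Ea1 _ E4.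
have C1 : rctx Ai a1.
  split; rewrite ?Er1 //; try exact: cA; move=> i iu;
    do ?by rewrite Ea1 // ?c0 ?c1 ?c3 ?c6.
  by rewrite E4 ltnS leqNgt iu /= c4.
have [_ s7 s8 _ _ _ _ s14 _ _ _ s1 s3 _ _ _] := C1.
have E4' i : i < 2 ^ K -> av a1 4 i = if i < u.+1 then x i else 0.
  by move=> iK; rewrite E4; case: ltnP => // ui; rewrite c4.
have xl : \sum_(w < u.+1) x w < lim by apply: leq_ltn_trans limB; apply: big_sum_le.
apply: tri_seq; apply: (query_tri lim0 limW limK ub14 ub56 ub57 ub65 ub59 ub8 K0 KJ h0 MK
  (k := h.+1) (x := x) (leqnn _) u0 s7 s8 s14 s3 E4' xl).
move=> a2 K2 G2.
have C2 : rctx Ai a2.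
  apply: (rctx_eq C1) => [r'|j]; rewrite !inE.
    by move=> hr; apply: (keep_r K2); move: hr; do !case: eqP => [->|_] //.
  by move=> hj; apply: (keep_a K2); move: hj; do !case: eqP => [->|_] //.
have [t6 _ _ _ _ _ _ _ _ _ _ t1 _ _ _ _] := C2.
pose g c := cnt X c * BIG + sm X c.
have gE c : c < M -> conv_sum a1 (c + (low u A h c).-1 * M) = g c.
  move=> cM.
  have qh : (low u A h c).-1 < h.
    by rewrite /low; case: ifP => [/and3P[_ _ l]|_] /=; [case: mincoins l|].
  rewrite (conv_row lim0 limW limK ub14 ub56 ub57 ub65 ub59 ub8 K0 KJ A_range h0 MK
    (k := h.+1) (x := x) _ qh cM s3 E4'); last by apply: leq_trans qh _.
  rewrite /g /wcnt /wsum big_distrl -big_split /=; apply: eq_bigr => w _.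
  rewrite -mulnDr /x -mulnA [(BIG + w) * _]mulnC mulnA; congr (_ * _).
  rewrite mulnb; congr nat_of_bool.
  case Xw : (X w) => //=; rewrite -/M; apply/esym.
  have Aw : A w by apply: cA; case/andP: Xw.
  exact: wt_low.
have gl c : c < M -> g c < lim.
  move=> cM; rewrite -gE //; apply: leq_ltn_trans xl.
  apply: (conv_sum_le (K := K) (h := h) (A := A) (k := h.+1)) => //.
  apply: MK1 => //; rewrite /low; case: ifP => [/and3P[_ _ l]|_] //.
  by apply: leq_trans (leq_pred _) l.
apply: (@tri_map _ _ _ _ _ _ _ _ g).
- by rewrite t6.
- move=> i a'; rewrite t6 => iM e81 Er Ea _; split=> [|_]; last exact: gl.
  rewrite /= e81 !Er // !Ea // t6 t1 // subn1 G2 ?gE //.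
  apply: MK1 => //; rewrite /low; case: ifP => [/and3P[_ _ l]|_] //.
  by apply: leq_trans (leq_pred _) l.
rewrite t6 => a3 Er3 Ea3 _ E5; split.
- apply: (rctx_eq C2) => [r'|j]; rewrite !inE.
    by move=> hr; apply: Er3; move: hr; do !case: eqP => [->|_] //.
  by move=> hj; apply: Ea3; move: hj; do !case: eqP => [->|_] //.
- by move=> w wu; rewrite Ea3 // (keep_a K2) // E4 wu.
by move=> c cM; rewrite E5 cM.
Qed.

Lemma divmod_cnt X c v : v = cnt X c * BIG + sm X c ->
  v %/ BIG = cnt X c /\ v %% BIG = sm X c.
Proof.
move=> ->; rewrite divnMDl ?muln_gt0 // modnMDl.
by rewrite divn_small ?sm_lt // modn_small ?sm_lt // addn0.
Qed.

Lemma bool_lim (x : bool) : x < lim.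
Proof. by apply: leq_trans lim0; case: x. Qed.

Lemma u1_lim : u.+1 < lim.
Proof. by have := BIG_lim (ltnSn u); apply: leq_ltn_trans; rewrite -addn1 addnC leq_add // muln_gt0. Qed.

Lemma test_body_tri Ai a p r (U U0 H : nat -> bool) (R : astate -> Prop) : rctx Ai a ->
  rg a 76 = p -> rg a 75 = r -> rg a 77 = siz Ai -> rg a 78 = csz M U0 ->
  (forall c, c < M -> av a 8 c = U c) -> (forall w, w < u.+1 -> av a 7 w = H w) ->
  (forall i, av a 2 i <= u) ->
  let X := tst Ai p r in
  let acc := accept u.+1 M kap wt Ai U0 U X in
  (forall a', keep test_body a a' -> rctx Ai a' ->
     (forall c, c < M -> av a' 8 c = U c && ~~ (acc && (0 < cnt X c))) ->
     (forall w, w < u.+1 -> av a' 7 w = H w || acc && X w) ->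
     (forall c, c < M -> av a' 2 c =
        if cnt X c == 1 then maxn (av a 2 c) (sm X c) else av a 2 c) ->
     (forall i, av a' 2 i <= u) -> R a') ->
  tri W lim ub test_body a R.
Proof.
move=> C e76 e75 e77 e78 E8 E7 E2 X acc HR.
apply: (@tri_conseq _ _ _ _ _ (fun a' => [/\ rctx Ai a',
     forall c, c < M -> av a' 8 c = U c && ~~ (acc && (0 < cnt X c)),
     forall w, w < u.+1 -> av a' 7 w = H w || acc && X w,
     forall c, c < M -> av a' 2 c =
        if cnt X c == 1 then maxn (av a 2 c) (sm X c) else av a 2 c &
     forall i, av a' 2 i <= u])); last by move=> a' k [*]; apply: HR.
apply: tri_seq; apply: (testq_tri C e76 e75) => a1 K1 C1 E4 E5.
have {}E7 w : w < u.+1 -> av a1 7 w = H w by rewrite (keep_a K1) //; exact: E7.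
have {}E8 c : c < M -> av a1 8 c = U c by rewrite (keep_a K1) //; exact: E8.
have f2 : av a1 2 = av a 2 by rewrite (keep_a K1).
have BIG0 : 0 < BIG by rewrite muln_gt0.
have [s6 _ _ _ _ s11 s13 _ _ s18 _ _ _ _ _ _] := C1.
have X4 w : w < u.+1 -> (0 < av a1 4 w) = X w.
  by move=> wu; rewrite E4 // -/X; case: (X w); rewrite ?mul1n ?addn_gt0 ?BIG0.
apply: tri_seq; apply: (@tri_sum _ _ _ _ _ _ _ _ (fun w => X w)) => //.
- by rewrite s13.
- by move=> i a'; rewrite s13 => iu e81 Er Ea; rewrite /= e81 Ea X4.
- by rewrite s13; apply: leq_ltn_trans (csize_le _ _) u1_lim.
rewrite s13 => a2 Er2 Ea2 _ e79.
have {}e79 : rg a2 79 = siz X by [].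
have X5 c : c < M -> (0 < av a2 5 c %/ BIG) = (0 < cnt X c).
  by move=> cM; have [|-> _] := @divmod_cnt X c (av a2 5 c); rewrite // Ea2 E5.
apply: tri_seq; apply: (@tri_sum _ _ _ _ _ _ _ _ (fun c => U c && (0 < cnt X c))) => //.
- by rewrite Er2 // s6.
- move=> i a'; rewrite Er2 // s6 => iu e81 Er Ea; rewrite /= e81 Ea Er // Er2 // s11.
  by rewrite X5 // Ea2 E8 // mulnb.
- rewrite Er2 // s6; apply: leq_ltn_trans limM.
  apply: leq_trans (csz_le M U); apply: leq_sum => c _; by case: (U c); case: (0 < _).
rewrite Er2 // s6 => a3 Er3 Ea3 _ e80.
have {}e80 : rg a3 80 = hits u.+1 M wt U X by [].
have f4 w : w < u.+1 -> (0 < av a3 4 w) = X w by move=> wu; rewrite Ea3 Ea2 X4.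
have f5 c : c < M -> av a3 5 c = cnt X c * BIG + sm X c by move=> cM; rewrite Ea3 Ea2 E5.
have f7 w : w < u.+1 -> av a3 7 w = H w by move=> wu; rewrite Ea3 Ea2 E7.
have f8 w : w < M -> av a3 8 w = U w by move=> wu; rewrite Ea3 Ea2 E8.
have {}f2 : av a3 2 = av a 2 by rewrite Ea3 Ea2 f2.
have r79 : rg a3 79 = siz X by rewrite Er3.
have r77 : rg a3 77 = siz Ai by rewrite Er3 // Er2 // (keep_r K1).
have r78 : rg a3 78 = csz M U0 by rewrite Er3 // Er2 // (keep_r K1).
have C3 : rctx Ai a3.
  apply: (rctx_eq C1) => [r'|j _]; last by rewrite Ea3 Ea2.
  by rewrite !inE => hr; rewrite Er3 ?Er2 //; move: hr; do !case: eqP => [->|_] //.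
have [t6 _ _ _ _ t11 t13 _ _ t18 _ _ _ _ _ _] := C3.
clear Er2 Ea2 Er3 Ea3 E4 E5 E7 E8 s6 s11 s13 s18 X4 X5 K1 a1 C1 a2 e79.
apply: tri_seq; apply: (@tri_conseq _ _ _ _ _ (fun a' => 
     (forall c, c < M -> av a' 8 c = U c && ~~ (acc && (0 < cnt X c))) /\
     (forall w, w < u.+1 -> av a' 7 w = H w || acc && X w))).
  have accE : ev W a3 ((Va 18 *& Va 79 *& Va 78) <& (Va 80 *& Va 77)) = acc.
    by rewrite /= t18 r79 r78 e80 r77.
  apply: tri_cn; rewrite accE => hacc; last first.
    have -> : acc = false by case E : acc hacc.
    by apply: tri_nop; split=> [c cM|w wu]; rewrite ?andbT ?orbF ?f8 ?f7.
  have -> : acc = true by case E : acc hacc.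
  apply: tri_seq; apply: (@tri_map _ _ _ _ _ _ _ _ (fun w => H w || X w)).
  - by rewrite t13.
  - move=> i a'; rewrite t13 => iu e81 Er Ea Et; split=> [|_]; last exact: bool_lim.
    by rewrite /= e81 Et // f7 // Ea // addn_gt0 f4 // lt0b.
  rewrite t13 => a4 Er4 Ea4 _ E7.
  apply: (@tri_map _ _ _ _ _ _ _ _ (fun c => U c && ~~ (0 < cnt X c))).
  - by rewrite Er4 // t6.
  - move=> i a'; rewrite Er4 // t6 => iM e81 Er Ea Et; split=> [|_]; last exact: bool_lim.
    rewrite /= e81 Et // Ea4 // f8 // Ea // Ea4 // Er // Er4 // t11.
    by have [-> _] := divmod_cnt (f5 _ iM); rewrite -mulnb -leqNgt leqn0.
  rewrite Er4 // t6 => a5 Er5 Ea5 _ E8; split.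
    by move=> c cM; rewrite E8 cM.
  by move=> w wu; rewrite Ea5 // E7 wu.
move=> a4 K4 [E8 E7].
have C4 : rctx Ai a4.
  apply: (rctx_eq C3) => [r'|j]; rewrite !inE.
    by move=> hr; apply: (keep_r K4); move: hr; do !case: eqP => [->|_] //.
  by move=> hj; apply: (keep_a K4); move: hj; do !case: eqP => [->|_] //.
have [v6 _ _ _ _ v11 _ _ _ _ _ _ _ _ _ _] := C4.
pose g c := if cnt X c == 1 then maxn (av a 2 c) (sm X c) else av a 2 c.
have gu c : g c <= u.
  rewrite /g; case: eqP => // /wcnt1[h1 _ _ _]; rewrite geq_max E2.
  by rewrite -ltnS.
apply: (@tri_map _ _ _ _ _ _ _ _ g).
- by rewrite v6.
- move=> i a'; rewrite v6 => iM e81 Er Ea Et; split=> [|_].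
    rewrite /= e81 Et // !Ea // !(keep_a K4) // f2 !Er // v11.
    have [-> ->] := divmod_cnt (f5 _ iM); rewrite /g; case: eqP => _.
      by rewrite mul1n maxnE.
    by rewrite mul0n addn0.
  by apply: leq_ltn_trans (gu i) _; apply: ltn_trans u1_lim.
rewrite v6 => a5 Er5 Ea5 _ G; split.
- apply: (rctx_eq C4) => [r'|j]; rewrite !inE.
    by move=> hr; apply: Er5; move: hr; do !case: eqP => [->|_] //.
  by move=> hj; apply: Ea5; move: hj; do !case: eqP => [->|_] //.
- by move=> c cM; rewrite Ea5 // E8.
- by move=> w wu; rewrite Ea5 // E7.
- by move=> c cM; rewrite G cM.
by move=> i; rewrite G; case: ifP => // _; rewrite (keep_a K4) // f2.
Qed.

Definition before (p r p' r' : nat) : Prop := (p' < p \/ p' = p /\ r' < r) /\ r' < p'.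

Definition tcond (Ai : nat -> bool) (D : nat -> nat -> Prop) (T0 T : nat -> nat) :=
  forall c, c < M ->
    if cnt Ai c == 0 then T c = T0 c else top_inv u.+1 wt Ai D c (T c).

Lemma tcond_weak Ai (D D' : nat -> nat -> Prop) T0 T :
  (forall p r, D' p r -> D p r) -> tcond Ai D T0 T -> tcond Ai D' T0 T.
Proof. by move=> dd tc c cM; have := tc c cM; case: ifP => // _; apply: top_weak. Qed.

Record pst (Ai U0 H0 : nat -> bool) (D0 : nat -> nat -> Prop) (T0 : nat -> nat)
    (D : nat -> nat -> Prop) (a : astate) : Prop := Pst
  { ps_ctx : rctx Ai a;
    ps_siz : rg a 77 = siz Ai;
    ps_csz : rg a 78 = csz M U0;
    ps_T : forall i, av a 2 i <= u;
    ps_top : tcond Ai (fun p r => D0 p r \/ D p r) T0 (av a 2);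
    ps_inv : exists U H : nat -> bool, [/\ forall c, c < M -> av a 8 c = U c,
      forall w, w < u.+1 -> av a 7 w = H w & pass_inv u.+1 M kap wt Ai U0 H0 D U H] }.

Lemma pst_weak Ai U0 H0 D0 T0 (D D' : nat -> nat -> Prop) a :
  (forall p r, D' p r -> D p r) -> pst Ai U0 H0 D0 T0 D a -> pst Ai U0 H0 D0 T0 D' a.
Proof.
move=> dd [C e7 e8 hT ht [U [H [EU EH I]]]]; split=> //.
  by apply: tcond_weak ht => p r [|/dd]; [left|right].
by exists U, H; split=> //; apply: pass_weak I.
Qed.

Lemma pst_setr Ai U0 H0 D0 T0 D a r v : r \notin [:: 77, 78 & ctx_regs] ->
  pst Ai U0 H0 D0 T0 D a -> pst Ai U0 H0 D0 T0 D (setr a r v).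
Proof.
rewrite !inE !negb_or => /and3P[/negbTE r7 /negbTE r8 rn].
move=> [C e7 e8 hT ht hI]; split=> //=; rewrite /upd ?[77 == r]eq_sym ?r7 ?[78 == r]eq_sym ?r8 //.
apply: (rctx_eq C) => // r' hr' /=; rewrite /upd; case: eqP => // E.
by move: rn; rewrite -E -!negb_or; rewrite !inE in hr'; rewrite hr'.
Qed.

Lemma test_step Ai U0 H0 D0 T0 D a p r : rg a 76 = p -> rg a 75 = r ->
  pst Ai U0 H0 D0 T0 D a ->
  tri W lim ub test_body a (pst Ai U0 H0 D0 T0 (fun p' r' => D p' r' \/ p' = p /\ r' = r)).
Proof.
move=> e76 e75 [C e7 e8 hT ht [U [H [EU EH I]]]].
apply: (test_body_tri C e76 e75 e7 e8 EU EH hT) => a' K' C' EU' EH' ET hT'; split=> //.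
- by rewrite (keep_r K').
- by rewrite (keep_r K').
- move=> c cM; have := ht c cM; case: ifP => [/eqP z <-|nz hi].
    by rewrite ET // wcnt_tst0.
  have hs := top_inv_step hi (ET c cM).
  by apply: top_weak hs => p' r'; tauto.
do 2!eexists; split; [exact: EU'| |].
  exact: EH'.
exact: (pass_step (b := b) (P := P) (Q := Q) u1b Q0 kap0 P0 Qb QP I).
Qed.

Definition all_tests := before P.+1 0.

Record rst (Ai U0 : nat -> bool) (T0 : nat -> nat) (j : nat) (a : astate) : Prop := Rst
  { rs_ctx : rctx Ai a;
    rs_siz : rg a 77 = siz Ai;
    rs_T : forall i, av a 2 i <= u;
    rs_top : tcond Ai (fun p r => 0 < j /\ all_tests p r) T0 (av a 2);
    rs_inv : exists U H : nat -> bool, [/\ forall c, c < M -> av a 8 c = U c,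
      forall w, w < u.+1 -> av a 7 w = H w & round_inv u.+1 M kap wt Ai U0 j U H] }.

Lemma pass_tri Ai (U0 : nat -> bool) T0 j a : (forall c, c < M -> U0 c -> Q <= cnt Ai c) ->
  rst Ai U0 T0 j a -> tri W lim ub pass_prog a (rst Ai U0 T0 j.+1).
Proof.
move=> HQ [C e7 hT ht [U [H [EU EH I]]]]; have [r6 _ _ r9 _ _ _ _ _ _ _ _ _ _ _ _] := C.
apply: tri_seq; apply: (@tri_sum _ _ _ _ _ _ _ _ (fun c => U c)); [by []|by []| | | |].
- by rewrite r6.
- by move=> i a'; rewrite r6 => iM e81 Er Ea; rewrite /= e81 Ea EU.
- by rewrite r6; apply: leq_ltn_trans (csz_le _ _) limM.
rewrite r6 => a1 Er1 Ea1 _ e78.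
pose S D a' := pst Ai U H (fun p r => 0 < j /\ all_tests p r) T0 D a'.
have f9 : rg a1 9 = P by rewrite Er1.
apply: (@tri_for _ _ _ _ _ _ _ (fun i => S (before i.+1 0))); first (by rewrite f9); rewrite ?f9.
- split.
  + apply: (rctx_eq C) => [r'|j' _] //; rewrite !inE => hr; apply: Er1;
      move: hr; do !case: eqP => [->|_] //.
  + by rewrite Er1.
  + exact: e78.
  + by move=> i; rewrite Ea1.
  + move=> c cM; rewrite Ea1; have := ht c cM; case: ifP => // _; apply: top_weak => p r [//|].
    by rewrite /before; lia.
  exists U, H; split=> [c cM|w wu|]; rewrite ?Ea1; [exact: EU|exact: EH|].
  apply: pass_weak (@pass_inv0 _ _ _ _ _ _ _ (ri_HA I)).
  by move=> p r; rewrite /before; lia.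
- move=> i a2 iP K2 S2.
  apply: tri_seq; apply: (@tri_set _ _ _ _ _ i.+1); first by rewrite /= /upd eqxx addn1.
    by apply: leq_ltn_trans limP.
  set a3 := setr _ 76 _.
  have e76 : rg a3 76 = i.+1 by rewrite /= /upd.
  apply: (@tri_for _ _ _ _ _ _ _ (fun r => S (before i.+1 r))); first (by rewrite e76; apply: leq_trans ub76); rewrite ?e76.
  + by do 2!apply: pst_setr => //.
  + move=> r a4 ri K4 S4.
    have g76 : rg (setr a4 75 r) 76 = i.+1 by rewrite /= /upd /= (keep_r K4).
    have g75 : rg (setr a4 75 r) 75 = r by rewrite /= /upd.
    have S5 := pst_setr (r := 75) r isT S4.
    apply: (tri_conseq (test_step g76 g75 S5)) => a5 _.
    by apply: pst_weak => p' r'; rewrite /before; lia.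
  move=> a4 K4 S4; apply: pst_setr => //; apply: pst_weak S4 => p' r'.
  by rewrite /before; lia.
move=> a2 K2 [C2 g7 g8 hT2 ht2 [U2 [H2 [EU2 EH2 I2]]]]; split=> //.
- apply: (rctx_eq C2) => // r'; rewrite /= !inE /upd.
  by do !case: eqP => [->|_] //.
- by apply: tcond_weak ht2 => p r [_]; right.
exists U2, H2; split=> //.
apply: (round_step (b := b) (P := P) (Q := Q) u1b Q0 kap0 P0 Qb QP I I2 HQ) => p r pP rp.
by rewrite /before; lia.
Qed.

Lemma rst_setr Ai U0 T0 j a r v : r \notin [:: 77 & ctx_regs] ->
  rst Ai U0 T0 j a -> rst Ai U0 T0 j (setr a r v).
Proof.
rewrite !inE !negb_or => /andP[/negbTE r7 rn].
move=> [C e7 hT ht hI]; split=> //=; rewrite /upd ?[77 == r]eq_sym ?r7 //.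
apply: (rctx_eq C) => // r' hr' /=; rewrite /upd; case: eqP => // E.
by move: rn; rewrite -E -!negb_or; rewrite !inE in hr'; rewrite hr'.
Qed.

Definition rk (a : astate) (w : nat) := av a 9 w * u.+1 + w.

Record rnd (i : nat) (a : astate) : Prop := Rnd
  { rn_cls : forall w, w < u.+1 -> av a 9 w <= i;
    rn_T : forall c, av a 2 c <= u;
    rn_ex : exists Ai : nat -> bool, [/\ rctx Ai a, siz Ai * 2 ^ i <= 2 ^ b,
      forall w, w < u.+1 -> A w -> ~~ Ai w -> av a 9 w < i &
      forall c, c < M -> 0 < low u A h c -> cnt Ai c = 0 ->
        is_top u A (rk a) c (av a 2 c)] }.

Lemma M_K : M < 2 ^ K.
Proof.
by apply: leq_trans MK; rewrite mulSn -addnA -addn1 leq_add2l addnS.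
Qed.

Lemma rank_step (Ai H : nat -> bool) (cls cls' T T' : nat -> nat) i :
  (forall w, H w -> Ai w) -> (forall w, Ai w -> A w) ->
  (forall w, w < u.+1 -> A w -> ~~ Ai w -> cls w < i) ->
  (forall w, w < u.+1 -> cls' w = if Ai w then i else cls w) ->
  (forall c, c < M -> 0 < low u A h c -> cnt Ai c = 0 ->
     is_top u A (fun w => cls w * u.+1 + w) c (T c)) ->
  (forall c, c < M -> Q < cnt Ai c -> 0 < cnt H c) ->
  tcond Ai all_tests (fun c => if cnt Ai c == 0 then T c else 0) T' ->
  forall c, c < M -> 0 < low u A h c -> cnt H c = 0 ->
    is_top u A (fun w => cls' w * u.+1 + w) c (T' c).
Proof.
move=> HA iA hcls cE hT hhit hT' c cM l0 H0.
have wu w : wit u A c w -> w < u.+1 by move/(wit_pos A_range); rewrite ltnS => /andP[].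
have := hT' c cM; case: eqP => [z ->|/eqP nz ti].
  have [t1 t2] := hT c cM l0 z.
  have nA w : wit u A c w -> Ai w = false.
    move=> hw; apply/negP => Aw; suff : 0 < cnt Ai c by rewrite z.
    by apply/wcnt_gt0; exists w; rewrite ?wu // Aw /wt l0 hw.
  split=> // w hw; rewrite !cE ?wu // !nA //; exact: t2.
have cQ : 0 < cnt Ai c <= Q.
  by rewrite lt0n nz leqNgt; apply/negP => /(hhit c cM); rewrite H0.
have posA w : Ai w && wt c w -> 0 < w by case/andP=> /iA /A_range /andP[].
have [|h1 h2 h3 h4] := top_end (b := b) (P := P) (Q := Q) (kap := kap) u1b Q0 kap0 P0 Qb QP ti _ cQ posA.
  by move=> p r pP rp; rewrite /all_tests /before; lia.
split; first by case/andP: h3.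
move=> w hw; rewrite (cE _ (wu _ hw)) (cE _ h1) h2; case Aw : (Ai w).
  by rewrite leq_add2l h4 ?wu // /wt l0.
have ci : cls w < i by apply: hcls; rewrite ?wu ?Aw //; case/and4P: hw.
have wl := wu _ hw.
have : (cls w).+1 * u.+1 <= i * u.+1 by rewrite leq_mul2r ci orbT.
by rewrite mulSn; lia.
Qed.

Lemma round_tri i a : i <= b -> rg a 72 = i -> rnd i a ->
  tri W lim ub round_prog a (rnd i.+1).
Proof.
move=> ib e72 [hcls hT [Ai [C hsiz hclsA htop]]].
have [r6 _ _ _ _ _ r13 _ _ _ _ _ _ _ a6 cA] := C.
pose cls' w := if Ai w then i else av a 9 w.
have cls'_le w : w < u.+1 -> cls' w <= i by move=> wu; rewrite /cls'; case: ifP => // _; exact: hcls.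
apply: tri_seq; apply: (@tri_map _ _ _ _ _ _ _ _ cls'); first by rewrite r13.
  move=> w a'; rewrite r13 => wu e81 Er Ea Et; split=> [|_].
    rewrite /= e81 Et // Ea // a6 // Er // e72 /cls'; case: (Ai w).
      by rewrite muln0 muln1.
    by rewrite muln0 addn0 muln1.
  by apply: leq_ltn_trans (leq_trans (cls'_le _ wu) ib) limb.
rewrite r13 => a1 Er1 Ea1 _ E9.
apply: tri_seq; apply: (@tri_set _ _ _ _ _ 1); [by []|by apply: leq_trans lim0|].
apply: tri_seq; apply: (@tri_set _ _ _ _ _ 0); [by []|by apply: leq_trans lim0|].
set a2 := setr _ 75 _.
have C2 : rctx Ai a2.
  apply: (rctx_eq C) => [r'|j]; rewrite !inE.
    by do !case: eqP => [->|_] //=; move=> _; rewrite /upd /= Er1.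
  by move=> hj; apply: Ea1; move: hj; do !case: eqP => [->|_] //.
have e2 : av a2 2 = av a 2 by exact: Ea1.
have e9 w : w < u.+1 -> av a2 9 w = cls' w by move=> wu; rewrite [LHS]E9 wu.
apply: tri_seq; apply: (testq_tri C2 (p := 1) (r := 0)); [by []|by []|] => a3 K3 C3 _ E5.
have [s6 _ _ _ s10 s11 s13 _ _ _ _ _ _ _ _ _] := C3.
have cntE c : cnt (tst Ai 1 0) c = cnt Ai c.
  by apply: eq_bigr => w _; rewrite /tst modn1 eqxx andbT.
have divE c : c < M -> av a3 5 c %/ BIG = cnt Ai c.
  by move=> cM; have [-> _] := divmod_cnt (E5 _ cM).
pose U0 c := Q < cnt Ai c; pose T0 c := if cnt Ai c == 0 then av a 2 c else 0.
apply: tri_seq; apply: (@tri_map _ _ _ _ _ _ _ _ (fun c => U0 c)); first by rewrite s6.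
  move=> c a'; rewrite s6 => cM e81 Er Ea Et; split=> [|_]; last exact: bool_lim.
  by rewrite /= e81 Ea // !Er // s10 s11 divE.
rewrite s6 => a4 Er4 Ea4 _ E8.
apply: tri_seq; apply: (@tri_map _ _ _ _ _ _ _ _ T0); first by rewrite Er4 // s6.
  move=> c a'; rewrite Er4 // s6 => cM e81 Er Ea Et; split=> [|_].
    rewrite /= e81 Et // Ea4 // Ea // Ea4 // Er // Er4 // s11 divE // (keep_a K3) // e2 /T0.
    by case: eqP => _; rewrite ?muln1 ?muln0.
  rewrite /T0; case: ifP => _; last by apply: leq_trans lim0.
  by apply: leq_ltn_trans (hT c) _; apply: ltn_trans u1_lim.
rewrite (Er4 6 isT) s6 => a5 Er5 Ea5 _ E2.
apply: tri_seq; apply: (@tri_map _ _ _ _ _ _ _ _ (fun _ => 0)).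
- by rewrite Er5 // Er4 // s13.
- by move=> w a' _ _ _ _ _; split=> // _; apply: leq_trans lim0.
rewrite (Er5 13 isT) (Er4 13 isT) s13 => a6' Er6 Ea6 _ E7.
have C6 : rctx Ai a6'.
  apply: (rctx_eq C3) => [r'|j]; rewrite !inE.
    by move=> hr; rewrite Er6 ?Er5 ?Er4 //; move: hr; do !case: eqP => [->|_] //.
  by move=> hj; rewrite Ea6 ?Ea5 ?Ea4 //; move: hj; do !case: eqP => [->|_] //.
have [v6 v7 _ _ _ _ v13 _ _ _ _ _ _ _ v6a _] := C6.
apply: tri_seq; apply: (@tri_sum _ _ _ _ _ _ _ _ (fun w => Ai w)); [by []|by []| | | |].
- by rewrite v13.
- by move=> w a'; rewrite v13 => wu e81 _ Ea; rewrite /= e81 Ea v6a.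
- by rewrite v13; apply: leq_ltn_trans (csize_le _ _) u1_lim.
rewrite v13 => a7 Er7 Ea7 _ e77.
have f7 : rg a7 7 = K by rewrite Er7.
have e9' w : w < u.+1 -> av a7 9 w = cls' w.
  by move=> wu; rewrite Ea7 Ea6 // Ea5 // Ea4 // (keep_a K3) // e9.
have e2' c : av a7 2 c = if c < M then T0 c else av a 2 c.
  by rewrite Ea7 Ea6 // E2 Ea4 // (keep_a K3) // e2.
apply: tri_seq; apply: (@tri_for _ _ _ _ _ _ _ (rst Ai U0 T0)); first (by rewrite f7);
  rewrite ?f7.
- split.
  + apply: (rctx_eq C6) => [r'|j _] //; rewrite !inE => hr; apply: Er7;
      move: hr; do !case: eqP => [->|_] //.
  + exact: e77.
  + move=> c; rewrite e2'; case: ifP => // _; rewrite /T0; case: ifP => // _; exact: hT.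
  + move=> c cM; rewrite e2' cM; case: ifP => // nz; rewrite /T0 nz.
    by split; [left|move=> p r w []].
  exists U0, (fun _ => false); split.
  + by move=> c cM; rewrite Ea7 Ea6 // Ea5 // E8 cM.
  + by move=> w wu; rewrite Ea7 E7 wu.
  exact: round_inv0.
- move=> j a8 jK K8 S8; apply: pass_tri; last by apply: rst_setr.
  by move=> c cM; apply: ltnW.
move=> a8 K8 S8; have := rst_setr (r := 73) K isT S8; set a9 := setr a8 73 K.
move=> [C9 _ hT9 ht9 [U [H [EU EH I]]]].
have [z6 z7 z8 z9 z10 z11 z13 z14 z16 z18 y0 y1 y3 y4 y6 yA] := C9.
have [hs hhit] := round_end (b := b) (P := P) (Q := Q) u1b Q0 kap0 P0 Qb QP I erefl M_K.
have e9'' w : w < u.+1 -> av a9 9 w = cls' w by move=> wu; rewrite /= (keep_a K8) // e9'.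
apply: (@tri_map _ _ _ _ _ _ _ _ (fun w => H w)); first by rewrite z13.
  move=> w a'; rewrite z13 => wu e81 _ Ea _; split=> [|_]; last exact: bool_lim.
  by rewrite /= e81 Ea // EH.
rewrite z13 => b1 Eb1 Eb2 _ E6; split.
- by move=> w wu; rewrite Eb2 // e9'' //; apply: leqW; exact: cls'_le.
- by move=> c; rewrite Eb2.
exists H; split.
- split; rewrite ?Eb1 //; try (by move=> k kk; rewrite Eb2 // ?y0 ?y1 ?y3 ?y4).
    by move=> w wu; rewrite E6 wu.
  by move=> w /(ri_HA I) /cA.
- by apply: leq_trans hsiz; rewrite expnS mulnA leq_mul2r [_ * 2]mulnC hs orbT.
- move=> w wu Aw nH; rewrite Eb2 // e9'' // /cls' ltnS; case: ifP => // /negbT nA.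
  by apply: ltnW; apply: hclsA.
move=> c cM l0 z; rewrite [av b1 2]Eb2 //; rewrite /rk Eb2 //.
apply: (rank_step (ri_HA I) cA hclsA e9'' htop) => //.
by apply: tcond_weak ht9.
Qed.

Lemma rounds_tri a (R : astate -> Prop) :
  rg a 6 = M -> rg a 7 = K -> rg a 8 = J -> rg a 9 = P -> rg a 10 = Q -> rg a 11 = BIG ->
  rg a 13 = u.+1 -> rg a 14 = 2 ^ K -> rg a 16 = b.+1 -> rg a 18 = kap ->
  (forall w, w < u.+1 -> av a 0 w = A w) ->
  (forall c, c < M -> av a 1 c = low u A h c) ->
  (forall c, av a 2 c = 0) ->
  (forall i, i < 2 ^ K -> av a 3 i = row u h A h.+1 i) ->
  (forall i, u < i -> av a 4 i = 0) ->
  (forall a', keep rounds_prog a a' ->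
     (forall c, c < M -> 0 < low u A h c ->
        is_top u A (fun w => av a' 9 w * u.+1 + w) c (av a' 2 c)) ->
     (forall c, av a' 2 c <= u) -> R a') ->
  tri W lim ub rounds_prog a R.
Proof.
move=> r6 r7 r8 r9 r10 r11 r13 r14 r16 r18 a0 a1 a2 a3 a4 HR.
apply: (@tri_conseq _ _ _ _ _ (rnd b.+1)); last first.
  move=> a' K' [_ hT [Ai [C hs _ htop]]]; apply: HR => // c cM l0; apply: htop => //.
  apply/eqP; rewrite -leqn0; apply: leq_trans (_ : siz Ai <= _).
    by apply: leq_sum => w _; case: (Ai w); case: (wt _ _).
  rewrite leqn0 -leqn0 -ltnS -(ltn_pmul2r (expn_gt0 2 b.+1)) mul1n.
  by apply: leq_ltn_trans hs _; rewrite ltn_exp2l.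
apply: tri_seq; apply: (@tri_map _ _ _ _ _ _ _ _ (fun _ => 0)); first by rewrite r13.
  by move=> w a' _ _ _ _ _; split=> // _; apply: leq_trans lim0.
rewrite r13 => s1 Er1 Ea1 _ E9.
apply: tri_seq; apply: (@tri_map _ _ _ _ _ _ _ _ (fun w => A w)); first by rewrite Er1 // r13.
  move=> w a'; rewrite Er1 // r13 => wu e81 _ Ea _; split=> [|_]; last exact: bool_lim.
  by rewrite /= e81 Ea // Ea1 // a0.
rewrite (Er1 13 isT) r13 => s2 Er2 Ea2 _ E6.
have f16 : rg s2 16 = b.+1 by rewrite Er2 // Er1.
apply: (@tri_for _ _ _ _ _ _ _ rnd); first (by rewrite f16); rewrite ?f16.
- split.
  + by move=> w wu; rewrite Ea2 // E9 wu.
  + by move=> c; rewrite Ea2 // Ea1 // a2.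
  exists A; split.
  + split; rewrite ?Er2 ?Er1 //; try (by move=> k kk; rewrite Ea2 // Ea1 // ?a0 ?a1 ?a3 ?a4).
    by move=> w wu; rewrite E6 wu.
  + by rewrite muln1; apply: leq_trans (csize_le _ _) u1b.
  + by move=> w _ ->.
  move=> c cM l0 z; suff : 0 < cnt A c by rewrite z.
  move: l0; rewrite /low; case: ifP => // /and3P[c0 fc mh] m0.
  have [w hw] := wit_exists A_range c0 fc.
  apply/wcnt_gt0; exists w; first by rewrite ltnS; case/andP: (wit_pos A_range hw).
  by rewrite /wt hw /low c0 fc mh m0 !andbT; case/and4P: hw.
- move=> i s3 ib K3 [hc hT [Ai [C hs hcl htop]]].
  apply: round_tri; [by []|by rewrite /= /upd eqxx|].
  split=> //; exists Ai; split=> //.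
  apply: (rctx_eq C) => // r'; rewrite /= !inE /upd.
  by do !case: eqP => [->|_] //.
move=> s3 K3 [hc hT [Ai [C hs hcl htop]]]; split=> //; exists Ai; split=> //.
apply: (rctx_eq C) => // r'; rewrite /= !inE /upd.
by do !case: eqP => [->|_] //.
Qed.

End Rounds.

(** * Parameters *)

Lemma bitlen_bounds x : 0 < x -> 0 < bitlen x /\ 2 ^ (bitlen x).-1 <= x < 2 ^ bitlen x.
Proof. by move=> x0; rewrite /bitlen trunc_logP // trunc_log_ltn. Qed.

Lemma double_le_exp2 b : 0 < b -> 2 * b <= 2 ^ b.
Proof. by case: b => // b _; rewrite expnS leq_mul2l /= ltn_expl. Qed.

Definition kstep (need k : nat) := if 2 ^ k < need then k.+1 else k.
Definition kiter (need i : nat) := iter i (kstep need) 1.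

Lemma kiterP need i : 1 < need -> [/\ 0 < kiter need i, 2 ^ kiter need i <= 2 * need,
  kiter need i <= i.+1 & need <= 2 ^ kiter need i \/ kiter need i = i.+1].
Proof.
move=> n1; elim: i => [|i [h1 h2 h3 h4]]; first by split; [..|right]; rewrite ?expn1 //= ; lia.
have -> : kiter need i.+1 = kstep need (kiter need i) by [].
rewrite /kstep; case: (ltnP (2 ^ kiter need i) need) => h; split=> //; try by [apply: leqW|left].
  by rewrite expnS leq_mul2l /= ltnW.
by right; case: h4 => [|->//]; lia.
Qed.

Definition jstep (x : nat * nat) := if 1 < x.1 then (uphalf x.1, x.2.+1) else x.
Definition jiter (K i : nat) := iter i jstep (K, 0).

Lemma jiterP K i : 0 < K -> [/\ iter (jiter K i).2 uphalf K = (jiter K i).1,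
  0 < (jiter K i).1, (jiter K i).1.-1 * 2 ^ (jiter K i).2 < K,
  2 ^ (jiter K i).2 <= 2 * K & (jiter K i).1 <= maxn 1 (K - i)].
Proof.
move=> K0; elim: i => [|i [h1 h2 h3 h4 h5]]; first by split; rewrite //= ?expn0; lia.
have -> : jiter K i.+1 = jstep (jiter K i) by [].
rewrite /jstep; case: (ltnP 1 (jiter K i).1) => h /=; last by split=> //; lia.
have := uphalf_half (jiter K i).1; have := odd_double_half (jiter K i).1.
set x := (jiter K i).1 in h1 h2 h3 h5 h *; set j := (jiter K i).2 in h1 h3 h4 * => o1 o2.
split.
- by rewrite h1.
- by lia.
- apply: leq_ltn_trans h3; rewrite expnS mulnA leq_mul2r; apply/orP; right; lia.
- rewrite expnS leq_mul2l /=; apply: leq_trans (ltnW h3); rewrite leq_pmull //; lia.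
by lia.
Qed.

Section Params.
Variable u : nat.
Hypothesis u0 : 0 < u.
Definition pb := bitlen u.
Definition ph := 8 * pb.
Definition pM := ph * u + 1.
Definition pneed := (ph + 1) * pM + (u + 1).
Definition pK := kiter pneed ph.
Definition pJ := (jiter pK pK).2.
(* [2 ^ 20 * b ^ 4] and [2 ^ 13 * b ^ 2], in factors small enough for a program *)
Definition pP := 32 * 32 * (32 * 32) * (pb * pb * (pb * pb)).
Definition pQ := 64 * 64 * 2 * (pb * pb).

Lemma pb0 : 0 < pb. Proof. by []. Qed.

Lemma u_pb : u.+1 <= 2 ^ pb.
Proof. by have [_ /andP[]] := bitlen_bounds u0. Qed.

Lemma pb_u : 2 ^ pb <= 2 * u /\ pb <= u.
Proof.
have [_ /andP[h1 _]] := bitlen_bounds u0.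
have h : 2 ^ pb <= 2 * u by rewrite -(prednK pb0) expnS leq_mul2l.
split=> //; have := double_le_exp2 pb0; lia.
Qed.

Lemma ph_large : ph.+1 * (ph * u).+1 < 2 ^ ph.
Proof.
have h1 := double_le_exp2 pb0; have h2 := u_pb; have h3 := pb0.
rewrite /ph [8 * pb]mulnC expnM; set x := 2 ^ pb in h1 h2 *.
have x2 : 2 <= x by lia.
have l1 : (pb * 8).+1 <= 5 * x by lia.
have l2 : (pb * 8 * u).+1 <= 4 * x * x by nia.
apply: leq_ltn_trans (leq_mul l1 l2) _.
have -> : 5 * x * (4 * x * x) = 20 * x ^ 3 by ring.
have -> : x ^ 8 = x ^ 5 * x ^ 3 by rewrite -expnD.
rewrite ltn_mul2r expn_gt0; apply/andP; split; first by lia.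
by apply: leq_trans (_ : 2 ^ 5 <= _) => //; rewrite leq_exp2r.
Qed.

Lemma pneed_gt1 : 1 < pneed. Proof. rewrite /pneed /pM; nia. Qed.

Lemma pneed_le : pneed <= 83 * (pb * pb * u).
Proof.
have b0 := pb0; rewrite /pneed /pM /ph.
have l1 : 8 * pb + 1 <= 9 * pb by lia.
have l2 : 8 * pb * u + 1 <= 9 * (pb * u) by nia.
have := leq_mul l1 l2; have : u <= pb * pb * u by nia.
nia.
Qed.

Lemma pKP : [/\ 0 < pK, 2 ^ pK <= 2 * pneed, pK <= ph.+1 & pneed <= 2 ^ pK].
Proof.
have [h1 h2 h3 h4] := kiterP ph pneed_gt1; split=> //.
case: h4 => // e; rewrite /pK e expnS.
have := ph_large; have := u_pb; rewrite /pneed /pM !addn1.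
have : 2 ^ pb <= 2 ^ ph by rewrite leq_exp2l // /ph; lia.
by lia.
Qed.

Lemma pK_b : pK <= 9 * pb.
Proof. by have [_ _ h _] := pKP; apply: leq_trans h _; have := pb0; rewrite /ph; lia. Qed.

Lemma pJP : iter pJ uphalf pK = 1 /\ 2 ^ pJ <= 18 * pb.
Proof.
have [K0 _ _ _] := pKP; have [h1 h2 _ h4 h5] := jiterP pK K0.
by rewrite /pJ h1; split; [lia|have := pK_b; lia].
Qed.

Lemma pKJ : 2 ^ (pK + pJ) <= 2988 * (pb * pb * pb * u).
Proof.
have [_ h _ _] := pKP; have [_ h2] := pJP; have h3 := pneed_le.
rewrite expnD; apply: leq_trans (leq_mul (leq_trans h (leq_mul (leqnn 2) h3)) h2) _.
by lia.
Qed.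

Lemma pPQ : 2 * (pQ * pb) <= primes_upto pP /\ 4 * (2 * pK * pP) <= pQ * primes_upto pP.
Proof.
have b0 := pb0; pose n := 16 * 32 * (32 * 32) * (pb * pb * (pb * pb)).
have Pn : pP = 2 * n by rewrite /pP /n; lia.
have n0 : 0 < n by rewrite /n; lia.
have Pe : 2 * n <= 2 ^ (20 * pb).
  have h := double_le_exp2 b0.
  rewrite -Pn /pP.
  have -> : 2 ^ (20 * pb) = (2 ^ pb) ^ 16 * (2 ^ pb * 2 ^ pb * (2 ^ pb * 2 ^ pb)).
    by rewrite -!expnD -expnM -expnD; congr (2 ^ _); lia.
  have b1 : pb <= 2 ^ pb by lia.
  have l2 : 32 * 32 * (32 * 32) <= (2 ^ pb) ^ 16 * 16.
    apply: leq_trans (_ : (2 ^ 1) ^ 16 * 16 <= _); first by lia.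
    by rewrite leq_mul2r /= leq_exp2r // leq_exp2l.
  set x := 2 ^ pb in h b1 l2 *; set z := x ^ 16 in l2 *.
  have hh : 4 * (pb * pb) <= x * x by nia.
  have := leq_mul hh hh; nia.
have := primes_upto_lower n0 Pe; rewrite -Pn; set p := primes_upto _ => hp.
have hb : 128 * 200 * (pb * pb * pb) <= p.
  rewrite -(@leq_pmul2l (20 * pb)); last by lia.
  by apply: leq_trans hp; rewrite /n; nia.
split; first by rewrite /pQ; nia.
have hK := pK_b; rewrite /pP /pQ.
have : 8 * (9 * pb) * (32 * 32 * (32 * 32) * (pb * pb * (pb * pb))) <=
   64 * 64 * 2 * (pb * pb) * (128 * 200 * (pb * pb * pb)) by nia.
nia.
Qed.
End Params.

(** * Running time *)

Fixpoint psize (c : acmd) : nat :=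
  match c with
  | Sq c1 c2 => psize c1 + psize c2
  | Cn e c1 c2 => (ecost (cexp e) + (psize c1 + psize c2)).+1
  | Fo _ _ c1 => 14 + psize c1
  | _ => tb id c
  end.

Fixpoint nest (p : pred nat) (c : acmd) : nat :=
  match c with
  | Sq c1 c2 | Cn _ c1 c2 => maxn (nest p c1) (nest p c2)
  | Fo _ rb c1 => nest p c1 + p rb
  | _ => 0
  end.

Lemma tb_nest (big : pred nat) ub c N S : 0 < N -> 0 < S ->
  (forall r, ub r <= if big r then N else S) ->
  tb ub c <= psize c * (N ^ nest big c * S ^ nest (predC big) c).
Proof.
move=> N0 S0 hub; have leaf k : k <= k * (N ^ 0 * S ^ 0) by rewrite !muln1.
have mono x y x' y' : x <= x' -> y <= y' -> N ^ x * S ^ y <= N ^ x' * S ^ y'.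
  by move=> h1 h2; apply: leq_mul; apply: leq_pexp2l.
have pos x y : 0 < N ^ x * S ^ y by rewrite muln_gt0 !expn_gt0 N0 S0.
elim: c => [|r e|j e1 e2|r e|e1 e2|c1 IH1 c2 IH2|e c1 IH1 c2 IH2|r rb c1 IH] /=;
  try exact: leaf.
- rewrite mulnDl; apply: leq_add; [apply: leq_trans IH1 _|apply: leq_trans IH2 _];
    by rewrite leq_mul2l mono ?orbT // ?leq_maxl ?leq_maxr.
- have h1 := leq_trans IH1 (leq_mul (leqnn (psize c1)) (mono _ _ _ _
     (leq_maxl (nest big c1) (nest big c2)) (leq_maxl (nest (predC big) c1) (nest (predC big) c2)))).
  have h2 := leq_trans IH2 (leq_mul (leqnn (psize c2)) (mono _ _ _ _
     (leq_maxr (nest big c1) (nest big c2)) (leq_maxr (nest (predC big) c1) (nest (predC big) c2)))).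
  move: h1 h2; set X := N ^ _ * _; have : 0 < X by exact: pos.
  move: (ecost _) => k X0 h1 h2; have hk : k <= k * X by rewrite leq_pmulr.
  by rewrite mulSn !mulnDl; lia.
set X := N ^ _ * _ in IH *; set Y := N ^ _ * _.
have XY : ub rb * X <= Y.
  apply: leq_trans (leq_mul (hub rb) (leqnn X)) _; rewrite /Y /X.
  by case: (big rb); rewrite ?addn0 !addn1 !expnS; nia.
have X0 : 0 < X by exact: pos.
have Y0 : 0 < Y by exact: pos.
have := leq_mul (leqnn (ub rb)) IH; rewrite mulnCA => h.
have := leq_mul (leqnn (psize c1)) XY; nia.
Qed.

(** * The complete program *)

Definition read_prog :=
  Fo 71 3 (Sq (GetR 72 (Va 71 +& Nu 1)) (Put 0 (Va 72) (Nu 1))).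

Definition b_loop :=
  Fo 71 1 (Cn (Va 20 <& (Va 1 +& Nu 1))
    (Sq (Set_ 20 (Nu 2 *& Va 20)) (Set_ 4 (Va 4 +& Nu 1))) Nop).

Definition K_loop :=
  Fo 71 5 (Cn (Va 14 <& Va 21)
    (Sq (Set_ 14 (Nu 2 *& Va 14)) (Set_ 7 (Va 7 +& Nu 1))) Nop).

Definition J_loop :=
  Fo 71 7 (Cn (Nu 1 <& Va 22)
    (Sq (Set_ 22 ((Va 22 +& Nu 1) /& Nu 2)) (Set_ 8 (Va 8 +& Nu 1))) Nop).

Definition init_prog :=
  Sq (Set_ 4 (Nu 0)) (Sq (Set_ 20 (Nu 1)) (Sq b_loop
  (Sq (Set_ 5 (Nu 8 *& Va 4))
  (Sq (Set_ 6 (Va 5 *& Va 1 +& Nu 1))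
  (Sq (Set_ 21 ((Va 5 +& Nu 1) *& Va 6 +& (Va 1 +& Nu 1)))
  (Sq (Set_ 7 (Nu 1)) (Sq (Set_ 14 (Nu 2)) (Sq K_loop
  (Sq (Set_ 8 (Nu 0)) (Sq (Set_ 22 (Va 7)) (Sq J_loop
  (Sq (Set_ 13 (Va 1 +& Nu 1)) (Sq (Set_ 15 (Va 2 +& Nu 1))
  (Sq (Set_ 9 (Nu 32 *& Nu 32 *& (Nu 32 *& Nu 32) *& (Va 4 *& Va 4 *& (Va 4 *& Va 4))))
  (Sq (Set_ 10 (Nu 64 *& Nu 64 *& Nu 2 *& (Va 4 *& Va 4)))
  (Sq (Set_ 11 (Va 13 *& Va 13)) (Sq (Set_ 16 (Va 4 +& Nu 1))
      (Set_ 18 (Nu 2 *& Va 7))))))))))))))))))).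

Lemma read_tri W lim ub n (w : n.-tuple nat) a (R : astate -> Prop) :
  128 <= lim -> rg a 3 = n -> n <= ub 3 -> n < rg a 0 ->
  (forall i, rw a i = nth 0 (0 :: w) i) -> (forall i, i < n -> nth 0 w i < lim) ->
  (forall i, av a 0 i = 0) ->
  (forall a', keep read_prog a a' -> (forall x, av a' 0 x = (x \in tval w)) -> R a') ->
  tri W lim ub read_prog a R.
Proof.
move=> lim0 e3 b3 n0 ew wl z HR.
apply: (@tri_conseq _ _ _ _ _ (fun a' => forall x, av a' 0 x = (x \in tval w)));
  last by move=> a' k h; apply: HR.
apply: (@tri_for _ _ _ _ _ _ _ (fun i a' => forall x, av a' 0 x = (x \in take i w))).
- by rewrite e3.
- by move=> x; rewrite z take0.
- move=> i a1; rewrite e3 => iN K1 I1.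
  have ew1 : rw a1 i.+1 = nth 0 w i by rewrite (keep_w K1) // ew.
  apply: tri_seq; apply: (@tri_getr _ _ _ _ _ i.+1).
  + by rewrite /= /upd /= addn1.
  + by rewrite /= /upd /= (keep_r K1) //; apply: leq_trans n0.
  + by rewrite /= ew1; exact: wl.
  rewrite /= ew1; apply: (@tri_put _ _ _ _ _ _ (nth 0 w i) 1) => //; first by lia.
  move=> x; rewrite /= /upd I1 (take_nth 0) ?size_tuple // mem_rcons inE.
  by case: eqP.
by move=> a1 K1 I1 x; rewrite /= I1 e3 take_oversize // size_tuple.
Qed.

Section Init.
Variables (W lim : nat) (ub : nat -> nat) (u t : nat).
Hypothesis u0 : 0 < u.
Hypotheses (lim0 : 128 <= lim) (limK : 2 ^ (pK u + pJ u).+2 < lim) (limP : pP u < lim)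
  (limB : u.+1 * (u.+1 * u.+1 + u.+1) < lim) (limt : u + t + 2 < lim).
Hypotheses (ub1 : u <= ub 1) (ub5 : ph u <= ub 5) (ub7 : pK u <= ub 7).

Local Notation b := (pb u).

Lemma b_loop_tri a (R : astate -> Prop) : rg a 1 = u -> rg a 4 = 0 -> rg a 20 = 1 ->
  (forall a', keep b_loop a a' -> rg a' 4 = b -> R a') -> tri W lim ub b_loop a R.
Proof.
move=> e1 e4 e20 HR; apply: (@tri_conseq _ _ _ _ _ (fun a' => rg a' 4 = b));
  last by move=> a' k h; apply: HR.
pose I i a' := [/\ rg a' 20 = 2 ^ rg a' 4, i <= rg a' 4 \/ u < 2 ^ rg a' 4 &
  0 < rg a' 4 -> 2 ^ (rg a' 4).-1 <= u].
apply: (@tri_for _ _ _ _ _ _ _ I); first by rewrite e1.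
- by split; rewrite ?e20 ?e4 //; left.
- move=> i a1; rewrite e1 => iu K1 [I1 I2 I3].
  have f1 : rg a1 1 = u by rewrite (keep_r K1).
  apply: tri_cn; rewrite /= /upd /= f1 I1 addn1 ltnS; case: leqP => // h _.
    have x_lt := ltn_expl (rg a1 4) (isT : 1 < 2).
    apply: tri_seq; apply: (@tri_set _ _ _ _ _ (2 ^ (rg a1 4).+1)).
    + by rewrite /= /upd /= I1 expnS.
    + by rewrite expnS; nia.
    apply: (@tri_set _ _ _ _ _ (rg a1 4).+1).
    + by rewrite /= /upd /= addn1.
    + by lia.
    split=> //=; rewrite /upd //=.
    by case: I2 => h2; [left|lia].
  by apply: tri_nop; split=> //=; rewrite /upd /=; [right].
move=> a1 K1; rewrite e1 => -[I1 I2 I3]; rewrite /= /upd /=.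
have h : u < 2 ^ rg a1 4.
  case: I2 => // h; apply: leq_trans (ltn_expl u (isT : 1 < 2)) _; exact: leq_pexp2l.
have r0 : 0 < rg a1 4 by case: (rg a1 4) h u0 => //; rewrite expn0; lia.
by rewrite /pb /bitlen (@trunc_log_eq 2 (rg a1 4).-1) ?prednK // I3.
Qed.

Lemma K_loop_tri a (R : astate -> Prop) : rg a 5 = ph u -> rg a 7 = 1 -> rg a 14 = 2 ->
  rg a 21 = pneed u ->
  (forall a', keep K_loop a a' -> rg a' 7 = pK u -> rg a' 14 = 2 ^ pK u -> R a') ->
  tri W lim ub K_loop a R.
Proof.
move=> e5 e7 e14 e21 HR.
apply: (@tri_conseq _ _ _ _ _ (fun a' => rg a' 7 = pK u /\ rg a' 14 = 2 ^ pK u));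
  last by move=> a' k [*]; apply: HR.
have [_ _ _ need_K] := pKP u0.
apply: (@tri_for _ _ _ _ _ _ _ (fun i a' => rg a' 7 = kiter (pneed u) i /\
    rg a' 14 = 2 ^ kiter (pneed u) i)); first by rewrite e5.
- by rewrite e7 e14.
- move=> i a1; rewrite e5 => ih K1 [I1 I2].
  have f21 : rg a1 21 = pneed u by rewrite (keep_r K1).
  have E : kiter (pneed u) i.+1 = kstep (pneed u) (kiter (pneed u) i) by [].
  rewrite E /kstep; move: I1 I2; set k := kiter _ _ => I1 I2.
  apply: tri_cn; rewrite /= /upd /= f21 I2; case: ltnP => // h _.
    have k_lt := ltn_expl k (isT : 1 < 2).
    have kK : 2 ^ k.+1 < lim.
      apply: leq_ltn_trans limK; apply: leq_pexp2l => //.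
      have : k < pK u by rewrite -(ltn_exp2l _ _ (isT : 1 < 2)); apply: leq_trans need_K.
      by lia.
    apply: tri_seq; apply: (@tri_set _ _ _ _ _ (2 ^ k.+1)) => //.
      by rewrite /= /upd /= I2 expnS.
    apply: (@tri_set _ _ _ _ _ k.+1).
    + by rewrite /= /upd /= I1 addn1.
    + by apply: ltn_trans kK; apply: ltn_expl.
    by [].
by move=> a1 K1; rewrite e5.
Qed.

Lemma J_loop_tri a (R : astate -> Prop) : rg a 7 = pK u -> rg a 8 = 0 -> rg a 22 = pK u ->
  (forall a', keep J_loop a a' -> rg a' 8 = pJ u -> R a') ->
  tri W lim ub J_loop a R.
Proof.
move=> e7 e8 e22 HR.
apply: (@tri_conseq _ _ _ _ _ (fun a' => rg a' 8 = pJ u));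
  last by move=> a' k h; apply: HR.
have [K0 _ _ _] := pKP u0.
have Kl : pK u < lim.
  by apply: ltn_trans limK; apply: leq_trans (ltn_expl _ (isT : 1 < 2)) _;
    apply: leq_pexp2l => //; lia.
apply: (@tri_for _ _ _ _ _ _ _ (fun i a' => [/\ rg a' 22 = (jiter (pK u) i).1,
    rg a' 8 = (jiter (pK u) i).2 & rg a' 8 <= i /\ rg a' 22 <= pK u])); first by rewrite e7.
- by rewrite e8 e22.
- move=> i a1; rewrite e7 => ih K1 [I1 I2 [I3 I4]].
  have -> : jiter (pK u) i.+1 = jstep (jiter (pK u) i) by [].
  rewrite /jstep -I1 -I2.
  apply: tri_cn; rewrite /= /upd /=; case: ltnP => // h _.
    have uE : (rg a1 22 + 1) %/ 2 = uphalf (rg a1 22) by rewrite addn1 divn2 uphalfE.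
    apply: tri_seq; apply: (@tri_set _ _ _ _ _ (uphalf (rg a1 22))).
    + by rewrite /= /upd.
    + by rewrite -uE; lia.
    apply: (@tri_set _ _ _ _ _ (rg a1 8).+1).
    + by rewrite /= /upd /= addn1.
    + by lia.
    by split=> //=; rewrite /upd //=; lia.
  by apply: tri_nop; split=> //=; rewrite /upd /=; lia.
by move=> a1 K1; rewrite e7 => -[_ I2 _].
Qed.

Lemma init_tri a (R : astate -> Prop) : rg a 1 = u -> rg a 2 = t ->
  (forall a', keep init_prog a a' ->
     [/\ rg a' 4 = b, rg a' 5 = ph u, rg a' 6 = (ph u * u).+1, rg a' 7 = pK u & rg a' 8 = pJ u] ->
     [/\ rg a' 9 = pP u, rg a' 10 = pQ u, rg a' 11 = u.+1 * u.+1 & rg a' 13 = u.+1] ->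
     [/\ rg a' 14 = 2 ^ pK u, rg a' 15 = t.+1, rg a' 16 = b.+1 & rg a' 18 = 2 * pK u] ->
     R a') -> tri W lim ub init_prog a R.
Proof.
move=> e1 e2 HR.
apply: (@tri_conseq _ _ _ _ _ (fun a' =>
     [/\ rg a' 4 = b, rg a' 5 = ph u, rg a' 6 = (ph u * u).+1, rg a' 7 = pK u & rg a' 8 = pJ u] /\
     [/\ rg a' 9 = pP u, rg a' 10 = pQ u, rg a' 11 = u.+1 * u.+1 & rg a' 13 = u.+1] /\
     [/\ rg a' 14 = 2 ^ pK u, rg a' 15 = t.+1, rg a' 16 = b.+1 & rg a' 18 = 2 * pK u]));
  last by move=> a' k [? [? ?]]; apply: HR.
have b0 := pb0 u; have bK := pK_b u0; have [_ _ _ nK] := pKP u0.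
have Kl : 2 ^ pK u < lim.
  by apply: leq_ltn_trans limK; apply: leq_pexp2l => //; lia.
have Pb : 100 * b <= pP u.
  have h : b <= b * b * (b * b) by rewrite -!mulnA leq_pmulr // !muln_gt0 b0.
  by rewrite /pP; move: (b * b * (b * b)) h => X h; lia.
have Mn : ph u * u + 1 <= pneed u.
  by rewrite /pneed /pM; apply: leq_trans (leq_addr _ _); rewrite leq_pmull // addn1.
apply: tri_seq; apply: (@tri_set _ _ _ _ _ 0); [by []|by lia|].
apply: tri_seq; apply: (@tri_set _ _ _ _ _ 1); [by []|by lia|].
apply: tri_seq; apply: b_loop_tri; [by rewrite /= /upd /=|by []|by []|] => a1 K1 f4.
have f1 : rg a1 1 = u by rewrite (keep_r K1).
have f2 : rg a1 2 = t by rewrite (keep_r K1).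
apply: tri_seq; apply: (@tri_set _ _ _ _ _ (ph u)); [by rewrite /= f4|by rewrite /ph; lia|].
apply: tri_seq; apply: (@tri_set _ _ _ _ _ (ph u * u + 1)); [by rewrite /= /upd /= f1|by lia|].
apply: tri_seq; apply: (@tri_set _ _ _ _ _ (pneed u)); [by rewrite /= /upd /= f1|by lia|].
apply: tri_seq; apply: (@tri_set _ _ _ _ _ 1); [by []|by lia|].
apply: tri_seq; apply: (@tri_set _ _ _ _ _ 2); [by []|by lia|].
apply: tri_seq; apply: K_loop_tri; [by []|by []|by []|by []|] => a2 K2 g7 g14.
have g := keep_r K2.
apply: tri_seq; apply: (@tri_set _ _ _ _ _ 0); [by []|by lia|].
apply: tri_seq; apply: (@tri_set _ _ _ _ _ (pK u)); [by rewrite /= /upd /=|by lia|].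
apply: tri_seq; apply: J_loop_tri; [by rewrite /= /upd /=|by []|by []|] => a3 K3 k8.
have k := keep_r K3.
have k1 : rg a3 1 = u by rewrite k //= /upd /= g.
have k2 : rg a3 2 = t by rewrite k //= /upd /= g.
have k4 : rg a3 4 = b by rewrite k //= /upd /= g.
have k5 : rg a3 5 = ph u by rewrite k //= /upd /= g.
have k6 : rg a3 6 = (ph u * u).+1 by rewrite k //= /upd /= g //= /upd /= addn1.
have k7 : rg a3 7 = pK u by rewrite k.
have k14 : rg a3 14 = 2 ^ pK u by rewrite k.
apply: tri_seq; apply: (@tri_set _ _ _ _ _ u.+1); [by rewrite /= k1 addn1|by nia|].
apply: tri_seq; apply: (@tri_set _ _ _ _ _ t.+1); [by rewrite /= /upd /= k2 addn1|by lia|].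
apply: tri_seq; apply: (@tri_set _ _ _ _ _ (pP u)); [by rewrite /= /upd /= k4|by []|].
apply: tri_seq; apply: (@tri_set _ _ _ _ _ (pQ u)); [by rewrite /= /upd /= k4| |].
  apply: leq_ltn_trans limP; rewrite /pQ /pP.
  have h : b * b <= b * b * (b * b) by rewrite leq_pmulr // muln_gt0 b0.
  by move: (b * b * (b * b)) h => X h; lia.
apply: tri_seq; apply: (@tri_set _ _ _ _ _ (u.+1 * u.+1)); [by []|by nia|].
apply: tri_seq; apply: (@tri_set _ _ _ _ _ b.+1); [by rewrite /= /upd /= k4 addn1|by lia|].
apply: (@tri_set _ _ _ _ _ (2 * pK u)); [by rewrite /= /upd /= k7|by lia|].
by do !split; rewrite //= /upd /=.
Qed.

End Init.

Definition output_prog :=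
  Fo 71 2 (Cn (Ar 10 (Va 71 +& Nu 1) <& Va 15)
    (PutR (Va 71 +& Nu 1) (Op MS (Nu 0) (Ar 10 (Va 71 +& Nu 1))))
    (PutR (Va 71 +& Nu 1) (Op MA (Op Sr (Op MS (Nu 0) (Nu 1)) (Nu 1)) (Nu 1)))).

Definition rest_prog :=
  Sq init_prog (Sq levels (Sq rounds_prog (Sq dp_prog output_prog))).

Lemma half_word W : 0 < W ->
  ((0 + (2 ^ W - 1 %% 2 ^ W)) %% 2 ^ W %/ 2 ^ 1 + 1) %% 2 ^ W = 2 ^ W.-1.
Proof.
case: W => // W _; rewrite add0n /= expn1.
have h1 : 1 < 2 ^ W.+1 by rewrite expnS; have := expn_gt0 2 W; lia.
have h2 : 2 ^ W.+1 - 1 < 2 ^ W.+1 by lia.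
rewrite (modn_small h1) (modn_small h2).
have -> : (2 ^ W.+1 - 1) %/ 2 = 2 ^ W - 1.
  rewrite expnS (_ : 2 * 2 ^ W - 1 = (2 ^ W - 1) * 2 + 1) ?divnMDl ?addn0 //.
  by have := expn_gt0 2 W; lia.
by rewrite subnK ?expn_gt0 // modn_small // ltn_exp2l.
Qed.

Lemma output_tri W lim ub t a F (R : astate -> Prop) : 0 < W ->
  rg a 2 = t -> rg a 15 = t.+1 -> t < rg a 0 -> t <= ub 2 ->
  (forall c, c <= t -> av a 10 c = F c) ->
  (forall a', keep output_prog a a' -> (forall c, 1 <= c <= t ->
     rw a' c = if F c <= t then (2 ^ W - F c %% 2 ^ W) %% 2 ^ W else 2 ^ W.-1) -> R a') ->
  tri W lim ub output_prog a R.
Proof.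
move=> W0 e2 e15 e0 b2 E10 HR.
pose o c := if F c <= t then (2 ^ W - F c %% 2 ^ W) %% 2 ^ W else 2 ^ W.-1.
apply: (@tri_conseq _ _ _ _ _ (fun a' => forall c, 1 <= c <= t -> rw a' c = o c));
  last by move=> a' k h; apply: HR.
apply: (@tri_for _ _ _ _ _ _ _ (fun i a' => forall c, 1 <= c <= i -> rw a' c = o c)).
- by rewrite e2.
- by case.
- move=> i a1; rewrite e2 => it K1 I1.
  have f0 : rg a1 0 = rg a 0 by rewrite (keep_r K1).
  have f10 : av a1 10 i.+1 = F i.+1 by rewrite (keep_a K1) // E10.
  have f15 : rg a1 15 = t.+1 by rewrite (keep_r K1).
  have post v : v = o i.+1 -> forall c, 1 <= c <= i.+1 -> rw (setw a1 i.+1 v) c = o c.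
    move=> -> c hc; rewrite /= /upd; case: eqP => [->//|ne]; apply: I1; lia.
  apply: tri_cn; rewrite /= /upd /= f15 addn1 f10 ltnS => hF.
    apply: (@tri_putr _ _ _ _ _ i.+1 ((2 ^ W - F i.+1 %% 2 ^ W) %% 2 ^ W)).
    + by rewrite /= /upd /= addn1.
    + by rewrite /= /upd /= addn1 f10 add0n.
    + by rewrite /= /upd /= f0; apply: leq_ltn_trans e0.
    by apply: post; rewrite /o; case: (F i.+1 <= t) hF.
  apply: (@tri_putr _ _ _ _ _ i.+1 (2 ^ W.-1)).
  + by rewrite /= /upd /= addn1.
  + exact: half_word.
  + by rewrite /= /upd /= f0; apply: leq_ltn_trans e0.
  by apply: post; rewrite /o; case: (F i.+1 <= t) hF.
by move=> a1 K1; rewrite e2.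
Qed.

Section Solutions.
Variables (n : nat) (w : n.-tuple nat).
Let A x := x \in tval w.

Lemma sol_of_solution c (m : n.-tuple nat) : solution w c m ->
  exists2 s, sol A c s & size s = \sum_(i < n) tnth m i.
Proof.
move=> ->; exists (flatten [seq nseq (tnth m i) (tnth w i) | i <- enum 'I_n]).
  rewrite /sol; apply/andP; split.
    apply/allP => x /flattenP[s /mapP[i _ ->]]; rewrite mem_nseq => /andP[_ /eqP ->].
    exact: mem_tnth.
  apply/eqP; rewrite sumn_flatten -map_comp sumnE big_map big_enum /=.
  by apply: eq_bigr => i _; rewrite sumn_nseq.
rewrite size_flatten /shape -map_comp sumnE big_map big_enum /=.
by apply: eq_bigr => i _; rewrite size_nseq.
Qed.

Lemma solution_of_sol c s : sol A c s ->
  exists2 m : n.-tuple nat, solution w c m & \sum_(i < n) tnth m i = size s.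
Proof.
case/andP=> As /eqP <-; elim: s As => [_|x s IH /= /andP[/tnthP[i ->] /IH[m sm zm]]].
  by exists [tuple 0 | i < n]; rewrite /solution big1 // => i _; rewrite tnth_mktuple ?muln0.
exists [tuple tnth m j + (j == i) | j < n].
  rewrite /solution sm (bigD1 i) //= [RHS](bigD1 i) //= tnth_mktuple eqxx addn1 mulnS.
  rewrite -addnA; congr (_ + (_ + _)); apply: eq_bigr => j /negbTE ji.
  by rewrite tnth_mktuple ji addn0.
rewrite -zm (bigD1 i) //= [in RHS](bigD1 i) //= tnth_mktuple eqxx addn1 addSn.
by congr (_ + _).+1; apply: eq_bigr => j /negbTE ji; rewrite tnth_mktuple ji addn0.
Qed.

Variables u : nat.
Hypothesis w_range : forall i, 1 <= tnth w i <= u.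

Lemma coin_range x : A x -> 0 < x <= u.
Proof. by case/tnthP=> i ->. Qed.

Lemma optimum c : is_optimum w c
  (if feasible u A c then Some (- (mincoins u A c)%:Z)%R else None).
Proof.
case f: (feasible u A c) => /=; last first.
  move=> m /sol_of_solution[s /(sol_feasible coin_range)]; by rewrite f.
split=> [|m /sol_of_solution[s ss sz]].
  have [s /solution_of_sol[m sm zm] sz] := mincoins_sol coin_range f.
  by exists m => //; rewrite /objective zm sz.
by rewrite /objective lerN2 lez_nat -sz; exact: (mincoins_min coin_range).
Qed.

End Solutions.

Lemma word_of_neg W k : 0 < k < 2 ^ W ->
  word_of W (Some (- k%:Z)%R) = (2 ^ W - k %% 2 ^ W) %% 2 ^ W.
Proof.
case/andP=> k0 kW; rewrite /= (modn_small kW) modn_small; last by lia.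
have -> : (- k%:Z = (2 ^ W - k)%N%:Z - (2 ^ W)%N%:Z)%R.
  by rewrite -subzn ?(ltnW kW) // addrAC subrr sub0r.
rewrite -[(- (2 ^ W)%N%:Z)%R]mulN1r addrC modzMDl modz_small //.
by rewrite lez_nat ltz_nat /=; lia.
Qed.

Definition time_ub (u t r : nat) : nat :=
  match r with
  | 1 => u | 2 => t | 5 => ph u | 6 => (ph u * u).+1 | 7 => pK u | 8 => pJ u
  | 9 => pP u | 13 => u.+1 | 14 => 2 ^ pK u | 15 => t.+1 | 16 => (pb u).+1
  | 56 | 57 => 2 ^ (pK u + pJ u) | 59 => (pK u).+1 | 65 => 2 ^ (pK u).+1
  | 76 => pP u | _ => 0
  end.

Definition big_reg : pred nat := fun r => r \in [:: 1; 2; 6; 13; 14; 15; 56; 57; 65].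

Lemma time_ub_le u t : 0 < u -> 0 < t -> forall r,
  time_ub u t r <= if big_reg r then 2988 * (pb u * pb u * pb u * (u + t)) else pP u.
Proof.
move=> u0 t0; set b := pb u; have b0 : 0 < b by [].
have [_ nK _ _] := pKP u0; have nl := pneed_le u0; have Kb := pK_b u0.
have [_ J2] := pJP u0; have J1 := ltn_expl (pJ u) (isT : 1 < 2).
have KJ := pKJ u0; rewrite -/b in nl Kb J2 KJ.
have b3 : b * b <= b * b * b by rewrite leq_pmulr.
have s1 : b <= b * b by rewrite leq_pmulr.
have bu : b * b * u <= b * b * b * u by rewrite leq_mul2r b3 orbT.
have ut : b * b * b * (u + t) = b * b * b * u + b * b * b * t by rewrite mulnDr.
have tt : t <= b * b * b * t by rewrite leq_pmull // !muln_gt0 b0.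
have uu : u <= b * b * b * u by rewrite leq_pmull // !muln_gt0 b0.
have Mu : b * u <= b * b * b * u by rewrite leq_mul2r; apply/orP; right; lia.
have Pb : 100 * b <= pP u.
  have h : b <= b * b * (b * b) by rewrite -!mulnA leq_pmulr // !muln_gt0 b0.
  by rewrite /pP -/b; move: (b * b * (b * b)) h => X h; lia.
rewrite ut; move: (b * b * b * u) (b * b * b * t) bu tt uu Mu KJ => X Y bu tt uu Mu KJ.
have hM : (ph u * u).+1 <= 9 * X by rewrite /ph -/b; move: Mu uu u0; rewrite -mulnA; lia.
have hK : 2 ^ pK u <= 166 * X by move: nK nl bu; move: (2 ^ _) (pneed u) (b * b * u) => x y z; lia.
have hK1 : 2 ^ (pK u).+1 <= 332 * X by rewrite expnS; lia.
move=> r; do 80?[case: r => [|r] //=]; rewrite /ph -?/b; lia.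
Qed.

Lemma rest_time : exists c, forall u t, 0 < u -> 0 < t ->
  tb (time_ub u t) rest_prog <= c * ((u + t) * pb u ^ 27).
Proof.
exists (psize rest_prog * (2988 * (32 * 32 * (32 * 32)) ^ 6)) => u t u0 t0.
set N := 2988 * (pb u * pb u * pb u * (u + t)).
have N0 : 0 < N by rewrite !muln_gt0 addn_gt0 u0.
have S0 : 0 < pP u by rewrite !muln_gt0.
apply: leq_trans (tb_nest (big := big_reg) rest_prog N0 S0 (time_ub_le u0 t0)) _.
have -> : nest big_reg rest_prog = 1 by vm_compute.
have -> : nest (predC big_reg) rest_prog = 6 by vm_compute.
rewrite -[leqRHS]mulnA leq_mul2l; apply/orP; right.
rewrite /N /pP expn1; move: 2988 (32 * 32 * (32 * 32)) (pb u) (u + t) => c d b s.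
by rewrite leq_eqVlt; apply/orP; left; apply/eqP; ring.
Qed.

Lemma lim_bounds u t y : 0 < u -> 3 < y -> u + t < y ->
  [/\ 2 ^ (pK u + pJ u).+2 < y ^ 32, pP u < y ^ 32,
      u.+1 * (u.+1 * u.+1 + u.+1) < y ^ 32, u + t + 2 < y ^ 32 & 128 <= y ^ 32].
Proof.
move=> u0 y3 uty; have [_ bu] := pb_u u0; have KJ := pKJ u0.
have y0 : 0 < y by lia.
have big d x : d < 32 -> x <= y ^ d -> x < y ^ 32.
  by move=> d32 h; apply: leq_ltn_trans h _; rewrite ltn_exp2l //; lia.
have y1 : 4 ^ 1 <= y ^ 1 by rewrite !expn1.
have p3 : 4 ^ 3 <= y ^ 3 by rewrite leq_exp2r.
have p5 : 4 ^ 5 <= y ^ 5 by rewrite leq_exp2r.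
have uy : u <= y by lia.
have by_ : pb u <= y by lia.
split.
- apply: (big 11) => //; rewrite [2 ^ _.+2]expnS [2 ^ _.+1]expnS mulnA.
  have h : pb u * pb u * pb u * u <= y ^ 4.
    by rewrite -[4]/(1 + 1 + 1 + 1) !expnD expn1; do !apply: leq_mul.
  have h2 : 2988 <= y ^ 6.
    by rewrite -[6]/(3 + 3) expnD; apply: leq_trans (leq_mul p3 p3); lia.
  apply: leq_trans (leq_mul (leqnn _) (leq_trans KJ (leq_mul h2 h))) _.
  rewrite -expnD -[11]/(1 + 10) [leqRHS]expnD leq_mul2r; apply/orP; right.
  by apply: leq_trans y1.
- apply: (big 14) => //; rewrite /pP.
  have h : pb u * pb u * (pb u * pb u) <= y ^ 4.
    by rewrite -[4]/(1 + 1 + (1 + 1)) !expnD expn1; do !apply: leq_mul.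
  have h2 : 32 * 32 * (32 * 32) <= y ^ 10.
    rewrite -[10]/(5 + 5) expnD; apply: leq_mul; apply: leq_trans p5; lia.
  by rewrite -[14]/(10 + 4) expnD; apply: leq_mul.
- apply: (big 5) => //.
  have u1 : u.+1 <= y by lia.
  have h : u.+1 * u.+1 + u.+1 <= y ^ 3.
    have := leq_mul u1 u1; rewrite !expnS expn0; nia.
  apply: leq_trans (leq_mul u1 h) _; rewrite -expnS leq_exp2l //; lia.
- apply: (big 2) => //; rewrite expnS expn1; nia.
apply: ltnW; apply: (big 4) => //.
by apply: leq_trans (_ : 4 ^ 4 <= _); [lia|rewrite leq_exp2r].
Qed.

Section Program.
Variables (n u t : nat) (w : n.-tuple nat) (W : nat).
Hypotheses (u0 : 0 < u) (t0 : 0 < t) (w_range : forall i, 1 <= tnth w i <= u).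
Let y := 2 ^ bitlen (n + u + t).
Hypothesis HW : 384 * bitlen (n + u + t) < W.
Let lim := y ^ 32.
Let A x := x \in tval w.

Lemma y_gt : n + u + t < y.
Proof. by have [|_ /andP[]] := @bitlen_bounds (n + u + t); first by lia. Qed.

Lemma lim_W : lim ^ 12 <= 2 ^ W.
Proof.
rewrite /lim /y -!expnM leq_exp2l //; apply: ltnW; apply: leq_ltn_trans HW.
by rewrite mulnC.
Qed.

Definition start : astate :=
  AState (upd (upd (nth 0 [:: n; u; t]) 3 n) 0 (n + t + 1)) (fun _ _ => 0)
         (nth 0 (0 :: w)).

Definition prologue : cmd :=
  Seq (Assign 3 (Reg 0)) (Assign 0 (Bin OAdd (Bin OAdd (Reg 0) (Reg 2)) (Const 1))).

Hypothesis y3 : 3 < y.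

Lemma lim_big : [/\ 2 ^ (pK u + pJ u).+2 < lim, pP u < lim,
  u.+1 * (u.+1 * u.+1 + u.+1) < lim, u + t + 2 < lim & 128 <= lim].
Proof. by apply: lim_bounds => //; have := y_gt; lia. Qed.

Lemma y_lim : y * y <= lim.
Proof. by rewrite /lim -(expnD y 1 1) leq_exp2l //; lia. Qed.

Lemma prologue_exec : exists s, exec W prologue (input_state u t w) s 8 /\ rep W lim s start.
Proof.
have [_ _ _ _ l128] := lim_big; have yy := y_lim; have yt := y_gt.
have limW : lim <= 2 ^ W.
  by apply: leq_trans lim_W; rewrite -{1}[lim]expn1 leq_pexp2l //; lia.
have b1 : n + t < 2 ^ W by nia.
have b2 : n + t + 1 < 2 ^ W by nia.
have b3 : 1 < 2 ^ W by lia.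
eexists; split.
  have -> : 8 = 2 + 6 by [].
  by apply: ExecSeq; exact: ExecAssign.
have nl : n + t + 1 < lim by nia.
split=> //=.
- by move=> r; rewrite /upd /= (modn_small b3) (modn_small b1) (modn_small b2).
- move=> r; rewrite /upd; case: eqP => // _; case: eqP => [_|_]; first by nia.
  by case: r => [|[|[|r]]] /=; rewrite ?nth_nil; nia.
- by move=> j i _ _; rewrite nth_default //= size_tuple /upd /=; lia.
all: by move=> *; lia.
Qed.

Lemma rest_tri a : keep read_prog start a -> (forall x, av a 0 x = A x) ->
  tri W lim (time_ub u t) rest_prog a (fun a' => forall c, 1 <= c <= t ->
    rw a' c = if (if feasible u A c then mincoins u A c else t.+1) <= t
              then (2 ^ W - mincoins u A c %% 2 ^ W) %% 2 ^ W else 2 ^ W.-1).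
Proof.
move=> K1 E0; have [lK lP lB lt l128] := lim_big.
have [K0 _ _ nK] := pKP u0; have [KJ _] := pJP u0; have b0 : 0 < pb u by [].
have A_range x : A x -> 0 < x <= u by exact: coin_range.
have h0 : 0 < ph u by rewrite muln_gt0.
have MK : (ph u).+1 * (ph u * u).+1 + u.+1 <= 2 ^ pK u.
  by move: nK; rewrite /pneed /pM !addn1.
have lW := lim_W.
have ub8 : pJ u <= time_ub u t 8 by [].
have [qb qp] := pPQ u0.
have Q0 : 0 < pQ u by rewrite !muln_gt0.
have P0 : 0 < pP u by rewrite !muln_gt0.
have e1 : rg a 1 = u by rewrite (keep_r K1).
have e2 : rg a 2 = t by rewrite (keep_r K1).
have e0 : rg a 0 = n + t + 1 by rewrite (keep_r K1).
have Ml : (ph u * u).+1 < lim.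
  apply: leq_ltn_trans lK; apply: leq_trans (leq_trans MK _); last by apply: leq_pexp2l => //; lia.
  by rewrite mulSn -addnA leq_addr.
have bP : pb u <= pP u.
  rewrite /pP mulnC; apply: leq_trans (leq_pmulr _ _) => //.
  by rewrite -!mulnA leq_pmulr // !muln_gt0 b0.
have hl : ph u < lim by apply: leq_ltn_trans Ml; apply: leqW; rewrite leq_pmulr.
apply: tri_seq; apply: (@init_tri W lim (time_ub u t) u t u0 l128 lK lP lB lt (leqnn _) (leqnn _) (leqnn _) _ _ e1 e2).
move=> a1 K2 [r4 r5 r6 r7 r8] [r9 r10 r11 r13] [r14 r15 r16 r18].
have za j i : j != 0 -> av a1 j i = 0.
  by move=> j1; rewrite (keep_a K2) // (keep_a K1) // !inE.
have f0 x : x < u.+1 -> av a1 0 x = A x by rewrite (keep_a K2).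
have u2l : u.+2 <= lim by apply: leq_ltn_trans lB; rewrite mulSn; lia.
have g0 : rg a1 0 = n + t + 1 by rewrite (keep_r K2).
have g2 : rg a1 2 = t by rewrite (keep_r K2).
apply: tri_seq.
apply: (@levels_tri W lim (time_ub u t) (pK u) (pJ u) l128 lW lK (leqnn _) (leqnn _) (leqnn _) (leqnn _) (leqnn _) (leqnn _) K0 KJ u (ph u) A A_range h0 MK
  _ _ u0 r5 r6 r7 r8 r13 r14 (leqnn _) (leqnn _) (leqnn _) u2l Ml hl f0 (fun i => za 1 i isT) (fun i => za 3 i isT) (fun i => za 4 i isT)).
move=> a2 K3 F1 F1' F3 F4.
have s r : r \notin modr levels -> rg a2 r = rg a1 r := @keep_r _ _ _ K3 r.
have s6 := etrans (s 6 isT) r6.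
have s7 := etrans (s 7 isT) r7.
have s8 := etrans (s 8 isT) r8.
have s9 := etrans (s 9 isT) r9.
have s10 := etrans (s 10 isT) r10.
have s11 := etrans (s 11 isT) r11.
have s13 := etrans (s 13 isT) r13.
have s14 := etrans (s 14 isT) r14.
have s16 := etrans (s 16 isT) r16.
have s18 := etrans (s 18 isT) r18.
have f0' x : x < u.+1 -> av a2 0 x = A x by move=> xu; rewrite (keep_a K3) // f0.
have f2' i : av a2 2 i = 0 by rewrite (keep_a K3) // za.
apply: tri_seq.
apply: (@rounds_tri W lim (time_ub u t) (pK u) (pJ u) l128 lW lK (leqnn _) (leqnn _) (leqnn _) (leqnn _) (leqnn _) (leqnn _) K0 KJ u (ph u) A A_range h0 u0 MK
  (pP u) (pQ u) (pb u) (u_pb u0) Q0 P0 qb qp lB Ml lP (leq_ltn_trans bP lP)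
  (leqnn _) (leqnn _) (leqnn _) (leqnn _) (leqnn _) (leqnn _) a2
  _ s6 s7 s8 s9 s10 s11 s13 s14 s16 s18 f0' F1 f2' F3 F4).
move=> a3 K4 top_ok top_le.
have s3 r : r \notin modr rounds_prog -> rg a3 r = rg a2 r := @keep_r _ _ _ K4 r.
have F13 : av a3 1 = av a2 1 by rewrite (keep_a K4).
have q5 : rg a3 5 = ph u by rewrite s3 // s.
have q13 : rg a3 13 = u.+1 by rewrite s3.
have q15 : rg a3 15 = t.+1 by rewrite s3 // s.
apply: tri_seq; apply: (@dp_prog_tri W lim (time_ub u t) u t (ph u) A a3 A_range (ph_large u0)
  q5 q13 q15 (leqnn _) (leqnn _) lt).
- by move=> i; apply: leq_ltn_trans (top_le i) _; lia.
- move=> c; rewrite F13; case: (ltnP c (ph u * u).+1) => cM; last by rewrite F1'.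
  rewrite F1 // => l0; have tc := top_ok c cM l0; move: l0.
  rewrite {1 2}/low; case: ifP => // /and3P[c0 fc mh] _; split=> //.
  apply/esym; apply: (top_eq A_range _ tc).
  move=> x x' /A_range hx /A_range hx' E.
  have x1 : x < u.+1 by lia.
  have x1' : x' < u.+1 by lia.
  by have := congr1 (modn^~ u.+1) E; rewrite /= !modnMDl !modn_small.
- move=> c c0 fc mh; rewrite F13 F1; first by rewrite /low c0 fc mh mincoins_gt0.
  rewrite ltnS; apply: leq_trans (mincoins_lower A_range fc) _.
  by rewrite leq_mul2r mh orbT.
move=> a4 K5 E10.
have W0 : 0 < W by apply: leq_ltn_trans HW.
have p0 : t < rg a4 0 by rewrite (keep_r K5) // s3 // s // g0; lia.
have p2 : rg a4 2 = t by rewrite (keep_r K5) // s3 // s.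
have p15 : rg a4 15 = t.+1 by rewrite (keep_r K5).
apply: (@output_tri W lim (time_ub u t) t a4
  (fun c => if feasible u A c then mincoins u A c else t.+1) _ W0 p2 p15 p0 (leqnn _) E10).
move=> a5 K6 out c hc; rewrite out //.
by case: (feasible u A c) => //; rewrite ltnn.
Qed.
End Program.

(* [n - u] is truncated: it vanishes when n <= u, in particular for pairwise
   distinct weights; otherwise it pays for reading the surplus, necessarily
   repeated, weights, which no bound in u and t alone can cover. *)
Theorem theorem22 :
  exists (p : cmd) (a C k : nat), 0 < a /\
  forall (n u t : nat) (w : n.-tuple nat) (W : nat),
    valid_instance u t w ->
    a * bitlen (n + u + t) < W ->
    exists (s : state) (T : nat),
      [/\ exec W p (input_state u t w) s T,
          correct_output W t w s
        & T <= C * ((u + t) * bitlen u ^ k + (n - u))].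
Proof.
have [c hc] := rest_time.
exists (Seq prologue (Seq (comp read_prog) (comp rest_prog))), 384.
exists (40 + c), 27; split=> // n u t w W [n0 u0 t0 w_range] HW.
have yn := y_gt u0 t0 HW; have y3 : 3 < 2 ^ bitlen (n + u + t) by lia.
have lW := lim_W HW; have [_ _ _ lt l128] := lim_big u0 t0 HW y3.
have yy := y_lim u0 t0 HW y3.
set lim := (2 ^ bitlen (n + u + t)) ^ 32 in lW lt l128 yy.
have [s0 [X0 R0]] := prologue_exec w u0 t0 HW y3.
pose A x := x \in tval w.
have [okr [K1 E0]] : tri W lim (fun=> n) read_prog (start u t w)
    (fun a' => keep read_prog (start u t w) a' /\ forall x, av a' 0 x = A x).
  apply: (@read_tri W lim (fun=> n) n w) => //.
  - by rewrite /= /upd /=; lia.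
  - move=> i iN; have -> : nth 0 w i = tnth w (Ordinal iN) by rewrite (tnth_nth 0).
    by have /andP[_ h] := w_range (Ordinal iN); lia.
have [s1 [T1 [X1 R1 B1]]] := comp_ok l128 lW (isT : wf read_prog) okr R0.
have [ok2 out] := rest_tri u0 t0 w_range HW y3 K1 E0.
have [s2 [T2 [X2 R2 B2]]] := comp_ok l128 lW (isT : wf rest_prog) ok2 R1.
exists s2, (8 + (T1 + T2)); split.
- exact: ExecSeq X0 (ExecSeq X1 X2).
- move=> x hx; exists (if feasible u A x then Some (- Posz (mincoins u A x))%R else None).
    exact: optimum.
  have x0 : x < rg (run W rest_prog (run W read_prog (start u t w))) 0.
    by rewrite !run_r //= /upd /=; lia.
  rewrite (rep_w R2 x0) out //; case f: (feasible u A x); last by rewrite ltnn.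
  have mx : mincoins u A x <= x by [].
  have A_range y : A y -> 0 < y <= u by exact: coin_range.
  rewrite (leq_trans mx); last by case/andP: hx.
  rewrite word_of_neg // (mincoins_gt0 A_range) /=; last by case/andP: hx.
  have lW1 : lim <= 2 ^ W by apply: leq_trans lW; rewrite -{1}[lim]expn1 leq_pexp2l //; lia.
  lia.
have B2' := leq_trans B2 (hc u t u0 t0).
have B1' : T1 <= 6 + n * 22 by exact: B1.
rewrite -/(pb u); move: B2'; set X := (u + t) * _ => B2'.
have uX : u + t <= X by rewrite leq_pmulr // expn_gt0.
have nX : n <= X + (n - u) by lia.
rewrite mulnDl; have cX : c * X <= c * (X + (n - u)) by rewrite leq_mul2l leq_addr orbT.
lia.
Qed.
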